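(* Let $T=(T^1,\dots,T^p)$ with all $T^i>0$ and $T_0=[0,T^1]\times\dots\times[0,T^p]\subset\mathbb{R}^p$. Suppose the function $F:T_0\times\mathbb{R}^n\to\mathbb{R}$, $(t,u)\mapsto F(t,u)$, satisfies the following four properties: 1) $F(t,u)$ is measurable in $t$ for every $u\in\mathbb{R}^n$ and continuously differentiable in $u$ for every $t\in T_0$; 2) there exist $a\in C^1(\mathbb{R}^+,\mathbb{R}^+)$ with derivative $a'$ bounded from above, and $b\in C(T_0,\mathbb{R}^+)$, such that for all $t\in T_0$ and all $u\in\mathbb{R}^n$, $|F(t,u)|\le a(|u|)\,b(t)$ and $|\nabla_uF(t,u)|\le a(|u|)\,b(t)$; 3) there exists $g\in C^1(T_0,\mathbb{R})$ such that for all $t\in T_0$ and all $u\in\mathbb{R}^n$, $|\nabla_uF(t,u)|\le g(t)$; 4) the action $\varphi_1(u)=\int_{T_0}F(t,u(t))\,dt$ is weakly lower semi-continuous on $H_T^1$. If $\int_{T_0}F(t,u)\,dt\to\infty$ when $|u|\to\infty$ (with $u\in\mathbb{R}^n$ constant), then the boundary value problem $$\Delta u(t)=\nabla F(t,u(t)),$$ $$u|_{S_i^-}=u|_{S_i^+},\qquad \frac{\partial u}{\partial t}\Big|_{S_i^-}=\frac{\partial u}{\partial t}\Big|_{S_i^+},\qquad i=1,\dots,p,$$ has at least one solution which minimizes the action $$\varphi(u)=\int_{T_0}\left[\frac12\left|\frac{\partial u}{\partial t}\right|^2+F(t,u(t))\right]dt$$ in $H_T^1$.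
   Context: Here $dt=dt^1\wedge\dots\wedge dt^p$ denotes Lebesgue measure on $T_0$, $\mathbb{R}^+=[0,\infty)$, and $|\cdot|$ is the Euclidean norm. $C_T^\infty$ is the space of infinitely differentiable functions $\mathbb{R}^p\to\mathbb{R}^n$ that are multiply $T$-periodic, i.e. periodic with period $T^\alpha$ in the variable $t^\alpha$ for each $\alpha=1,\dots,p$. $H_T^1=W_T^{1,2}$ is the Hilbert space of functions $u\in L^2(T_0,\mathbb{R}^n)$ having weak derivatives $\partial u/\partial t=(\partial u^i/\partial t^\alpha)_{i,\alpha}$ in $L^2$, where weak derivatives are defined by testing against functions in $C_T^\infty$ (so they encode periodicity): $\int_{T_0}(u,\partial f/\partial t^\alpha)\,dt=-\int_{T_0}(\partial u/\partial t^\alpha,f)\,dt$ for all $f\in C_T^\infty$. Its scalar product is $\langle u,v\rangle=\int_{T_0}\big(\sum_i u^iv^i+\sum_{i,\alpha}\frac{\partial u^i}{\partial t^\alpha}\frac{\partial v^i}{\partial t^\alpha}\big)dt$, and $\left|\frac{\partial u}{\partial t}\right|^2=\sum_{i,\alpha}\left(\frac{\partial u^i}{\partial t^\alpha}\right)^2$. $S_i^-$ and $S_i^+$ are the opposite faces of $T_0$ given by $t^i=0$ and $t^i=T^i$. $\nabla F=\nabla_uF$ is the gradient in the variable $u$. The equation is understood a.e. on $T_0$, with $\Delta u$ the weak Laplacian defined by $\int_{T_0}\sum_{i,\alpha}\frac{\partial u^i}{\partial t^\alpha}\frac{\partial v^i}{\partial t^\alpha}\,dt=-\int_{T_0}(\Delta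 u,v)\,dt$ for all $v\in C_T^\infty$; the boundary conditions are the periodicity conditions in the sense corresponding to the existence of the weak derivatives $\partial u/\partial t$ and $\Delta u$ with respect to the periodic test functions $C_T^\infty$. *)

(* Defs.v *)
From HB Require Import structures.
From mathcomp Require Import all_boot all_order all_algebra.
From mathcomp Require Import all_classical all_reals all_analysis.

Set Implicit Arguments.
Unset Strict Implicit.
Unset Printing Implicit Defensive.

Import Order.TTheory GRing.Theory Num.Theory.
Import numFieldNormedType.Exports.

Local Open Scope classical_set_scope.
Local Open Scope ring_scope.

Section tuple_step.
Context (R : realType) (p : nat).
Local Notation RT := (measurableTypeR R).

Definition tuple_cons (x : RT * p.-tuple RT) : p.+1.-tuple RT :=
  [the p.+1.-tuple RT of x.1 :: x.2].

Lemma measurable_tuple_cons : measurable_fun setT tuple_cons.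
Proof. exact: measurable_cons. Qed.

Variable m : {sigma_finite_measure set (p.-tuple RT) -> \bar R}.

Definition lebesgue_tuple_step : set (p.+1.-tuple RT) -> \bar R :=
  pushforward (lebesgue_measure \x m)%E tuple_cons.

Let mcons (A : set (p.+1.-tuple RT)) :
  measurable A -> measurable (tuple_cons @^-1` A).
Proof.
by move=> mA; rewrite -[X in measurable X]setTI; exact: measurable_tuple_cons.
Qed.

Let step0 : lebesgue_tuple_step set0 = 0%E.
Proof. by rewrite /lebesgue_tuple_step /pushforward preimage_set0 measure0. Qed.

Let step_ge0 (A : set (p.+1.-tuple RT)) : (0 <= lebesgue_tuple_step A)%E.
Proof. exact: (measure_ge0 (lebesgue_measure \x m)%E). Qed.

Let step_sigma_additive : semi_sigma_additive lebesgue_tuple_step.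
Proof.
move=> F mF tF mUF; rewrite /lebesgue_tuple_step /pushforward preimage_bigcup.
apply: measure_semi_sigma_additive.
- by move=> n; exact: mcons.
- apply/trivIsetP => i j _ _ ij; rewrite -preimage_setI.
  by move/trivIsetP : tF => /(_ _ _ _ _ ij) ->//; rewrite preimage_set0.
- by rewrite -preimage_bigcup; exact: mcons.
Qed.

HB.instance Definition _ := isMeasure.Build _ _ _ lebesgue_tuple_step
  step0 step_ge0 step_sigma_additive.

Let step_sigma_finite : sigma_finite setT lebesgue_tuple_step.
Proof.
have /sigma_finiteP[F [TF ndF Foo]] :=
  sigma_finiteT (@lebesgue_measure R : {sigma_finite_measure set RT -> \bar R}).
have /sigma_finiteP[G [TG ndG Goo]] := sigma_finiteT m.
pose uncons (t : p.+1.-tuple RT) : RT * p.-tuple RT := (thead t, behead_tuple t).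
have munc : measurable_fun setT uncons.
  apply/measurable_fun_pairP; split; first exact: measurable_tnth.
  exact: measurable_behead.
have consK x : uncons (tuple_cons x) = x.
  by case: x => x t; congr (_, _); apply/val_inj.
exists (fun k => uncons @^-1` (F k `*` G k)).
  apply/esym; rewrite -subTset => t _.
  have [k _ Fk] : (\bigcup_k F k) (uncons t).1 by rewrite -TF.
  have [l _ Gl] : (\bigcup_k G k) (uncons t).2 by rewrite -TG.
  exists (maxn k l) => //; split.
  - by move: Fk; exact/subsetPset/ndF/leq_maxl.
  - by move: Gl; exact/subsetPset/ndG/leq_maxr.
move=> k; have [mFk Fk_oo] := Foo k; have [mGk Gk_oo] := Goo k.
split; first by rewrite -[X in measurable X]setTI; exact: (munc measurableT _ (measurableX mFk mGk)).
rewrite /lebesgue_tuple_step /pushforward -comp_preimage.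
rewrite (_ : uncons \o _ = id); last by apply/funext => x; exact: consK.
by rewrite preimage_id product_measure1E// lte_mul_pinfty// ge0_fin_numE.
Qed.

HB.instance Definition _ := Measure_isSigmaFinite.Build _ _ _
  lebesgue_tuple_step step_sigma_finite.

End tuple_step.

Fixpoint lebesgue_tuple (R : realType) (p : nat) :
    {sigma_finite_measure set (p.-tuple (measurableTypeR R)) -> \bar R} :=
  match p with
  | 0 => \d_([tuple] : 0.-tuple (measurableTypeR R))
  | p'.+1 => lebesgue_tuple_step (lebesgue_tuple R p')
  end.

(* Row vectors carry the topology and the tuples the sigma-algebra, so the
   outer measure of the product is transported along the coordinates. *)
Definition lebesgue_outer (R : realType) (p : nat) (A : set 'rV[R]_p) : \bar R :=
  mu_ext (lebesgue_tuple R p)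
    [set x : p.-tuple (measurableTypeR R) | A (\row_i tnth x i)].

Section lebesgue_outer_is_outer_measure.
Context (R : realType) (p : nat).
Local Notation outer := (@lebesgue_outer R p).

Let outer0 : outer set0 = 0%E.
Proof. exact: mu_ext0. Qed.

Let outer_ge0 (A : set 'rV[R]_p) : (0 <= outer A)%E.
Proof. exact: mu_ext_ge0. Qed.

Let le_outer : {homo outer : A B / A `<=` B >-> (A <= B)%E}.
Proof. by move=> A B AB; apply: le_mu_ext => x; exact: AB. Qed.

Let outer_sigma_subadditive : sigma_subadditive outer.
Proof.
by move=> F; exact: (mu_ext_sigma_subadditive
  (measure_ge0 (lebesgue_tuple R p)) (fun k => [set x | F k (\row_i tnth x i)])).
Qed.

HB.instance Definition _ := isOuterMeasure.Build R _ outer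
  outer0 outer_ge0 le_outer outer_sigma_subadditive.

End lebesgue_outer_is_outer_measure.

(* R^p with the (complete) sigma-algebra of Lebesgue measurable sets. *)
Notation lebesgue_space R p := (caratheodory_type (@lebesgue_outer R p)).

Definition lebesgue (R : realType) (p : nat) :
  set (lebesgue_space R p) -> \bar R := @lebesgue_outer R p.

HB.instance Definition _ (R : realType) (p : nat) :=
  isMeasure.Build _ _ _ (@lebesgue R p)
    (caratheodory_measure0 (@lebesgue_outer R p))
    (caratheodory_measure_ge0 (mu := @lebesgue_outer R p))
    (caratheodory_measure_sigma_additive (mu := @lebesgue_outer R p)).

Definition mxdot (R : realType) (m k : nat) (A B : 'M[R]_(m, k)) : R :=
  \sum_i \sum_j A i j * B i j.

(* [`| x |] is the sup norm on row vectors. *)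
Definition enorm (R : realType) (n : nat) (x : 'rV[R]_n) : R :=
  Num.sqrt (mxdot x x).

Definition basis_vec (R : realType) (p : nat) (a : 'I_p) : 'rV[R]_p :=
  delta_mx 0 a.

Definition partial (R : realType) (p : nat) (W : normedModType R) (a : 'I_p)
  (f : 'rV[R]_p -> W) : 'rV[R]_p -> W := 'D_(basis_vec R a) f.

Definition gradient (R : realType) (n : nat) (f : 'rV[R]_n -> R)
    (x : 'rV[R]_n) : 'rV[R]_n :=
  \row_i partial i (f : 'rV[R]_n -> R^o) x.

Fixpoint Cn (R : realType) (p : nat) (W : normedModType R) (k : nat)
    (f : 'rV[R]_p -> W) : Prop :=
  continuous f /\
  if k is k'.+1 then
    forall a, (forall t, derivable f t (basis_vec R a)) /\ Cn k' (partial a f)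
  else True.

(* [df] is the derivative of [f] in direction [v] on [D], all increments staying
   in [D]: at the boundary of a box or of a half-line it is one-sided. *)
Definition continuous_derivative_within (R : realType) (V : normedModType R)
    (D : set V) (v : V) (f df : V -> R) : Prop :=
  {within D, continuous df} /\
  forall x, D x ->
    h^-1 * (f (x + h *: v) - f x)
      @[h --> within [set h | D (x + h *: v)] (0 : R)^'] --> df x.

Definition box (R : realType) (p : nat) (T : 'rV[R]_p) : set 'rV[R]_p :=
  [set t | forall a, 0 <= t 0 a <= T 0 a].

Definition C1_box (R : realType) (p : nat) (T : 'rV[R]_p) (g : 'rV[R]_p -> R) :
    Prop :=
  {within box T, continuous g} /\
  forall a, exists dg, continuous_derivative_within (box T) (basis_vec R a) g dg.

Definition smooth_periodic (R : realType) (p n : nat) (T : 'rV[R]_p) :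
    set ('rV[R]_p -> 'rV[R]_n) :=
  [set f : 'rV[R]_p -> 'rV[R]_n |
    (forall k, Cn k f) /\ forall a t, f (t + T 0 a *: basis_vec R a) = f t].

Definition L2 (R : realType) (p m k : nat) (T : 'rV[R]_p) :
    set ('rV[R]_p -> 'M[R]_(m, k)) :=
  [set f : 'rV[R]_p -> 'M[R]_(m, k) |
    (forall i j, measurable_fun (box T : set (lebesgue_space R p))
                   (fun t => f t i j)) /\
    (\int[@lebesgue R p]_(t in box T) (mxdot (f t) (f t))%:E < +oo)%E].

(* [Du t] is the n x p matrix of the weak derivatives [du^i/dt^a] at [t]. *)
Definition is_weak_gradient (R : realType) (p n : nat) (T : 'rV[R]_p)
    (u : 'rV[R]_p -> 'rV[R]_n) (Du : 'rV[R]_p -> 'M[R]_(n, p)) : Prop :=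
  L2 T Du /\
  forall f a, smooth_periodic T f ->
    \int[@lebesgue R p]_(t in box T) mxdot (u t) (partial a f t) =
    - \int[@lebesgue R p]_(t in box T) mxdot (col a (Du t))^T (f t).

(* Elements are functions, not classes modulo equality a.e. on the box; their
   values outside the box are irrelevant. *)
Definition H1 (R : realType) (p n : nat) (T : 'rV[R]_p) :
    set ('rV[R]_p -> 'rV[R]_n) :=
  [set u : 'rV[R]_p -> 'rV[R]_n | L2 T u /\ exists Du, is_weak_gradient T u Du].

(* Weak gradients are unique a.e., so the choice made by [xget] is immaterial
   under an integral. *)
Definition weak_gradient (R : realType) (p n : nat) (T : 'rV[R]_p)
    (u : 'rV[R]_p -> 'rV[R]_n) : 'rV[R]_p -> 'M[R]_(n, p) :=
  xget (fun=> 0) [set Du | is_weak_gradient T u Du].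

Definition H1_dot (R : realType) (p n : nat) (T : 'rV[R]_p)
    (u v : 'rV[R]_p -> 'rV[R]_n) : R :=
  \int[@lebesgue R p]_(t in box T)
    (mxdot (u t) (v t) + mxdot (weak_gradient T u t) (weak_gradient T v t)).

Definition H1_weak_cvg (R : realType) (p n : nat) (T : 'rV[R]_p)
    (u_ : nat -> 'rV[R]_p -> 'rV[R]_n) (u : 'rV[R]_p -> 'rV[R]_n) : Prop :=
  forall h, H1 T h -> H1_dot T (u_ k) h @[k --> \oo] --> H1_dot T u h.

(* Sequential weak lower semi-continuity. *)
Definition H1_weakly_lsc (R : realType) (p n : nat) (T : 'rV[R]_p)
    (phi : ('rV[R]_p -> 'rV[R]_n) -> \bar R) : Prop :=
  forall (u_ : nat -> 'rV[R]_p -> 'rV[R]_n) u,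
    (forall k, H1 T (u_ k)) -> H1 T u -> H1_weak_cvg T u_ u ->
    (phi u <= limn_einf (fun k => phi (u_ k)))%E.

Definition potential_action (R : realType) (p n : nat) (T : 'rV[R]_p)
    (F : 'rV[R]_p -> 'rV[R]_n -> R) (u : 'rV[R]_p -> 'rV[R]_n) : \bar R :=
  (\int[@lebesgue R p]_(t in box T) (F t (u t))%:E)%E.

Definition action (R : realType) (p n : nat) (T : 'rV[R]_p)
    (F : 'rV[R]_p -> 'rV[R]_n -> R) (u : 'rV[R]_p -> 'rV[R]_n) : \bar R :=
  (\int[@lebesgue R p]_(t in box T)
    (2^-1 * mxdot (weak_gradient T u t) (weak_gradient T u t) + F t (u t))%:E)%E.

Definition is_weak_laplacian (R : realType) (p n : nat) (T : 'rV[R]_p)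
    (u Lu : 'rV[R]_p -> 'rV[R]_n) : Prop :=
  L2 T Lu /\
  forall v, smooth_periodic T v ->
    \int[@lebesgue R p]_(t in box T)
      mxdot (weak_gradient T u t) (\matrix_(i, a) partial a v t 0 i) =
    - \int[@lebesgue R p]_(t in box T) mxdot (Lu t) (v t).

(* The periodic boundary conditions on [u] and on its first derivatives are
   those encoded by testing [H1] and the weak Laplacian against periodic
   functions. *)
Definition periodic_solution (R : realType) (p n : nat) (T : 'rV[R]_p)
    (F : 'rV[R]_p -> 'rV[R]_n -> R) (u : 'rV[R]_p -> 'rV[R]_n) : Prop :=
  H1 T u /\
  exists Lu, is_weak_laplacian T u Lu /\
    {ae @lebesgue R p, forall t, box T t -> Lu t = gradient (F t) (u t)}.

(* Main.v *)
(* Fourier analysis with real scalars: the Hartley functions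
   [e_m t = cos (w_m . t) + sin (w_m . t)], [m] in Z^p, are orthogonal in [L^2],
   and a partial derivative maps [e_m] to a multiple of [e_(-m)]. They are complete
   because polynomials in cosines converge boundedly to indicators of boxes. By Parseval, the distance of [u] to its projection on [|m| <= N] is at
   most [kappa / (N + 1) * |Du|]: [N = 0] is the Poincare-Wirtinger inequality
   and [N -> oo] gives the compactness of H^1 in L^2.
   Since [|grad F| <= g] is bounded on the box, the potential is Lipschitz in
   [L^2]; hence minimizing sequences are bounded, converge strongly in [L^2] along
   an ultrafilter, and, by the parallelogram identity, their gradients converge
   strongly too. The minimizer solves the Euler-Lagrange equation. *)
Require Import Defs.
From mathcomp Require Import all_boot all_order all_algebra.
From mathcomp Require Import all_classical all_reals all_analysis.
From mathcomp Require Import measurable_realfun ring lra zify.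

Set Implicit Arguments.
Unset Strict Implicit.
Unset Printing Implicit Defensive.

Import Order.TTheory GRing.Theory Num.Theory.
Import numFieldNormedType.Exports.

Local Open Scope classical_set_scope.
Local Open Scope ring_scope.

(** * Square integrable functions *)

(** A minimizing sequence is bounded because [u] splits into its mean and its oscillation. The
    oscillation is controlled by [|Du|] and the potential is Lipschitz, so the change of potential
    due to the oscillation is absorbed by half of the kinetic term; what remains controls the
    potential at the constant [mean u], where coercivity applies. A single ultrafilter makes all
    Fourier coefficients converge at once, with uniformly small tails, and an ordinary Cauchy
    sequence can be picked from it. The gradients follow because the midpoint of two almost
    minimizers cannot have energy below the infimum, while its potential is close to theirs. Two
    obstacles shape the rest. Orthogonality to the Hartley functions yields vanishing integrals only
    over Borel sets, whereas the integral lives on the Carathéodory sigma-algebra: measurable sets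
    are replaced by Borel hulls. And a weak gradient is determined only almost everywhere: the
    argument carries explicit pairs of a function and a gradient, and returns to the chosen
    [weak_gradient] at the end. *)

Lemma discriminant_le0 (R : realFieldType) (a b c : R) : 0 <= a -> 0 <= c ->
  (forall s, 0 <= a + 2 * s * b + s ^+ 2 * c) -> b ^+ 2 <= a * c.
Proof.
move=> a0 c0 H; have [c00|cn0] := eqVneq c 0.
  have [->|bn0] := eqVneq b 0; first by rewrite expr0n mulr_ge0.
  (* With [c = 0] the quadratic is affine in [s]; this [s] makes it equal to [-1]. *)
  have := H (- (a + 1) / (2 * b)); rewrite c00 mulr0 addr0.
  have -> : 2 * (- (a + 1) / (2 * b)) * b = - (a + 1) by field; rewrite bn0.
  by move=> h; lra.
have cgt0 : 0 < c by rewrite lt_def cn0.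
have := H (- b / c).
have -> : a + 2 * (- b / c) * b + (- b / c) ^+ 2 * c = (a * c - b ^+ 2) / c.
  by field.
by rewrite pmulr_lge0 ?invr_gt0// subr_ge0.
Qed.

Section square_integrable.
Context d (X : measurableType d) (R : realType).
Variables (mu : {measure set X -> \bar R}) (D : set X) (mD : measurable D).
Implicit Types f g h : X -> R.

Definition sqint f :=
  measurable_fun D f /\ mu.-integrable D (EFin \o (fun t => f t * f t)).

Definition ip f g : R := \int[mu]_(t in D) (f t * g t).

Lemma eq_int f g : (forall t, D t -> f t = g t) ->
  mu.-integrable D (EFin \o f) -> mu.-integrable D (EFin \o g).
Proof.
move=> fg; apply: eq_integrable => // t tD /=.
by rewrite fg//; exact: set_mem.
Qed.

Lemma intD f g : mu.-integrable D (EFin \o f) -> mu.-integrable D (EFin \o g) ->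
  mu.-integrable D (EFin \o (fun t => f t + g t)).
Proof. by move=> If Ig; exact: (integrableD mD If Ig). Qed.

Lemma intZ c f : mu.-integrable D (EFin \o f) ->
  mu.-integrable D (EFin \o (fun t => c * f t)).
Proof. by move=> If; exact: (integrableZl mD c If). Qed.

Lemma intB f g : mu.-integrable D (EFin \o f) -> mu.-integrable D (EFin \o g) ->
  mu.-integrable D (EFin \o (fun t => f t - g t)).
Proof. by move=> If Ig; exact: (integrableB mD If Ig). Qed.

Lemma sqintP f : measurable_fun D f ->
  (\int[mu]_(t in D) (f t * f t)%:E < +oo)%E -> sqint f.
Proof.
move=> mf foo; split => //; apply/integrableP; split.
  by apply/measurable_EFinP; exact: measurable_funM.
rewrite (eq_integral (fun t => (f t * f t)%:E))// => t _ /=.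
by rewrite ger0_norm// -expr2 sqr_ge0.
Qed.

Lemma eq_sqint f g : {in D, f =1 g} -> sqint f -> sqint g.
Proof.
move=> fg [mf If]; split.
  by apply: (eq_measurable_fun f) => // x xD; rewrite fg.
by apply: eq_int If => x /mem_set xD; rewrite fg.
Qed.

Lemma sqintM f g : sqint f -> sqint g ->
  mu.-integrable D (EFin \o (fun t => f t * g t)).
Proof.
move=> [mf If] [mg Ig].
apply: (le_integrable mD _ _ (intD If Ig)).
  by apply/measurable_EFinP; exact: measurable_funM.
move=> t _ /=; rewrite lee_fin normrM -(ger0_norm (normr_ge0 (f t))).
have : 0 <= (`|f t| - `|g t|) ^+ 2 by rewrite sqr_ge0.
rewrite -!expr2 -!(real_normK (num_real (f t))) -(real_normK (num_real (g t))).
have := normr_ge0 (f t); have := normr_ge0 (g t).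
rewrite [X in _ -> _ -> _ -> _ <= X]ger0_norm ?addr_ge0 ?sqr_ge0// normr_id.
by move: `|f t| `|g t| => a b; nra.
Qed.

Lemma sqintZ c f : sqint f -> sqint (fun t => c * f t).
Proof.
move=> [mf If]; split; first exact: measurable_funM.
apply: eq_int (intZ (c * c) If) => t _; ring.
Qed.

Lemma sqintD f g : sqint f -> sqint g -> sqint (fun t => f t + g t).
Proof.
move=> sf sg; have := sqintM sf sg; move: sf sg => [mf If] [mg Ig] Ifg.
split; first exact: measurable_funD.
apply: eq_int (intD (intD If Ig) (intZ 2 Ifg)) => t _; ring.
Qed.

Lemma sqintB f g : sqint f -> sqint g -> sqint (fun t => f t - g t).
Proof.
move=> sf sg; have := sqintD sf (sqintZ (-1) sg).
by apply: eq_sqint => t _; rewrite mulN1r.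
Qed.

Lemma sqint0 : sqint (fun=> 0).
Proof.
split; first exact: measurable_cst.
by apply: (@eq_int (fun=> 0)); [move=> t _; rewrite mulr0|exact: integrable0].
Qed.

Lemma sqint_sum I (s : seq I) (P : pred I) (F : I -> X -> R) :
  (forall i, P i -> sqint (F i)) -> sqint (fun t => \sum_(i <- s | P i) F i t).
Proof.
move=> sF; elim: s => [|i s IH].
  by apply: eq_sqint sqint0 => t _; rewrite big_nil.
have [Pi|nPi] := boolP (P i).
  by apply: eq_sqint (sqintD (sF _ Pi) IH) => t _; rewrite big_cons Pi.
by apply: eq_sqint IH => t _; rewrite big_cons (negbTE nPi).
Qed.

Lemma eq_ip f f' g g' : {in D, f =1 f'} -> {in D, g =1 g'} -> ip f g = ip f' g'.
Proof. by move=> ff gg; apply: eq_Rintegral => t tD; rewrite ff// gg. Qed.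

Lemma ipC f g : ip f g = ip g f.
Proof. by apply: eq_Rintegral => t _; rewrite mulrC. Qed.

Lemma ipDl f g h : sqint f -> sqint g -> sqint h ->
  ip (fun t => f t + g t) h = ip f h + ip g h.
Proof.
move=> sf sg sh; rewrite /ip -RintegralD//; try exact: sqintM.
by apply: eq_Rintegral => t _; rewrite mulrDl.
Qed.

Lemma ipZl c f h : sqint f -> sqint h -> ip (fun t => c * f t) h = c * ip f h.
Proof.
move=> sf sh; rewrite /ip -RintegralZl//; try exact: sqintM.
by apply: eq_Rintegral => t _; rewrite mulrA.
Qed.

Lemma ipBl f g h : sqint f -> sqint g -> sqint h ->
  ip (fun t => f t - g t) h = ip f h - ip g h.
Proof.
move=> sf sg sh; rewrite /ip -RintegralB//; try exact: sqintM.
by apply: eq_Rintegral => t _; rewrite mulrBl.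
Qed.

Lemma ip_suml I (s : seq I) (P : pred I) (F : I -> X -> R) h :
  (forall i, P i -> sqint (F i)) -> sqint h ->
  ip (fun t => \sum_(i <- s | P i) F i t) h = \sum_(i <- s | P i) ip (F i) h.
Proof.
move=> sF sh; elim: s => [|i s IH].
  rewrite big_nil /ip (@eq_Rintegral _ _ _ mu D (fun=> 0)); last first.
    by move=> t _; rewrite big_nil mul0r.
  by rewrite /Rintegral integral0.
rewrite big_cons; have [Pi|nPi] := boolP (P i).
  rewrite -IH -ipDl//; try exact: sF; try exact: sqint_sum.
  by apply: eq_ip => // t _; rewrite big_cons Pi.
by rewrite -IH; apply: eq_ip => // t _; rewrite big_cons (negbTE nPi).
Qed.

Lemma ip_ge0 f : (0 : R) <= ip f f.
Proof. by apply: Rintegral_ge0 => t _; rewrite -expr2 sqr_ge0. Qed.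

Lemma ip_addZ c f g : sqint f -> sqint g ->
  ip (fun t => f t + c * g t) (fun t => f t + c * g t) =
  ip f f + 2 * c * ip f g + c ^+ 2 * ip g g.
Proof.
move=> sf sg; have scg := sqintZ c sg; have sfg := sqintD sf scg.
rewrite ipDl// ipZl// ![ip _ (fun=> _ + _)]ipC !ipDl// !ipZl// (ipC g f).
by ring.
Qed.

Lemma ip_subE f g : sqint f -> sqint g ->
  ip (fun t => f t - g t) (fun t => f t - g t) = ip f f - 2 * ip f g + ip g g.
Proof.
move=> sf sg; transitivity
  (ip (fun t => f t + (-1) * g t) (fun t => f t + (-1) * g t)).
  by apply: eq_ip => t _; rewrite mulN1r.
by rewrite ip_addZ//; ring.
Qed.

Lemma ip_CS f g : sqint f -> sqint g -> ip f g ^+ 2 <= ip f f * ip g g.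
Proof.
move=> sf sg; have H c : (0 : R) <= ip f f + 2 * c * ip f g + c ^+ 2 * ip g g.
  by rewrite -ip_addZ//; exact: ip_ge0.
by apply: discriminant_le0 => //; exact: ip_ge0.
Qed.

Lemma sqint_bounded (C : R) f : (mu D < +oo)%E -> measurable_fun D f ->
  (forall t, D t -> `|f t| <= C) -> sqint f.
Proof.
move=> muD mf fC; split => //; apply: measurable_bounded_integrable => //.
  exact: measurable_funM.
exists (C ^+ 2); split; first exact: num_real.
move=> x Cx t Dt /=; rewrite normrM (le_trans _ (ltW Cx))// expr2.
by apply: ler_pM; rewrite ?fC.
Qed.

Lemma sqint_integrable f : (mu D < +oo)%E -> sqint f ->
  mu.-integrable D (EFin \o f).
Proof.
move=> muD sf; have s1 : sqint (fun=> 1).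
  by apply: (@sqint_bounded 1) => // t _; rewrite normr1.
by apply: eq_int (sqintM sf s1) => t _; rewrite mulr1.
Qed.

Lemma sqint_le_integrable f g : measurable_fun D f ->
  mu.-integrable D (EFin \o g) -> (forall t, D t -> `|f t| <= g t) ->
  mu.-integrable D (EFin \o f).
Proof.
move=> mf Ig fg; apply: (le_integrable mD _ _ Ig).
  exact/measurable_EFinP.
by move=> t Dt /=; rewrite lee_fin (le_trans (fg _ Dt)) ?ler_norm.
Qed.

End square_integrable.

Lemma sum_half_le2 (R : realFieldType) n : \sum_(0 <= k < n) (2 ^- k : R) <= 2.
Proof.
suff -> : \sum_(0 <= k < n) (2 ^- k : R) = 2 - 2 * 2 ^- n.
  by rewrite gerBl mulr_ge0// invr_ge0 exprn_ge0.
elim: n => [|n IH]; first by rewrite big_geq// expr0 invr1 mulr1 subrr.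
rewrite big_nat_recr//= IH exprSr invfM.
by field; rewrite expf_neq0.
Qed.

(** * Completeness of [L^2] *)

Section riesz_fischer.
Context d (X : measurableType d) (R : realType).
Variables (mu : {measure set X -> \bar R}) (D : set X) (mD : measurable D).
Local Notation ip := (ip mu D).
Local Notation sqint := (sqint mu D).

(** Where the sequence converges its limit is its lower limit, so Fatou's lemma transfers a uniform
    bound on the integrals. *)
Lemma fatou_le (f_ : nat -> X -> R) (f : X -> R) (c : \bar R) :
  (forall k, measurable_fun D (f_ k)) -> (forall k t, D t -> 0 <= f_ k t) ->
  measurable_fun D f -> {ae mu, forall t, D t -> f_ ^~ t @ \oo --> f t} ->
  (forall k, \int[mu]_(t in D) (f_ k t)%:E <= c)%E ->
  (\int[mu]_(t in D) (f t)%:E <= c)%E.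
Proof.
move=> mf_ f_0 mf f_f f_c.
have mE k : measurable_fun D (EFin \o f_ k) by exact/measurable_EFinP.
have E0 k t : D t -> (0 <= (EFin \o f_ k) t)%E by move=> /f_0; rewrite /= lee_fin.
have -> : (\int[mu]_(t in D) (f t)%:E =
           \int[mu]_(t in D) limn_einf (fun k => (EFin \o f_ k) t))%E.
  apply: ae_eq_integral => //.
  - exact/measurable_EFinP.
  (* The lower limit is measurable as the negative of an upper limit. *)
  - rewrite (_ : (fun t => _) =
      (fun t => - limn_esup (fun k => - (EFin \o f_ k) t))%E); last first.
      apply/funext => t; rewrite -limn_einfN; congr limn_einf.
      by apply/funext => k /=; rewrite opprK.
    apply: measurableT_comp => //; apply: measurable_fun_limn_esup => k.
    exact: measurableT_comp.
  - apply: filterS f_f => t /[apply] f_f; apply/esym.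
    apply: (cvg_limn_einf_sup _).1.
    by apply: cvg_EFin => //; exact: nearW.
apply: (le_trans (fatou mu mD mE E0)).
rewrite limn_einf_lim; apply: lime_le; first exact: is_cvg_einfs.
apply: nearW => k; apply: le_trans (f_c k).
by apply: ereal_inf_lbound; exists k => /=.
Qed.

(** Riesz-Fischer: a subsequence with squared gaps [4 ^- k] converges almost everywhere, and Fatou's
    lemma turns the Cauchy estimate into convergence of the whole sequence to that limit. *)
Lemma L2_complete (f_ : nat -> X -> R) : (forall k, sqint (f_ k)) ->
  (forall e, 0 < e -> exists N, forall i j, (N <= i)%N -> (N <= j)%N ->
     ip (fun t => f_ i t - f_ j t) (fun t => f_ i t - f_ j t) <= e) ->
  exists2 f, sqint f &
    ip (fun t => f_ k t - f t) (fun t => f_ k t - f t) @[k --> \oo] --> (0 : R).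
Proof.
move=> sf cf.
have /choice[N HN] : forall k : nat, exists N, forall i j, (N <= i)%N -> (N <= j)%N ->
     ip (fun t => f_ i t - f_ j t) (fun t => f_ i t - f_ j t) <= (4 ^- k).
  by move=> k; apply: cf; rewrite invr_gt0 exprn_gt0.
(* Taking maxima places [s j] beyond [N k] for every [k <= j]. *)
pose s k := (\max_(i < k.+1) N i)%N.
have Ns i k : (i <= k)%N -> (N i <= s k)%N.
  by move=> ik; exact: (@leq_bigmax _ (fun i : 'I_k.+1 => N i) (Ordinal (ik : i < k.+1)%N)).
pose g k := f_ (s k).
have sg k : sqint (g k) by exact: sf.
pose dg k t := g k.+1 t - g k t.
have sdg k : sqint (dg k) by exact: sqintB.
have mdg k : measurable_fun D (dg k) by case: (sdg k).
(* Even with the weight [2 ^+ k] the integrals are at most [2 ^- k], while [|dg k| <= 2 ^- k + h_ k]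
   by the inequality between means: where the series of the [h_ k] is finite, the telescoping series
   converges absolutely. *)
pose h_ k t := 2 ^+ k * (dg k t * dg k t).
have h_0 k t : 0 <= h_ k t by rewrite mulr_ge0 ?exprn_ge0// -expr2 sqr_ge0.
have mh k : measurable_fun D (h_ k).
  by apply: measurable_funM => //; exact: measurable_funM.
have Ih k : (\int[mu]_(t in D) (h_ k t)%:E <= (2 ^- k)%:E)%E.
  have Id := (sdg k).2.
  have Ihk : mu.-integrable D (EFin \o h_ k) by exact: intZ.
  rewrite -[leLHS]fineK ?integrable_fin_num// lee_fin.
  rewrite -/(Rintegral mu D (h_ k)) RintegralZl// -/(ip (dg k) (dg k)).
  apply: (@le_trans _ _ (2 ^+ k * 4 ^- k)); last first.
    by rewrite -exprVn -exprMn -exprVn lerXn2r ?nnegrE//; lra.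
  by rewrite ler_pM2l ?exprn_gt0//; apply: HN; exact: Ns.
pose H t := (\sum_(k <oo) (h_ k t)%:E)%E.
have mH : measurable_fun D H.
  apply: ge0_emeasurable_sum => [k t _ _|k _]; first by rewrite lee_fin.
  exact/measurable_EFinP.
have H0 t : (0 <= H t)%E by apply: nneseries_ge0 => k _ _; rewrite lee_fin.
have IH : mu.-integrable D H.
  apply/integrableP; split => //.
  rewrite (eq_integral H); last by move=> t _; rewrite gee0_abs.
  rewrite integral_nneseries//; last 2 first.
    by move=> k; exact/measurable_EFinP.
    by move=> k t _; rewrite lee_fin.
  apply: (@le_lt_trans _ _ (\sum_(k <oo) (2 ^- k)%:E)%E).
    apply: lee_nneseries => [k _ _|k _]; last exact: Ih.
    by apply: integral_ge0 => t _; rewrite lee_fin.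
  apply: (@le_lt_trans _ _ 2%:E); last exact: ltry.
  apply: lime_le; first by apply: is_cvg_nneseries => k _ _; rewrite lee_fin.
  by apply: nearW => n; rewrite sumEFin lee_fin sum_half_le2.
have Hfin := integrable_ae mD IH.
pose A := D `&` [set t | H t \is a fin_num].
have mA : measurable A by exact: emeasurable_fin_num.
have cg t : A t -> cvgn (fun k => g k t).
  move=> [Dt Ht].
  have -> : (fun k => g k t) = (fun k => g 0 t + series (dg ^~ t) k).
    by apply/funext => k; rewrite /series/= telescope_sumr// addrCA subrr addr0.
  apply: is_cvgD; first exact: is_cvg_cst.
  apply: normed_cvg; apply: nondecreasing_is_cvgn.
    by apply: nondecreasing_series => k _ _; exact: normr_ge0.
  exists (2 + fine (H t)) => _ [n _ <-] /=.
  apply: (@le_trans _ _ (\sum_(0 <= k < n) (2 ^- k + h_ k t))).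
    apply: ler_sum => k _ /=; rewrite /h_ -expr2 -real_normK ?num_real//.
    have : 0 < 2 ^+ k :> R by rewrite exprn_gt0.
    move: (2 ^+ k) `|dg k t| (normr_ge0 (dg k t)) => c x x0 c0.
    rewrite -(ler_pM2l c0) mulrDr mulfV ?gt_eqF// mulrA -expr2 -exprMn.
    by have := sqr_ge0 (c * x - 1); have := mulr_ge0 (ltW c0) x0; nra.
  rewrite big_split/= lerD ?sum_half_le2//.
  rewrite -lee_fin fineK// -sumEFin.
  by apply: nneseries_lim_ge => k _ _; rewrite lee_fin.
pose f t := if t \in A then limn (fun k => g k t) else 0.
have mf : measurable_fun D f.
  apply: (@measurable_fun_cvg _ _ _ _ (fun k t => g k t * \1_A t)).
    move=> k; apply: measurable_funM; first by case: (sg k).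
    exact: measurable_indic.
  move=> t Dt; rewrite /f indicE; case: ifPn => [|nA].
    rewrite inE => At; under eq_fun do rewrite mulr1; exact: cg.
  by under eq_fun do rewrite mulr0; exact: cvg_cst.
have gf : {ae mu, forall t, D t -> g ^~ t @ \oo --> f t}.
  apply: filterS Hfin => t Hfin Dt; have At : A t by split => //; exact: Hfin.
  by rewrite /f mem_set//; exact: cg.
(* Fatou along [g (j + k)], [j] tending to infinity, with [f_ i] fixed. *)
have fat i k : (N k <= i)%N ->
   (\int[mu]_(t in D) ((f_ i t - f t) * (f_ i t - f t))%:E <= (4 ^- k)%:E)%E.
  move=> ki.
  apply: (@fatou_le (fun j t => (f_ i t - g (j + k)%N t) * (f_ i t - g (j + k)%N t))).
  - move=> j; have := sqintB mD (sf i) (sg (j + k)%N) => -[? _].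
    exact: measurable_funM.
  - by move=> j t _; rewrite -expr2 sqr_ge0.
  - have := sf i => -[mfi _]; apply: measurable_funM; exact: measurable_funB.
  - apply: filterS gf => t /[apply] gf.
    have gfk : (fun j => g (j + k)%N t) @ \oo --> f t.
      by rewrite (cvg_shiftn k (g ^~ t)).
    by apply: cvgM; apply: cvgB => //; exact: cvg_cst.
  - move=> j; have sij := sqintB mD (sf i) (sg (j + k)%N).
    rewrite -[leLHS]fineK; last exact: (integrable_fin_num mD sij.2).
    by rewrite lee_fin; apply: HN => //; apply: Ns; rewrite leq_addl.
have sff i k : (N k <= i)%N -> sqint (fun t => f_ i t - f t).
  move=> ki; apply: sqintP => //.
    by have := sf i => -[mfi _]; exact: measurable_funB.
  by apply: (le_lt_trans (fat _ _ ki)); rewrite ltry.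
have sf' : sqint f.
  apply: eq_sqint (sqintB mD (sf (N 0)) (sff (N 0) 0 (leqnn _))) => //.
  by move=> t _; ring.
exists f => //.
apply/cvgrPdist_le => e e0.
have [k ke] : exists k, (4 ^- k : R) <= e.
  have : geometric 1 (4^-1 : R) @ \oo --> 0.
    by apply: cvg_geometric; rewrite ger0_norm ?invf_lt1//; lra.
  move=> /cvgrPdist_le/(_ e e0) [k _ /(_ k (leqnn k)) /=].
  rewrite sub0r normrN mul1r exprVn ger0_norm ?invr_ge0 ?exprn_ge0// => ?.
  by exists k.
near=> i.
rewrite sub0r normrN ger0_norm ?ip_ge0// (le_trans _ ke)//.
have ki : (N k <= i)%N by near: i; exact: nbhs_infty_ge.
rewrite -lee_fin; apply: le_trans (fat _ _ ki).
by rewrite [leLHS]fineK// (integrable_fin_num mD (sff _ _ ki).2).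
Unshelve. all: by end_near.
Qed.
End riesz_fischer.

(** * Lebesgue measure on the box *)

Section tuple_box.
Context (R : realType).
Local Notation RT := (measurableTypeR R).

Definition tbox p (T : 'I_p -> R) : set (p.-tuple RT) :=
  [set x | forall a, 0 <= tnth x a <= T a].

Definition upd p (x : p.-tuple RT) (a : 'I_p) (s : R) : p.-tuple RT :=
  [tuple if i == a then s else tnth x i | i < p].

Lemma measurable_tbox p (T : 'I_p -> R) : measurable (tbox T).
Proof.
have -> : tbox T =
    \bigcap_(a in [set: 'I_p]) ((@tnth p RT)^~ a @^-1` [set` `[0, T a]]).
  apply/seteqP; split => x /= H a; first by move=> _ /=; rewrite in_itv/=; exact: H.
  by have := H a I; rewrite /= in_itv.
apply: fin_bigcap_measurable => [|a _]; first exact: finite_finset.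
by rewrite -[X in measurable X]setTI; apply: measurable_tnth => //; exact: measurable_itv.
Qed.

Lemma tbox_cons p (T : 'I_p.+1 -> R) (s : R) (x : p.-tuple RT) :
  tbox T (tuple_cons (s, x)) <-> 0 <= s <= T ord0 /\ tbox (fun a => T (lift ord0 a)) x.
Proof.
split=> [H|[H0 H] a].
  split; first by have := H ord0; rewrite /tuple_cons/= tnth0.
  by move=> a; have := H (lift ord0 a); rewrite /tuple_cons/= tnthS.
have [j ->|->] := unliftP ord0 a; first by rewrite /tuple_cons/= tnthS; exact: H.
by rewrite /tuple_cons/= tnth0.
Qed.

Lemma lebesgue_tuple_tbox p (T : 'I_p -> R) : (forall a, 0 <= T a) ->
  lebesgue_tuple R p (tbox T) = (\prod_a T a)%:E.
Proof.
elim: p T => [|p IH] T T0.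
  rewrite big_ord0 /= diracE mem_set//.
  by case.
rewrite big_ord_recl /= /lebesgue_tuple_step /pushforward.
have -> : @tuple_cons R p @^-1` tbox T =
    ([set` `[0, T ord0]] : set RT) `*` tbox (fun a => T (lift ord0 a)).
  apply/seteqP; split => -[s x] /=.
    by move/tbox_cons => -[? ?]; rewrite in_itv.
  by move=> [+ ?]; rewrite in_itv/= => ?; apply/tbox_cons.
rewrite product_measure1E; last 2 first.
- exact: measurable_itv.
- exact: measurable_tbox.
rewrite IH// EFinM; congr (_ * _)%E.
rewrite /= lebesgue_measure_itv/= lte_fin; case: ltP => [_|]; first by rewrite oppr0 adde0.
by move=> h; apply/esym/congr1/eqP; rewrite eq_le h T0.
Qed.

Lemma upd0 p (s r : R) (x : p.-tuple RT) :
  upd (tuple_cons (r, x)) ord0 s = tuple_cons (s, x).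
Proof.
apply: eq_from_tnth => i; rewrite tnth_mktuple.
by have [j ->|->] := unliftP ord0 i; rewrite /tuple_cons/= ?tnth0 ?tnthS.
Qed.

Lemma updS p (s r : R) (x : p.-tuple RT) a :
  upd (tuple_cons (r, x)) (lift ord0 a) s = tuple_cons (r, upd x a s).
Proof.
apply: eq_from_tnth => i; rewrite tnth_mktuple.
have [j ->|->] := unliftP ord0 i; last by rewrite /tuple_cons/= !tnth0.
by rewrite /tuple_cons/= !tnthS tnth_mktuple (inj_eq lift_inj).
Qed.

(** Fubini by induction on the dimension, peeling off the first coordinate: if it is [a], the inner
    integral runs over it and vanishes by hypothesis; otherwise the inner integral over the
    remaining coordinates vanishes by induction. The bound [C] supplies the integrability that
    Fubini requires. *)
Lemma integral_tbox_eq0 p (T : 'I_p -> R) (a : 'I_p) (h : p.-tuple RT -> R) (C : R) :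
  (forall a, 0 <= T a) ->
  measurable_fun (tbox T) h -> (forall x, tbox T x -> `|h x| <= C) ->
  (forall x, tbox T x ->
     (\int[lebesgue_measure]_(s in `[0%R, T a]) (h (upd x a s))%:E = 0)%E) ->
  (\int[lebesgue_tuple R p]_(x in tbox T) (h x)%:E = 0)%E.
Proof.
elim: p T a h => [|p IH] T a h T0 mh hC h0; first by case: a h0.
have mX := measurable_tbox T.
set X := tbox T in mh hC h0 mX *.
pose T' b := T (lift ord0 b).
have T'0 b : 0 <= T' b by exact: T0.
have muX : (lebesgue_tuple R p.+1 X < +oo)%E by rewrite lebesgue_tuple_tbox ?ltry.
have IhX : (lebesgue_tuple R p.+1).-integrable X (EFin \o h).
  apply: measurable_bounded_integrable => //.
  exists C; split; first exact: num_real.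
  by move=> x Cx t Xt; apply: le_trans (ltW Cx); exact: hC.
rewrite integral_mkcond.
have mc : measurable_fun setT (@tuple_cons R p) by exact: measurable_tuple_cons.
pose f : p.+1.-tuple RT -> \bar R := (EFin \o h) \_ X.
have mf : measurable_fun setT f.
  by apply/(measurable_restrictT _ mX); exact: measurable_int IhX.
have If : (lebesgue_tuple R p.+1).-integrable setT f.
  exact: (integrable_mkcond _ mX).1.
have If' : (lebesgue_measure \x lebesgue_tuple R p)%E.-integrable setT (f \o @tuple_cons R p).
  apply/integrableP; split; first exact: measurableT_comp.
  move/integrableP : (If) => [_]; apply: le_lt_trans.
  by rewrite ge0_integral_pushforward//; apply: measurableT_comp.
have -> : (\int[lebesgue_tuple R p.+1]_x f x =
    \int[(lebesgue_measure \x lebesgue_tuple R p)%E]_x (f \o @tuple_cons R p) x)%E.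
  exact: (@integral_pushforward _ _ _ _ _ _ mc _ setT f mf If' measurableT).
have fE s x : (f \o @tuple_cons R p) (s, x) =
   if (0 <= s <= T ord0) && (x \in tbox T') then (h (tuple_cons (s, x)))%:E else 0%E.
  rewrite /f /= patchE; case: ifPn => [|nX].
    by rewrite inE => /tbox_cons [-> ?]; rewrite mem_set.
  case: ifPn => // /andP[s0 /set_mem xT]; case/negP: nX.
  by apply/mem_set/tbox_cons.
have [a' aE|a0] := unliftP ord0 a; last first.
  rewrite -(integral21_prod_meas1 If').
  apply: integral0_eq => x _; rewrite /fubini_G.
  under eq_integral do rewrite fE.
  have [xT|nx] := boolP (x \in tbox T'); last first.
    by apply: integral0_eq => s _; rewrite andbF.
  have X0 : X (tuple_cons (0, x)).
    by apply/tbox_cons; rewrite lexx T0; split => //; exact: set_mem.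
  rewrite -[RHS](h0 _ X0) a0 [RHS]integral_mkcond.
  apply: eq_integral => s _; rewrite patchE andbT upd0.
  by rewrite mem_setE in_itv.
rewrite -(integral12_prod_meas1 If').
apply: integral0_eq => s _; rewrite /fubini_F.
under eq_integral do rewrite fE.
have [s0|ns] := boolP (0 <= s <= T ord0); last by apply: integral0_eq.
transitivity (\int[lebesgue_tuple R p]_(x in tbox T') (h (tuple_cons (s, x)))%:E)%E.
  by rewrite [RHS]integral_mkcond; apply: eq_integral => x _; rewrite patchE.
apply: (IH T' a' (fun x => h (tuple_cons (s, x)))) => //.
- apply: (@measurable_comp _ _ _ _ _ _ X) => //.
    by move=> _ [x xT <-]; apply/tbox_cons.
  apply: measurable_funTS; apply: measurableT_comp => //.
- by move=> x xT; apply: hC; apply/tbox_cons.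
- move=> x xT; have Xx : X (tuple_cons (s, x)) by apply/tbox_cons.
  rewrite -[RHS](h0 _ Xx) aE; apply: eq_integral => r _.
  by rewrite updS.
Qed.

End tuple_box.

(** * Rounding to a grid and measurability of superpositions *)

Lemma row_cvgP (R : realType) (n : nat) (F : set_system nat) {FF : Filter F}
    (u : nat -> 'rV[R]_n) (v : 'rV[R]_n) :
  (forall i, (fun k => u k 0 i) @ F --> v 0 i) -> u @ F --> v.
Proof.
move=> uv; apply/cvg_ballP => e e0.
have : \forall k \near F, forall i, ball (v 0 i) e (u k 0 i).
  by apply: filter_forall => i; have /cvg_ballP := uv i; exact.
by apply: filterS => k H; split => // i j; rewrite !ord1; exact: (H j).
Qed.

Definition grid (R : realType) n (k : nat) (z : 'rV[int]_n) : 'rV[R]_n :=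
  \row_i ((z 0 i)%:~R / k.+1%:R).

Definition grid_index (R : realType) n (k : nat) (v : 'rV[R]_n) : 'rV[int]_n :=
  \row_i Num.floor (k.+1%:R * v 0 i).

Lemma cvg_grid (R : realType) n (v : 'rV[R]_n) :
  (fun k => grid R k (grid_index k v)) @ \oo --> v.
Proof.
apply: row_cvgP => i; apply/cvgrPdist_lt => e e0.
near=> k; rewrite !mxE.
have k0 : 0 < k.+1%:R :> R by rewrite ltr0n.
have := floor_le (k.+1%:R * v 0 i); have := lt_succ_floor (k.+1%:R * v 0 i).
move: (Num.floor _) => z; rewrite intrD => z1 z2.
have -> : v 0 i - z%:~R / k.+1%:R = (k.+1%:R * v 0 i - z%:~R) / k.+1%:R.
  by field; rewrite gt_eqF.
rewrite ger0_norm; last by rewrite divr_ge0 ?subr_ge0// ltW.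
apply: (@le_lt_trans _ _ k.+1%:R^-1).
  by rewrite ler_pdivrMr// mulVf ?gt_eqF//; lra.
by near: k; exact: near_infty_natSinv_lt (PosNum e0).
Unshelve. all: by end_near. Qed.

(* Carathéodory functions are superposition measurable: round [u t] to a grid. *)
Lemma measurable_superposition d (X : measurableType d) (R : realType) n
    (D : set X) (Phi : X -> 'rV[R]_n -> R) (u : X -> 'rV[R]_n) :
  measurable D ->
  (forall c, measurable_fun D (Phi^~ c)) ->
  (forall t, D t -> {for u t, continuous (Phi t)}) ->
  (forall i, measurable_fun D (fun t => u t 0 i)) ->
  measurable_fun D (fun t => Phi t (u t)).
Proof.
move=> mD mPhi cPhi mu.
apply: (@measurable_fun_cvg _ _ _ _
  (fun k t => Phi t (grid R k (grid_index k (u t))))); last first.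
  move=> t Dt; apply: (@cvg_comp _ _ _ (fun k => grid R k (grid_index k (u t))) (Phi t)).
    exact: cvg_grid.
  exact: cPhi.
move=> k _ Y mY.
(* On the cell where [u t] rounds to [z] the second argument is the constant [grid R k z]; there are
   countably many cells, each cut out by the coordinates of [u]. *)
have -> : D `&` (fun t => Phi t (grid R k (grid_index k (u t)))) @^-1` Y =
  \bigcup_(z in [set: 'rV[int]_n])
    ((D `&` (Phi^~ (grid R k z)) @^-1` Y) `&`
     \bigcap_(i in [set: 'I_n])
       (D `&` (fun t => k.+1%:R * u t 0 i) @^-1` [set` `[(z 0 i)%:~R, (z 0 i + 1)%:~R[ ])).
  apply/seteqP; split => t /=.
    move=> [Dt Yt]; exists (grid_index k (u t)) => //; split => // i _.
    by split => //=; rewrite in_itv/= !mxE floor_le lt_succ_floor.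
  move=> [z _ [[Dt Yt] H]]; split => //.
  rewrite (_ : grid_index k (u t) = z)//.
  apply/rowP => i; rewrite mxE; apply: floor_def.
  by have [_ /=] := H i I; rewrite in_itv.
apply: countable_bigcupT_measurable => [|z]; first exact: countableP.
apply: measurableI; first exact: mPhi.
apply: fin_bigcap_measurable => [|i _]; first exact: finite_finset.
apply: (measurable_funM (measurable_cst _) (mu i)) => //.
Qed.

(** * Row vectors and tuples: measurability, measure and integrals on the box *)

Section coordinates.
Context (R : realType) (p : nat).
Local Notation RT := (measurableTypeR R).

Definition tv (t : lebesgue_space R p) : p.-tuple RT := [tuple t 0 i | i < p].
Definition rv (x : p.-tuple RT) : 'rV[R]_p := \row_i tnth x i.

Lemma tvK t : rv (tv t) = t.
Proof. by apply/rowP => i; rewrite mxE tnth_mktuple. Qed.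

Lemma rvK x : tv (rv x) = x.
Proof. by apply: eq_from_tnth => i; rewrite tnth_mktuple mxE. Qed.

(** [lebesgue_outer] is by definition the outer measure of the set of coordinate tuples, so the
    Carathéodory condition for a preimage is that of the Borel set itself. *)
Lemma measurable_tv : measurable_fun setT tv.
Proof.
move=> _ B mB; rewrite setTI.
suff : (@lebesgue_outer R p).-caratheodory (tv @^-1` B) by [].
move=> Y; have mB' := caratheodory_measurable_mu_ext (lebesgue_tuple R p) mB.
rewrite /lebesgue_outer [LHS](mB' [set x | Y (rv x)]).
by congr (_ + _)%E; congr mu_ext; apply/seteqP; split => x /=; rewrite rvK.
Qed.

Lemma lebesgue_tv (B : set (p.-tuple RT)) : measurable B ->
  @lebesgue R p (tv @^-1` B) = lebesgue_tuple R p B.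
Proof.
move=> mB; rewrite -(measurable_mu_extE (lebesgue_tuple R p) mB).
rewrite /lebesgue /lebesgue_outer; congr mu_ext.
by apply/seteqP; split => x /=; rewrite rvK.
Qed.

Lemma measurable_coord i : measurable_fun setT (fun t : lebesgue_space R p => t 0 i).
Proof.
rewrite (_ : (fun _ => _) = (@tnth p RT)^~ i \o tv); last first.
  by apply/funext => t /=; rewrite tnth_mktuple.
by apply: measurableT_comp; [exact: measurable_tnth|exact: measurable_tv].
Qed.

(** Superposition with an integrand constant in [t] and with the identity as inner function: only
    the coordinates have to be measurable, and the open sets of row vectors need not be compared
    with the sigma-algebra. *)
Lemma measurable_continuous (f : 'rV[R]_p -> R) : continuous f ->
  measurable_fun setT (f : lebesgue_space R p -> R).
Proof.
move=> cf.
have h1 c : measurable_fun setT (fun _ : lebesgue_space R p => f c).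
  exact: measurable_cst.
have h2 (t : lebesgue_space R p) : setT t -> {for t : 'rV[R]_p, continuous f}.
  by move=> _; exact: cf.
exact: (measurable_superposition measurableT h1 h2 measurable_coord).
Qed.

Lemma measurable_tuple_continuous (f : 'rV[R]_p -> R) : continuous f ->
  measurable_fun setT (f \o rv).
Proof.
move=> cf.
apply: (@measurable_superposition _ (p.-tuple RT) R p setT (fun=> f) rv) => //.
  by move=> t _; exact: cf.
move=> i; rewrite (_ : (fun _ => _) = (@tnth p RT)^~ i).
  exact: measurable_tnth.
by apply/funext => t /=; rewrite mxE.
Qed.

Variable T : 'rV[R]_p.
Hypothesis T0 : forall i, 0 < T 0 i.
Local Notation D := (box T : set (lebesgue_space R p)).

Lemma boxE : D = tv @^-1` tbox (T 0).
Proof.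
by apply/seteqP; split => t H a; have := H a; rewrite tnth_mktuple.
Qed.

Lemma mem_boxE t : (t \in D) = (tv t \in tbox (T 0)).
Proof. by rewrite boxE; apply/idP/idP; rewrite !inE. Qed.

Lemma measurable_box : measurable D.
Proof.
rewrite boxE -[X in measurable X]setTI.
by apply: measurable_tv => //; exact: measurable_tbox.
Qed.

Lemma lebesgue_box : @lebesgue R p D = (\prod_a T 0 a)%:E.
Proof.
rewrite boxE lebesgue_tv; last exact: measurable_tbox.
by rewrite lebesgue_tuple_tbox// => a; exact: ltW.
Qed.

Lemma lebesgue_box_lty : (@lebesgue R p D < +oo)%E.
Proof. by rewrite lebesgue_box ltry. Qed.

(** The image of [lebesgue] under [tv] agrees with the product measure on Borel sets, so integrals
    of Borel functions of the coordinates are accessible to Fubini. *)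
Lemma integral_box_tv (f : p.-tuple RT -> R) (C : R) :
  measurable_fun setT f -> (forall x, tbox (T 0) x -> `|f x| <= C) ->
  (\int[@lebesgue R p]_(t in D) (f (tv t))%:E =
   \int[lebesgue_tuple R p]_(x in tbox (T 0%R)) (f x)%:E)%E.
Proof.
move=> mf fC; have mX := measurable_tbox (T 0).
pose g := (EFin \o f) \_ (tbox (T 0)).
have mg : measurable_fun setT g.
  apply/(measurable_restrictT _ mX); apply/measurable_EFinP.
  exact: measurable_funTS.
have Ig : (@lebesgue R p).-integrable setT (g \o tv).
  have -> : g \o tv = (EFin \o (f \o tv)) \_ D.
    by apply/funext => t; rewrite /g/= !patchE mem_boxE.
  apply/(integrable_mkcond _ measurable_box).1.
  apply: measurable_bounded_integrable.
  - exact: measurable_box.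
  - exact: lebesgue_box_lty.
  - exact: (measurable_funTS (measurableT_comp mf measurable_tv)).
  - exists C; split; first exact: num_real.
    move=> c Cc t Dt; apply: le_trans (ltW Cc); apply: fC.
    by rewrite boxE in Dt.
rewrite [RHS]integral_mkcond [LHS]integral_mkcond -/g.
transitivity (\int[@lebesgue R p]_t (g \o tv) t)%E.
  by apply: eq_integral => t _; rewrite /g/= !patchE mem_boxE.
have E : (\int[pushforward (@lebesgue R p) tv]_x g x = \int[@lebesgue R p]_t (g \o tv) t)%E.
  exact: (@integral_pushforward _ _ _ _ _ _ measurable_tv _ setT g mg Ig measurableT).
rewrite -E; apply: eq_measure_integral; first exact: measurable_tv.
by move=> mtv A mA _; exact: lebesgue_tv.
Qed.

(** A line in direction [a] meets the hyperplane [t 0 a = c] in one point, so its indicator has zero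
    integral along every such line. *)
Lemma box_face_null a c : @lebesgue R p (D `&` [set t | t 0 a = c]) = 0%E.
Proof.
pose B : set (p.-tuple RT) := (@tnth p RT)^~ a @^-1` [set c].
have mB : measurable B.
  by rewrite -[X in measurable X]setTI; apply: measurable_tnth.
have mX := measurable_tbox (T 0).
have -> : D `&` [set t | t 0 a = c] = tv @^-1` (tbox (T 0) `&` B).
  by rewrite boxE; apply/seteqP; split => t; rewrite /B /= tnth_mktuple.
rewrite lebesgue_tv; last exact: measurableI.
rewrite setIC -integral_indic//.
apply: (@integral_tbox_eq0 _ _ _ a _ 1).
- by move=> b; exact: ltW.
- exact: measurable_indic.
- by move=> x _; rewrite indicE; case: (_ \in _); rewrite ?normr1 ?normr0.
- move=> x _; transitivity (\int[lebesgue_measure]_(s in `[0%R, T 0%R a]) (\1_[set c] s)%:E)%E.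
    apply: eq_integral => s _; congr (_%:E); rewrite !indicE; congr (_%:R).
    congr nat_of_bool.
    by apply/idP/idP; rewrite !inE /B /= tnth_mktuple eqxx.
  have mI : measurable ([set` `[0, T 0 a]] : set RT) by exact: measurable_itv.
  have mc : measurable ([set c] : set RT) by exact: measurable_set1.
  rewrite integral_indic//; apply/eqP; rewrite eq_le measure_ge0 andbT.
  rewrite -(lebesgue_measure_set1 c); apply: le_measure; rewrite ?inE//.
  exact: measurableI.
Qed.

Lemma compact_box : compact (box T).
Proof.
have -> : box T = [set v : 'rV[R]_p | forall i, [set` `[0, T 0 i]] (v ord0 i)].
  by apply/seteqP; split => t H i; have := H i; rewrite /= in_itv.
by apply: (@rV_compact R p (fun i => [set` `[0, T 0 i]])) => i; exact: segment_compact.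
Qed.

Lemma box_bounded (f : 'rV[R]_p -> R) : {within box T, continuous f} ->
  exists2 C, 0 <= C & forall t, box T t -> `|f t| <= C.
Proof.
move=> cf; have /compact_bounded[M [_ HM]] := continuous_compact cf compact_box.
exists (`|M| + 1) => [|t Dt]; first by rewrite addr_ge0.
by apply: HM; [rewrite (le_lt_trans (ler_norm _))// ltrDl|exists t].
Qed.

End coordinates.

(** * Directional derivatives *)

Section line_derivative.
Context (R : realType) (V W : normedModType R).

(** Both difference quotients are the same function of [h], so a directional derivative of [f] is an
    ordinary derivative of its restriction to a line. *)
Lemma line_quotient (f : V -> W) (y e : V) (s : R) :
  (fun h : R => h^-1 *: (((fun r : R => f (y + r *: e)) \o shift s) (h *: 1)
                         - f (y + s *: e))) =
  (fun h : R => h^-1 *: ((f \o shift (y + s *: e)) (h *: e) - f (y + s *: e))).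
Proof.
apply/funext => h /=; congr (_ *: (f _ - _)).
by rewrite [h *: 1]mulr1 scalerDl addrCA.
Qed.

Lemma derivable_line (f : V -> W) (y e : V) (s : R) :
  derivable f (y + s *: e) e -> derivable (fun r : R => f (y + r *: e)) s 1.
Proof. by rewrite /derivable line_quotient. Qed.

Lemma derive_line (f : V -> W) (y e : V) (s : R) :
  'D_1 (fun r : R => f (y + r *: e)) s = 'D_e f (y + s *: e).
Proof. by rewrite /derive line_quotient. Qed.

Lemma continuous_line (f : V -> W) (y e : V) : continuous f ->
  continuous (fun r : R => f (y + r *: e)).
Proof.
move=> cf s; apply: (@continuous_comp _ _ _ (fun r : R => y + r *: e) f); last exact: cf.
by apply: cvgD; [exact: cvg_cst|apply: cvgZr_tmp; exact: cvg_id].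
Qed.

End line_derivative.

(** * Periodic functions: integrals of partial derivatives over the box *)

Section periodic_integration_by_parts.
Context (R : realType) (p : nat) (T : 'rV[R]_p).
Hypothesis T0 : forall i, 0 < T 0 i.
Local Notation D := (box T : set (lebesgue_space R p)).

Lemma rv_upd (x : p.-tuple (measurableTypeR R)) a s :
  rv (upd x a s) = (rv x - tnth x a *: basis_vec R a) + s *: basis_vec R a.
Proof.
apply/rowP => i; rewrite !mxE tnth_mktuple /=.
by case: eqVneq => [->|_]; rewrite ?mulr1 ?mulr0; ring.
Qed.

(** Along each line in direction [a] the fundamental theorem of calculus gives the increment of [h]
    over one period, which is zero. Applied to a product, this is integration by parts without
    boundary terms. *)
Lemma integral_partial_eq0 (h : 'rV[R]_p -> R^o) a :
  continuous h -> (forall t, derivable h t (basis_vec R a)) ->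
  continuous (partial a h) ->
  (forall t, h (t + T 0 a *: basis_vec R a) = h t) ->
  \int[@lebesgue R p]_(t in D) partial a h t = 0.
Proof.
move=> ch dh cdh ph.
have [C C0 HC] := @box_bounded _ _ T (partial a h) (continuous_subspaceT cdh).
have mf : measurable_fun setT (partial a h \o @rv R p).
  exact: (@measurable_tuple_continuous _ _ (partial a h)).
have fC x : tbox (T 0) x -> `|(partial a h \o @rv R p) x| <= C.
  by move=> xT; apply: HC => b; rewrite mxE; exact: xT.
rewrite /Rintegral (_ : integral _ _ _ = 0%E)//.
transitivity (\int[@lebesgue R p]_(t in D) ((partial a h \o @rv R p) (tv t))%:E)%E.
  by apply: eq_integral => t _ /=; rewrite tvK.
rewrite (integral_box_tv T0 mf fC).
apply: (@integral_tbox_eq0 _ _ _ a _ C) => //.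
- by move=> b; exact: ltW.
- exact: measurable_funTS.
move=> x _; set y := rv x - tnth x a *: basis_vec R a.
pose phi (s : R) : R^o := h (y + s *: basis_vec R a).
have cphi : continuous phi by exact: continuous_line.
transitivity (\int[lebesgue_measure]_(s in `[0%R, T 0%R a])
                (partial a h (y + s *: basis_vec R a))%:E)%E.
  by apply: eq_integral => s _ /=; rewrite rv_upd.
rewrite (@continuous_FTC2 _ _ phi) //.
- by rewrite /phi ph scale0r addr0 -EFinD subrr.
- apply: continuous_subspaceT.
  exact: (@continuous_line _ _ R^o (partial a h)).
- split.
  + by move=> s _; exact: derivable_line.
  + exact/cvg_at_right_filter/cphi.
  + exact/cvg_at_left_filter/cphi.
- by move=> s _; rewrite derive1E derive_line.
Qed.

End periodic_integration_by_parts.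

(** * The Hartley system *)

Section hartley.
Context (R : realType) (p : nat) (T : 'rV[R]_p).
Hypothesis T0 : forall i, 0 < T 0 i.
Local Notation D := (box T : set (lebesgue_space R p)).
Local Notation mu := (@lebesgue R p).
Implicit Types (m l q : 'rV[int]_p) (t : 'rV[R]_p).

Definition base_freq (a : 'I_p) : R := 2 * pi / T 0 a.
Definition freq m (a : 'I_p) : R := (m 0 a)%:~R * base_freq a.
Definition phase m t : R := \sum_a freq m a * t 0 a.
Definition cas m t : R := cos (phase m t) + sin (phase m t).

Lemma base_freq_gt0 a : 0 < base_freq a.
Proof. exact: divr_gt0 (mulr_gt0 (ltr0Sn R 1) (pi_gt0 R)) (T0 a). Qed.

Lemma freqN m a : freq (- m) a = - freq m a.
Proof. by rewrite /freq mxE mulrNz mulNr. Qed.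

Lemma phaseN m t : phase (- m) t = - phase m t.
Proof. by rewrite /phase -sumrN; apply: eq_bigr => a _; rewrite freqN mulNr. Qed.

Lemma phaseD m l t : phase (m + l) t = phase m t + phase l t.
Proof.
rewrite /phase -big_split; apply: eq_bigr => a _ /=.
by rewrite /freq mxE intrD; ring.
Qed.

Lemma phase_shift m t a s :
  phase m (t + s *: basis_vec R a) = phase m t + s * freq m a.
Proof.
have -> : phase m t + s * freq m a =
  \sum_b (freq m b * t 0 b + (if b == a then s * freq m b else 0)).
  by rewrite big_split/= -big_mkcond/= big_pred1_eq.
apply: eq_bigr => b _; rewrite !mxE /=.
by case: (b == a); rewrite ?mulr1 ?mulr0; ring.
Qed.

Lemma phase0 t : phase 0 t = 0.
Proof. by rewrite /phase big1// => a _; rewrite /freq mxE mulr0z !mul0r. Qed.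

Lemma cas0 t : cas 0 t = 1.
Proof. by rewrite /cas phase0 cos0 sin0 addr0. Qed.

Lemma cos_phaseE m t : cos (phase m t) = 2^-1 * (cas m t + cas (- m) t).
Proof. by rewrite /cas phaseN cosN sinN; field. Qed.

Lemma sin_phaseE m t : sin (phase m t) = 2^-1 * (cas m t - cas (- m) t).
Proof. by rewrite /cas phaseN cosN sinN; field. Qed.

(** [cas m * cas l] is [cos] of the phase of [m - l] plus [sin] of the phase of [m + l]; rewriting
    both in the system shows that its span is an algebra and reduces orthogonality to the integrals
    of single functions. *)
Lemma casM m l t : cas m t * cas l t =
  2^-1 * (cas (m - l) t + cas (- (m - l)) t + (cas (m + l) t - cas (- (m + l)) t)).
Proof.
rewrite [RHS]mulrDr -cos_phaseE -sin_phaseE !phaseD phaseN cosD sinD cosN sinN /cas.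
by ring.
Qed.

Lemma cas_bounded m t : `|cas m t| <= 2.
Proof.
rewrite (le_trans (ler_normD _ _))// -[leRHS]/(1 + 1).
by apply: lerD; rewrite ler_norml ?cos_geN1 ?cos_le1 ?sin_geN1 ?sin_le1.
Qed.

Lemma cas_line m t a : (fun s : R => cas m (t + s *: basis_vec R a)) =
  (fun x : R => cos x + sin x) \o (fun s => phase m t + s * freq m a).
Proof. by apply/funext => s; rewrite /cas phase_shift. Qed.

Lemma is_derive_cas m t a :
  is_derive t (basis_vec R a) (cas m : 'rV[R]_p -> R^o) (freq m a * cas (- m) t).
Proof.
have d0 : is_derive (0 : R) 1 (fun s : R => cas m (t + s *: basis_vec R a) : R^o)
    (freq m a * cas (- m) t).
  rewrite cas_line.
  have H1 : is_derive (phase m t + 0 * freq m a) (1 : R) (fun x : R => cos x + sin x)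
      (- sin (phase m t) + cos (phase m t)).
    by rewrite mul0r addr0; exact: is_deriveD.
  have H2 : is_derive (0 : R) (1 : R) (fun s : R => phase m t + s * freq m a) (freq m a).
    apply: is_derive_eq; rewrite scale0r !add0r.
    by rewrite mul1r [_ *: _]mulr1.
  have := @is_derive1_comp R (fun x : R => cos x + sin x)
    (fun s : R => phase m t + s * freq m a) 0 _ _ H1 H2.
  rewrite /cas phaseN cosN sinN mulrC addrC => H; exact: H.
have E := line_quotient (cas m : 'rV[R]_p -> R^o) t (basis_vec R a) 0.
have t0 : t + 0 *: basis_vec R a = t by rewrite scale0r addr0.
rewrite t0 in E.
case: d0 => d0 v0; split.
  by move: d0; rewrite /derivable -E t0.
by move: v0; rewrite /derive -E t0.
Qed.

Lemma derivable_cas m t a : derivable (cas m : 'rV[R]_p -> R^o) t (basis_vec R a).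
Proof. by have := is_derive_cas m t a => -[]. Qed.

Lemma partial_cas m a : partial a (cas m : 'rV[R]_p -> R^o) =
  (fun t => freq m a * cas (- m) t).
Proof. by apply/funext => t; have := is_derive_cas m t a => -[]. Qed.

Lemma continuous_phase m : continuous (phase m : 'rV[R]_p -> R).
Proof.
move=> t; apply: (@cvg_big _ _ _ _ _ (@add_continuous _) _ (nbhs t)) => a _.
by apply: cvgM; [exact: cvg_cst|exact: coord_continuous].
Qed.

Lemma continuous_cas m : continuous (cas m : 'rV[R]_p -> R).
Proof.
move=> t.
have h1 := continuous_comp (@continuous_phase m t) (@continuous_cos R (phase m t)).
have h2 := continuous_comp (@continuous_phase m t) (@continuous_sin R (phase m t)).
exact: cvgD h1 h2.
Qed.

Lemma cas_periodic m t a : cas m (t + T 0 a *: basis_vec R a) = cas m t.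
Proof.
have H (f : R -> R) (z : int) x : periodic f (pi *+ 2) ->
    f (x + z%:~R * (2 * pi)) = f x.
  move=> pf; rewrite [2 * pi]mulr_natl mulrzl; case: z => k.
    by rewrite -pmulrn periodicn.
  by rewrite NegzE mulrNz -pmulrn -[LHS](periodicn pf k.+1) subrK.
rewrite /cas phase_shift.
have -> : T 0 a * freq m a = (m 0 a)%:~R * (2 * pi).
  rewrite /freq /base_freq; move: (pi : R) => c.
  by field; rewrite gt_eqF.
by rewrite !H//; [exact: sinD2pi|exact: cosD2pi].
Qed.

(** The factor [c] makes the family stable under partial derivatives ([m] becomes [- m], [c] becomes
    [c * freq m a]), so that smoothness goes by induction on the order. *)
Definition casv n m (i : 'I_n) (c : R) t : 'rV[R]_n := (c * cas m t) *: delta_mx 0 i.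

Lemma casvE n m (i j : 'I_n) c t : casv m i c t 0 j = if j == i then c * cas m t else 0.
Proof. by rewrite !mxE /=; case: eqVneq; rewrite ?mulr1 ?mulr0. Qed.

Lemma continuous_casv n m (i : 'I_n) c : continuous (casv m i c).
Proof.
move=> t; have h : c * cas m x @[x --> t] --> c * cas m t.
  exact: (cvgMl_tmp (@continuous_cas m t)).
exact: cvgZr_tmp h.
Qed.

Lemma is_derive_casv n m (i : 'I_n) c t a :
  is_derive t (basis_vec R a) (casv m i c) (casv (- m) i (c * freq m a) t).
Proof.
have [d v] := is_derive_cas m t a.
have E : (fun h : R => h^-1 *: ((casv m i c \o shift t) (h *: basis_vec R a) - casv m i c t)) =
  (fun h : R => (c * (h^-1 *: ((cas m \o shift t) (h *: basis_vec R a) - cas m t : R^o)))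
     *: (delta_mx 0 i : 'rV[R]_n)).
  apply/funext => h; rewrite /casv /= -scalerBl scalerA; congr (_ *: _).
  by rewrite -mulrBr mulrCA.
have C : (fun h : R => h^-1 *: ((casv m i c \o shift t) (h *: basis_vec R a) - casv m i c t))
    @ 0^' --> casv (- m) i (c * freq m a) t.
  rewrite E /casv -mulrA -v; apply: cvgZr_tmp.
  exact: (cvgMl_tmp d).
by split; [apply/cvg_ex; eexists; exact: C|exact: (cvg_lim _ C)].
Qed.

Lemma partial_casv n m (i : 'I_n) c a :
  partial a (casv m i c) = casv (- m) i (c * freq m a).
Proof. by apply/funext => t; have := is_derive_casv m i c t a => -[]. Qed.

Lemma Cn_casv n m (i : 'I_n) c k : Cn k (casv m i c).
Proof.
elim: k m c => [|k IH] m c /=; split=> //; try exact: continuous_casv.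
move=> a; split; last by rewrite partial_casv.
by move=> t; have := is_derive_casv m i c t a => -[].
Qed.

Lemma smooth_casv n m (i : 'I_n) c : smooth_periodic T (casv m i c).
Proof.
split; first exact: Cn_casv.
by move=> a t; rewrite /casv cas_periodic.
Qed.

Local Notation V := (\prod_a T 0 a).

Lemma volume_gt0 : 0 < V.
Proof. by apply: prodr_gt0 => a _; exact: T0. Qed.

Lemma measurable_cas m : measurable_fun D (cas m).
Proof. exact/measurable_funTS/measurable_continuous/continuous_cas. Qed.

Lemma sqint_cas m : sqint mu D (cas m).
Proof.
apply: (@sqint_bounded _ _ _ _ _ _ 2); [exact: measurable_box|exact: lebesgue_box_lty
  |exact: measurable_cas|by move=> t _; exact: cas_bounded].
Qed.

Lemma integrable_cas m : mu.-integrable D (EFin \o cas m).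
Proof.
apply: sqint_integrable; [exact: measurable_box|exact: lebesgue_box_lty|exact: sqint_cas].
Qed.

(** For [m != 0] some [m 0 a] is nonzero, and [cas m] is then the partial derivative in direction
    [a] of a multiple of the periodic function [cas (- m)]. *)
Lemma integral_cas m : \int[mu]_(t in D) cas m t = if m == 0 then V else 0.
Proof.
case: eqVneq => [->|m0].
  under eq_Rintegral do rewrite cas0.
  rewrite Rintegral_cst; last exact: measurable_box.
  by rewrite mul1r; apply/(congr1 fine (lebesgue_box T0)).
have [a ma] : exists a, m 0 a != 0.
  have [/existsP//|] := boolP [exists a, m 0 a != 0].
  rewrite negb_exists => /forallP H; case/eqP: m0; apply/rowP => a; rewrite mxE.
  by have := H a; rewrite negbK => /eqP.
have fa : freq (- m) a != 0.
  by rewrite freqN oppr_eq0 mulf_neq0 ?intr_eq0// gt_eqF// base_freq_gt0.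
have E : partial a (cas (- m) : 'rV[R]_p -> R^o) = (fun t => freq (- m) a * cas m t).
  by rewrite partial_cas opprK.
have := @integral_partial_eq0 _ _ T T0 (cas (- m)) a.
rewrite E => H.
have : \int[mu]_(t in D) (freq (- m) a * cas m t) = 0.
  apply: H; first exact: continuous_cas.
  - by move=> t; exact: derivable_cas.
  - by move=> t; exact: (cvgMl_tmp (@continuous_cas m t)).
  - by move=> t; exact: cas_periodic.
rewrite RintegralZl; [|exact: measurable_box|exact: integrable_cas].
by move/eqP; rewrite mulf_eq0 (negbTE fa) => /eqP.
Qed.

Lemma ip_cas m l : ip mu D (cas m) (cas l) = if m == l then V else 0.
Proof.
have mD := measurable_box T.
rewrite /ip; under eq_Rintegral do rewrite casM.
have I q := integrable_cas q.
rewrite RintegralZl//; last by apply: intD => //; [exact: intD|exact: intB].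
rewrite RintegralD//; [|exact: intD|exact: intB].
rewrite RintegralD// RintegralB// !integral_cas !oppr_eq0 subr_eq0 subrr addr0.
by case: (m == l); [field|rewrite addr0 mulr0].
Qed.

End hartley.

(** * Boxes as bounded limits of trigonometric polynomials *)

Section completeness.
Context (R : realType) (p : nat) (T : 'rV[R]_p).
Hypothesis T0 : forall i, 0 < T 0 i.
Local Notation D := (box T : set (lebesgue_space R p)).
Local Notation mu := (@lebesgue R p).
Local Notation cas := (cas T).
Local Notation RT := (measurableTypeR R).

(** An inductive span instead of lists of coefficients: stability under products and orthogonality
    go by induction on the derivation. *)
Inductive trigpoly : ('rV[R]_p -> R) -> Prop :=
| trig_cas m : trigpoly (cas m)
| trig_lin c f g : trigpoly f -> trigpoly g -> trigpoly (fun t => c * f t + g t).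

Lemma eq_trig f g : f =1 g -> trigpoly f -> trigpoly g.
Proof. by move=> /funext ->. Qed.

Lemma trig0 : trigpoly (fun=> 0).
Proof.
by apply: eq_trig (trig_lin (-1) (trig_cas 0) (trig_cas 0)) => t; ring.
Qed.

Lemma trigZ c f : trigpoly f -> trigpoly (fun t => c * f t).
Proof. by move=> tf; apply: eq_trig (trig_lin c tf trig0) => t; ring. Qed.

Lemma trigD f g : trigpoly f -> trigpoly g -> trigpoly (fun t => f t + g t).
Proof. by move=> tf tg; apply: eq_trig (trig_lin 1 tf tg) => t; ring. Qed.

Lemma trigB f g : trigpoly f -> trigpoly g -> trigpoly (fun t => f t - g t).
Proof. by move=> tf tg; apply: eq_trig (trig_lin (-1) tg tf) => t; ring. Qed.

Lemma trig_cst c : trigpoly (fun=> c).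
Proof. by apply: eq_trig (trigZ c (trig_cas 0)) => t; rewrite cas0 mulr1. Qed.

Lemma trigM f g : trigpoly f -> trigpoly g -> trigpoly (fun t => f t * g t).
Proof.
move=> tf tg; elim: tf => [m|c f1 f2 _ IH1 _ IH2]; last first.
  by apply: eq_trig (trig_lin c IH1 IH2) => t; ring.
elim: tg => [l|c g1 g2 _ IH1 _ IH2]; last first.
  by apply: eq_trig (trig_lin c IH1 IH2) => t; ring.
have H q := trig_cas q.
apply: (eq_trig _ (trigZ 2^-1 (trigD (trigD (H (m - l)) (H (- (m - l))))
  (trigB (H (m + l)) (H (- (m + l))))))) => t.
by rewrite casM.
Qed.

Lemma trigX f k : trigpoly f -> trigpoly (fun t => f t ^+ k).
Proof.
move=> tf; elim: k => [|k IH]; first by apply: eq_trig (trig_cst 1) => t; rewrite expr0.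
by apply: eq_trig (trigM tf IH) => t; rewrite exprS.
Qed.

Lemma trig_prod I (s : seq I) (F : I -> 'rV[R]_p -> R) :
  (forall i, trigpoly (F i)) -> trigpoly (fun t => \prod_(i <- s) F i t).
Proof.
move=> tF; elim: s => [|i s IH].
  by apply: eq_trig (trig_cst 1) => t; rewrite big_nil.
by apply: eq_trig (trigM (tF i) IH) => t; rewrite big_cons.
Qed.

Lemma trig_cos_shift m b : trigpoly (fun t => cos (phase T m t - b)).
Proof.
have H q := trig_cas q.
apply: (eq_trig _ (trigD (trigZ (cos b * 2^-1) (trigD (H m) (H (- m))))
   (trigZ (sin b * 2^-1) (trigB (H m) (H (- m)))))) => t.
rewrite cosD sinN cosN cos_phaseE sin_phaseE.
by move: (cos b) (sin b) (cas m t) (cas (- m) t) => *; ring.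
Qed.

Lemma sqint_trig f : trigpoly f -> sqint mu D f.
Proof.
have mD := measurable_box T.
elim=> [m|c g h _ IH1 _ IH2]; first exact: sqint_cas.
have H := sqintD mD (sqintZ mD c IH1) IH2. exact: H.
Qed.

Lemma trig_orthogonal f q : sqint mu D f ->
  (forall m, ip mu D f (cas m) = 0) -> trigpoly q -> ip mu D f q = 0.
Proof.
have mD := measurable_box T.
move=> sf fm; elim=> [m|c g h tg IH1 th IH2]; first exact: fm.
have sg := sqint_trig tg; have sh := sqint_trig th.
rewrite ipC (ipDl mD (sqintZ mD c sg) sh sf) (ipZl mD c sg sf).
by rewrite ipC IH1 ipC IH2 mulr0 addr0.
Qed.

(* [step_poly k y] tends to the indicator of [y < 1/2] on the whole of [0, 1],
   the point [1/2] included. *)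
Definition step_poly k (y : R) : R := (1 - y ^+ k) ^+ (k * 2 ^ k).

Lemma step_poly_itv k (y : R) : 0 <= y <= 1 -> 0 <= step_poly k y <= 1.
Proof.
move=> /andP[y0 y1]; have yk1 : y ^+ k <= 1 by exact: exprn_ile1.
have yk0 : 0 <= y ^+ k by exact: exprn_ge0.
by rewrite /step_poly exprn_ge0 ?subr_ge0//= exprn_ile1 ?subr_ge0// gerBl.
Qed.

(** With [z = s ^+ 2], the factor [k * s ^+ k] stays below [1 / (1 - s)], by induction, and the
    remaining [s ^+ k] tends to zero. *)
Lemma cvg_natmul_geometric (z : R) : 0 <= z -> z < 1 ->
  (fun k => k%:R * z ^+ k) @ \oo --> (0 : R).
Proof.
move=> z0 z1; set s := Num.sqrt z.
have s0 : 0 <= s by exact: sqrtr_ge0.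
have s2 : s ^+ 2 = z by exact: sqr_sqrtr.
have s1 : s < 1 by rewrite -(@ltr_pXn2r _ 2) ?nnegrE// s2 expr1n.
have bound k : k%:R * s ^+ k * (1 - s) <= 1 - s ^+ k.
  elim: k => [|k IH]; first by rewrite expr0 !mul0r subrr.
  have sk0 : 0 <= s ^+ k by exact: exprn_ge0.
  have sk1 : s ^+ k <= 1 by rewrite exprn_ile1// ltW.
  have := ler_wpM2l s0 IH; rewrite exprS -natr1.
  have sk : s * s ^+ k <= 1 by rewrite -exprS exprn_ile1// ltW.
  have : 0 <= (1 - s) * (1 - s * s ^+ k) by rewrite mulr_ge0// subr_ge0// ltW.
  by move: (s ^+ k) (k%:R : R) => x n h1 h2; lra.
apply: (@squeeze_cvgr _ _ _ _ (fun=> 0) (fun k => geometric (1 - s)^-1 s k)).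
- apply: nearW => k; rewrite /= mulr_ge0 ?exprn_ge0//=.
  rewrite -s2 -exprM mul2n -addnn exprD mulrA ler_wpM2r ?exprn_ge0//.
  rewrite -[leRHS]mul1r ler_pdivlMr ?subr_gt0// (le_trans (bound k))//.
  by rewrite gerBl exprn_ge0.
- exact: cvg_cst.
- by apply: cvg_geometric; rewrite ger0_norm.
Qed.

(** Below [1/2], Bernoulli gives the lower bound [1 - k (2y)^k]. From [1/2] on, [1 - x <= exp (- x)]
    gives the upper bound [exp (- k (2y)^k) <= exp (- k)]. The factor [k] in the exponent forces the
    limit [0] at [y = 1/2], where [2 ^ k] alone would give [exp (-1)]. *)
Lemma cvg_step_poly (y : R) : 0 <= y <= 1 ->
  (fun k => step_poly k y) @ \oo --> (if y < 2^-1 then 1 else 0 : R).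
Proof.
move=> y01; have /andP[y0 y1] := y01; case: ltP => [yh|yh] /=; last first.
  apply: (@squeeze_cvgr _ _ _ _ (fun=> 0) (fun k => geometric 1 (expR (-1) : R) k)).
  - apply: nearW => k; have /andP[-> _] /= := @step_poly_itv k y y01.
    have yk1 : y ^+ k <= 1 by exact: exprn_ile1.
    apply: (@le_trans _ _ (expR (- y ^+ k) ^+ (k * 2 ^ k))).
      rewrite /step_poly lerXn2r ?nnegrE ?expR_ge0 ?subr_ge0//.
      exact: expR_ge1Dx.
    rewrite /= mul1r -!expRM_natl ler_expR.
    rewrite !mulrN mulr1 lerN2 natrM -mulrA ler_peMr//.
    rewrite natrX -exprMn exprn_ege1//.
    by rewrite -(ler_pM2l (ltr0Sn R 1)) mulfV// in yh.
  - exact: cvg_cst.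
  - by apply: cvg_geometric; rewrite ger0_norm ?expR_ge0// -expR0 ltr_expR; lra.
apply: (@squeeze_cvgr _ _ _ _ (fun k : nat => 1 - k%:R * (2 * y) ^+ k) (fun=> 1)).
- apply: nearW => k; have /andP[_ ->] := @step_poly_itv k y y01; rewrite andbT.
  have yk1 : y ^+ k <= 1 by exact: exprn_ile1.
  have bern (x : R) n : 0 <= x -> x <= 1 -> 1 - n%:R * x <= (1 - x) ^+ n.
    move=> x0 x1; elim: n => [|n IH]; first by rewrite mul0r subr0 expr0.
    rewrite exprS; apply: (@le_trans _ _ ((1 - x) * (1 - n%:R * x))).
      have : 0 <= n%:R * x * x by rewrite !mulr_ge0.
      by rewrite -natr1; lra.
    by rewrite ler_wpM2l ?subr_ge0.
  apply: le_trans (bern _ _ (exprn_ge0 k y0) yk1).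
  by rewrite exprMn natrM natrX mulrA.
- rewrite -[X in _ --> X]subr0; apply: cvgB; first exact: cvg_cst.
  by apply: cvg_natmul_geometric; [rewrite mulr_ge0|lra].
- exact: cvg_cst.
Qed.

(** The faces [t 0 a = 0] are left out: by periodicity a trigonometric polynomial does not
    distinguish them from [t 0 a = T 0 a]. *)
Definition corner (c : 'I_p -> R) (t : 'rV[R]_p) : R :=
  \prod_a (if 0 < t 0 a < c a then 1 else 0).

Lemma cornerE c t : corner c t = if [forall a, 0 < t 0 a < c a] then 1 else 0.
Proof.
case: ifPn => [/forallP H|]; first by apply: big1 => a _; rewrite H.
rewrite negb_forall => /existsP[a /negbTE na].
by rewrite /corner (bigD1 a)//= na mul0r.
Qed.

(** On the circle of length [T 0 a], the arc from [0] to [c a] is centred at [c a / 2], and the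
    cosine peaking there exceeds its value at the end points exactly inside the arc. The affine
    rescaling takes values in [[0, 1]] and puts the end points at [1/2], the threshold of
    [step_poly]. *)
Definition arc_arg (c : 'I_p -> R) a (t : 'rV[R]_p) : R :=
  2^-1 - 4^-1 * (cos (phase T (delta_mx 0 a) t - pi * c a / T 0 a)
                  - cos (pi * c a / T 0 a)).

Lemma phase_delta a t : phase T (delta_mx 0 a) t = 2 * (pi * t 0 a / T 0 a).
Proof.
rewrite /phase (bigD1 a)//= big1 => [|b ba]; last first.
  by rewrite /freq mxE (negbTE ba) /= mulr0z !mul0r.
rewrite addr0 /freq mxE !eqxx /= /base_freq mul1r.
by move: (pi : R) => x; field; rewrite gt_eqF.
Qed.

Lemma arc_arg_itv c a t : 0 <= arc_arg c a t <= 1.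
Proof.
rewrite /arc_arg; set u := _ - _ / _; set v := _ / _.
have := cos_geN1 u; have := cos_le1 u; have := cos_geN1 v; have := cos_le1 v.
by move: (cos u) (cos v) => x y *; apply/andP; split; lra.
Qed.

(** The difference of cosines is twice [sin (pi t / T) * sin (pi (c - t) / T)], so its sign can be
    read off from the signs of [t] and [c - t]. *)
Lemma arc_arg_lt c a t : box T t -> 0 < c a <= T 0 a ->
  (arc_arg c a t < 2^-1) = (0 < t 0 a < c a).
Proof.
move=> Dt /andP[c0 cT]; have /andP[t0 tT] := Dt a; have Ta := T0 a.
rewrite /arc_arg phase_delta.
have -> : cos (2 * (pi * t 0 a / T 0 a) - pi * c a / T 0 a) - cos (pi * c a / T 0 a)
   = 2 * (sin (pi * (t 0 a / T 0 a)) * sin (pi * ((c a - t 0 a) / T 0 a))).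
  rewrite -!mulrA; set x := pi * (t 0 a / T 0 a).
  have -> : pi * ((c a - t 0 a) / T 0 a) = pi * (c a / T 0 a) - x.
    by rewrite /x mulrBl mulrBr.
  set z := pi * (c a / T 0 a); move: x z => x z.
  have -> : 2 * x - z = x - (z - x) by ring.
  have -> : cos z = cos (x + (z - x)) by congr cos; ring.
  move: (z - x) => y; rewrite !cosD cosN sinN.
  by move: (cos x) (cos y) (sin x) (sin y) => *; ring.
have -> : forall w : R, (2^-1 - 4^-1 * (2 * w) < 2^-1) = (0 < w).
  by move=> w; rewrite ltrBlDr ltrDl pmulr_rgt0 ?pmulr_rgt0 ?invr_gt0.
have spos x : 0 < x -> x < T 0 a -> 0 < sin (pi * (x / T 0 a)).
  move=> x0 xT; apply: sin_gt0_pi; have P := pi_gt0 R; apply/andP; split.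
    by apply: mulr_gt0 => //; exact: divr_gt0.
  by rewrite gtr_pMr// ltr_pdivrMr// mul1r.
have sge x : 0 <= x -> x <= T 0 a -> 0 <= sin (pi * (x / T 0 a)).
  move=> x0 xT; apply: sin_ge0_pi; have P := pi_ge0 R; apply/andP; split.
    by apply: mulr_ge0 => //; apply: divr_ge0 => //; exact: ltW.
  by apply: ler_piMr => //; rewrite ler_pdivrMr// mul1r.
have [tpos|] := ltP 0 (t 0 a); last first.
  move=> t0'; have -> : t 0 a = 0 by apply/eqP; rewrite eq_le t0 t0'.
  by rewrite mul0r mulr0 sin0 mul0r ltxx.
have [tc|ct] /= := ltP (t 0 a) (c a).
  apply/mulr_gt0; apply: spos => //; first by lra.
    by rewrite subr_gt0.
  by lra.
apply/negbTE; rewrite -leNgt; apply: mulr_ge0_le0; first exact: sge.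
have -> : pi * ((c a - t 0 a) / T 0 a) = - (pi * ((t 0 a - c a) / T 0 a)).
  by rewrite -mulrN -mulNr opprB.
by rewrite sinN oppr_le0; apply: sge; lra.
Qed.

Lemma trig_arc c k : trigpoly (fun t => \prod_a step_poly k (arc_arg c a t)).
Proof.
apply: trig_prod => a; rewrite /step_poly; apply/trigX/trigB; first exact: trig_cst.
apply/trigX/trigB; first exact: trig_cst.
by apply/trigZ/trigB; [exact: trig_cos_shift|exact: trig_cst].
Qed.

Lemma cvg_arc c t : box T t -> (forall a, 0 < c a <= T 0 a) ->
  (fun k => \prod_a step_poly k (arc_arg c a t)) @ \oo --> corner c t.
Proof.
move=> Dt c0; apply: (@cvg_big _ _ _ _ _ (@mul_continuous _) _ \oo) => a _.
by rewrite -arc_arg_lt//; apply: cvg_step_poly; exact: arc_arg_itv.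
Qed.

Lemma measurable_corner c : (forall a, 0 < c a <= T 0 a) ->
  measurable_fun D (corner c).
Proof.
move=> c0; apply: (@measurable_fun_cvg _ (lebesgue_space R p) R D
    (fun k t => \prod_a step_poly k (arc_arg c a t)) (corner c)).
  by move=> k; have [m _] := sqint_trig (trig_arc c k).
by move=> t Dt; exact: cvg_arc.
Qed.

(** [f] is orthogonal to each approximating polynomial, and since these take values in [[0, 1]],
    dominated convergence applies with [|f|]. *)
Lemma integral_corner_eq0 f c : sqint mu D f ->
  (forall m, ip mu D f (cas m) = 0) -> (forall a, 0 < c a <= T 0 a) ->
  (\int[mu]_(t in D) (f t * corner c t)%:E = 0)%E.
Proof.
move=> sf fm c0; have mD := measurable_box T.
pose q k (t : lebesgue_space R p) : R := \prod_a step_poly k (arc_arg c a t).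
have sq k : sqint mu D (q k) by exact: (sqint_trig (trig_arc c k)).
have mq k : measurable_fun D (q k) by case: (sq k).
have mf : measurable_fun D f by case: sf.
have If := sqint_integrable mD (lebesgue_box_lty T0) sf.
have m1 k : measurable_fun D (fun t => (f t * q k t)%:E).
  by apply/measurable_EFinP; exact: measurable_funM.
have m2 : measurable_fun D (fun t => (f t * corner c t)%:E).
  by apply/measurable_EFinP; apply: measurable_funM => //; exact: measurable_corner.
have lim : {ae mu, forall t, D t ->
    (fun k => (f t * q k t)%:E) @ \oo --> (f t * corner c t)%:E}.
  apply: aeW => t Dt; apply: cvg_EFin; first exact: nearW.
  exact: (cvgMl_tmp (cvg_arc Dt c0)).
have dom : {ae mu, forall t k, D t -> (`|(f t * q k t)%:E| <= `|(EFin \o f) t|)%E}.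
  apply: aeW => t k Dt; rewrite /= lee_fin normrM ler_piMr//.
  rewrite normr_prod; apply: prodr_ile1 => a _; rewrite normr_ge0 /=.
  have /andP[h0 h1] := step_poly_itv k (arc_arg_itv c a t).
  by rewrite ger0_norm.
have [_ _] := dominated_convergence mD m1 m2 lim (integrable_abse If) dom.
have -> : [sequence (\int[mu]_(t in D) (f t * q k t)%:E)%E]_k = fun=> 0%E.
  apply/funext => k; have := trig_orthogonal sf fm (trig_arc c k).
  rewrite /ip /Rintegral /= -/(q k) => H.
  by rewrite -[LHS]fineK ?H// (integrable_fin_num mD (sqintM mD sf (sq k))).
move=> H; apply/esym; apply: (cvg_unique _ (cvg_cst _) H); exact: ereal_hausdorff.
Qed.

End completeness.

(** * Orthants generating the Borel sets, and Borel hulls *)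

Section tuple_corners.
Context (R : realType) (p : nat).
Local Notation RT := (measurableTypeR R).

Definition tuple_corner (c : 'I_p -> R) : set (p.-tuple RT) :=
  [set x | forall a, tnth x a < c a].

Lemma measurable_tuple_corner c : measurable (tuple_corner c).
Proof.
have -> : tuple_corner c =
    \bigcap_(a in [set: 'I_p]) ((@tnth p RT)^~ a @^-1` [set` `]-oo, c a[ ]).
  apply/seteqP; split => x /= H a; first by move=> _ /=; rewrite in_itv/=; exact: H.
  by have := H a I; rewrite /= in_itv.
apply: fin_bigcap_measurable => [|a _]; first exact: finite_finset.
by rewrite -[X in measurable X]setTI; apply: measurable_tnth => //; exact: measurable_itv.
Qed.

(** A half-space bounding coordinate [a] is the union over [n] of the orthants whose other bounds
    are [n]; an [n] beyond the sum of the absolute values of the coordinates captures a given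
    point. *)
Lemma measurable_tupleE :
  @measurable _ (p.-tuple RT) = <<s range tuple_corner >>.
Proof.
apply/seteqP; split; last first.
  apply: smallest_sub; first exact: sigma_algebra_measurable.
  by move=> _ [c _ <-]; exact: measurable_tuple_corner.
have : measurable_fun setT (id : g_sigma_algebraType (range tuple_corner) -> p.-tuple RT).
  apply/measurable_fun_tnthP => a.
  apply: (measurability _ (RGenInftyO.measurableE R)) => _ [_ [x ->] <-].
  rewrite setTI (_ : _ @^-1` _ = \bigcup_n
    tuple_corner (fun b => if b == a then x else n%:R)).
    apply: bigcupT_measurable => n; apply: sub_sigma_algebra.
    by eexists.
  apply/seteqP; split => y /=; rewrite in_itv/=.
    move=> yx; pose M := \sum_b `|tnth y b|.
    exists (Num.bound M) => // b; case: eqVneq => [->//|_].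
    have bM : tnth y b <= M.
      rewrite (le_trans (ler_norm _))// /M (bigD1 b)//= lerDl.
      by apply: sumr_ge0 => *.
    by rewrite (le_lt_trans bM)// archi_boundP// sumr_ge0.
  by move=> [n _ /(_ a)]; rewrite eqxx.
by move=> mid B mB; have := mid measurableT B mB; rewrite setTI.
Qed.

Lemma setI_closed_tuple_corner : setI_closed (range tuple_corner).
Proof.
move=> _ _ [c _ <-] [d _ <-]; exists (fun a => Num.min (c a) (d a)) => //.
apply/seteqP; split => x; rewrite /tuple_corner /=.
  by move=> H; split => a; have := H a; rewrite lt_min => /andP[].
by move=> [H1 H2] a; rewrite lt_min H1 H2.
Qed.

(** Intersect countable covers whose total measure exceeds the outer measure by less than [1/(k+1)].
    A measurable set of finite measure then differs from its hull by a null set, which carries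
    statements from Borel sets to all measurable ones. *)
Lemma borel_hull (A : set (lebesgue_space R p)) : (@lebesgue R p A < +oo)%E ->
  exists B : set (p.-tuple RT), [/\ measurable B, A `<=` @tv R p @^-1` B &
    @lebesgue R p (@tv R p @^-1` B) = @lebesgue R p A].
Proof.
move=> Aoo; pose A' : set (p.-tuple RT) := [set x | A (rv x)].
have AE : @lebesgue R p A = mu_ext (lebesgue_tuple R p) A' by [].
have Afin : mu_ext (lebesgue_tuple R p) A' \is a fin_num.
  by rewrite ge0_fin_numE -?AE//; exact: measure_ge0.
have /choice[F HF] : forall k : nat, exists F : (set (p.-tuple RT))^nat,
    measurable_cover A' F /\ (\sum_(j <oo) lebesgue_tuple R p (F j) <
      mu_ext (lebesgue_tuple R p) A' + (k.+1%:R^-1)%:E)%E.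
  move=> k; have k0 : 0 < k.+1%:R^-1 :> R by rewrite invr_gt0.
  by have [_ [F cF <-] H] := lb_ereal_inf_adherent k0 Afin; exists F.
pose U k := \bigcup_j F k j.
have mU k : measurable (U k) by apply: bigcupT_measurable => j; case: (HF k) => -[].
have mB : measurable (\bigcap_k U k) by exact: bigcapT_measurable.
exists (\bigcap_k U k); split => //.
  move=> t At k _; have [[_ AF] _] := HF k.
  by apply: AF; rewrite /A' /= tvK.
apply/eqP; rewrite eq_le; apply/andP; split; last first.
  apply: (@le_outer_measure _ _ (@lebesgue_outer R p)) => t At k _.
  by have [[_ AF] _] := HF k; apply: AF; rewrite /A' /= tvK.
rewrite lebesgue_tv// AE; apply/lee_addgt0Pr => e e0.
have [k _ ke] : \forall k \near \oo, k.+1%:R^-1 < e.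
  exact: near_infty_natSinv_lt (PosNum e0).
have [[mF _] Hk] := HF k.
apply: (@le_trans _ _ (lebesgue_tuple R p (U k))).
  by apply: le_measure; rewrite ?inE//; exact: bigcap_inf.
apply: (@le_trans _ _ (\sum_(j <oo) lebesgue_tuple R p (F k j))%E).
  exact: measure_sigma_subadditive.
apply: (le_trans (ltW Hk)); rewrite leeD2l// lee_fin ltW//.
exact: (ke k (leqnn k)).
Qed.

End tuple_corners.

(** * Completeness of the Hartley system *)

Section cas_complete.
Context (R : realType) (p : nat) (T : 'rV[R]_p).
Hypothesis T0 : forall i, 0 < T 0 i.
Local Notation D := (box T : set (lebesgue_space R p)).
Local Notation mu := (@lebesgue R p).
Local Notation cas := (cas T).
Local Notation RT := (measurableTypeR R).

(** Off these finitely many null faces, [corner] is the indicator of an orthant. *)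
Lemma faces_null :
  {ae mu, forall t, D t -> forall a, 0 < t 0 a < T 0 a}.
Proof.
have H : {ae mu, forall t, forall a, ~ (D t /\ t 0 a = 0) /\ ~ (D t /\ t 0 a = T 0 a)}.
  apply: filter_forall => a.
  have N c : {ae mu, forall t, ~ (D t /\ t 0 a = c)}.
    exists (D `&` [set t | t 0 a = c]); split.
    - apply: measurableI; first exact: measurable_box.
      rewrite -[X in measurable X]setTI.
      exact: (measurable_coord a measurableT (measurable_set1 c)).
    - exact: box_face_null.
    - by move=> t /= /contrapT.
  by apply: filterS2 (N 0) (N (T 0 a)).
apply: filterS H => t H Dt a; have [Ha HTa] := H a; have /andP[ta0 taT] := Dt a.
rewrite !lt_neqAle ta0 taT !andbT; apply/andP; split; apply/eqP => E.
  by apply: Ha.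
by apply: HTa.
Qed.

Variable f : lebesgue_space R p -> R.
Hypothesis sf : sqint mu D f.
Hypothesis f_orth : forall m, ip mu D f (cas m) = 0.

Let If : mu.-integrable D (EFin \o f).
Proof. exact: (sqint_integrable (measurable_box T) (lebesgue_box_lty T0) sf). Qed.

(** The class of sets for Dynkin induction. It is stable under complement because the integral of
    [f] over the whole box vanishes, by orthogonality to [cas 0 = 1]. *)
Let P (B : set (p.-tuple RT)) :=
  (\int[mu]_(t in D `&` @tv R p @^-1` B) (f t)%:E = 0)%E.

Let mtv B : measurable B -> measurable (@tv R p @^-1` B).
Proof. by move=> mB; rewrite -[X in measurable X]setTI; exact: measurable_tv. Qed.

Let PT : P setT.
Proof.
rewrite /P preimage_setT setIT; have := f_orth 0; rewrite /ip.
under eq_Rintegral do rewrite cas0 mulr1.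
rewrite /Rintegral => H.
by rewrite -[LHS]fineK ?H// (integrable_fin_num (measurable_box T) If).
Qed.

Let PC B : measurable B -> P B -> P (~` B).
Proof.
move=> mB PB; have mD := measurable_box T.
have mB' := mtv mB; have mC : measurable (~` (@tv R p @^-1` B)) by exact: measurableC.
have [m1 m2] := (measurableI _ _ mD mB', measurableI _ _ mD mC).
have DE : D = (D `&` @tv R p @^-1` B) `|` (D `&` ~` (@tv R p @^-1` B)).
  by rewrite -setIUr setUv setIT.
have := @integral_setU _ _ _ mu _ _ (EFin \o f) m1 m2.
rewrite -DE PB add0e; have := PT; rewrite /P preimage_setT setIT => ->.
move=> H; rewrite preimage_setC; apply/esym/H; first exact: measurable_int If.
by apply/disj_setPS => t [[_ h] [_]].
Qed.

Let PU (F : (set (p.-tuple RT))^nat) : (forall k, measurable (F k)) ->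
  trivIset setT F -> (forall k, P (F k)) -> P (\bigcup_k F k).
Proof.
move=> mF tF PF; rewrite /P preimage_bigcup setI_bigcupr.
rewrite integral_bigcup.
- by rewrite eseries0// => k _ _; exact: PF.
- apply: trivIset_setIl; apply/trivIsetP => i j _ _ ij; rewrite -preimage_setI.
  by move/trivIsetP : tF => /(_ _ _ _ _ ij) ->//; rewrite preimage_set0.
- by move=> k; apply: measurableI; [exact: measurable_box|exact: mtv].
- rewrite -setI_bigcupr; apply: (integrableS (measurable_box T)) => //.
  apply: measurableI; first exact: measurable_box.
  by apply: bigcupT_measurable => k; exact: mtv.
Qed.

Let Pcorner c : P (tuple_corner c).
Proof.
have mD := measurable_box T.
have [[a c0]|c0] := pselect (exists a, c a <= 0).
  rewrite /P (_ : _ `&` _ = set0) ?integral_set0//.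
  apply/seteqP; split => // t [Dt /(_ a)]; rewrite tnth_mktuple => ta.
  have /andP[ta0 _] := Dt a.
  by move: (le_lt_trans ta0 (lt_le_trans ta c0)); rewrite ltxx.
have cpos a : 0 < c a by rewrite ltNge; apply/negP => ca; apply: c0; exists a.
(* Truncation brings the corner into the range where [arc_arg] describes it; off the faces it does
   not change the trace of the orthant on the box. *)
pose c' a := Num.min (c a) (T 0 a).
have c'0 a : 0 < c' a <= T 0 a by rewrite /c' lt_min cpos T0 ge_min lexx orbT.
rewrite /P integral_mkcondr -(integral_corner_eq0 T0 sf f_orth c'0).
have mc : measurable_fun D (fun t => (f t * corner c' t)%:E).
  apply/measurable_EFinP/measurable_funM; first by case: sf.
  exact: measurable_corner.
apply: ae_eq_integral => //.
  apply/(measurable_restrict _ (mtv (measurable_tuple_corner c)) mD).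
  apply: (measurable_funS mD); first exact: subIsetl.
  exact: measurable_int If.
apply: filterS faces_null => t H Dt; have tT := H Dt.
rewrite cornerE patchE; case: ifPn => [|/negP tc].
  rewrite inE => tc; rewrite ifT ?mulr1//; apply/forallP => a.
  have := tc a; rewrite tnth_mktuple /c' lt_min => ->.
  by have /andP[-> ->] := tT a.
rewrite ifF ?mulr0//; apply/negP => /forallP tc'; apply: tc; rewrite inE => a.
by have := tc' a; rewrite tnth_mktuple /c' lt_min => /andP[_ /andP[]].
Qed.

Lemma integral_borel_eq0 B : measurable B -> P B.
Proof.
move=> mB; rewrite measurable_tupleE in mB; move: B mB.
apply: (@dynkin_induction _ _ (range (@tuple_corner R p)) P (measurable_tupleE R p)) => //.
- exact: setI_closed_tuple_corner.
- by move=> _ [c _ <-]; exact: Pcorner.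
Qed.

(** A function is zero almost everywhere once its integral over every measurable [A] in the box is
    zero; replacing [A] by the trace of its Borel hull changes the integral by that over a null
    set. *)
Lemma cas_complete : {ae mu, forall t, D t -> f t = 0}.
Proof.
have mD := measurable_box T.
have H : ae_eq mu D (EFin \o f) (cst 0%E).
  apply: integral_ae_eq => // A AD mA; rewrite integral0.
  have Aoo : (mu A < +oo)%E.
    by apply: le_lt_trans (lebesgue_box_lty T0); apply: le_measure; rewrite ?inE.
  have [B [mB AB BA]] := borel_hull Aoo.
  have mA' : measurable ((D `&` @tv R p @^-1` B) `\` A).
    by apply: measurableD => //; apply: measurableI => //; exact: mtv.
  have null : mu ((D `&` @tv R p @^-1` B) `\` A) = 0%E.
    have mB' := mtv mB.
    apply/eqP; rewrite eq_le measure_ge0 andbT.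
    apply: (@le_trans _ _ (mu (@tv R p @^-1` B `\` A))).
      apply: le_measure; rewrite ?inE//; first exact: measurableD.
      by apply: setSD; exact: subIsetr.
    rewrite measureD//; last by rewrite [ltLHS]BA.
    by rewrite setIidr// [X in (X - _)%E]BA subee// ge0_fin_numE// measure_ge0.
  have mDB : measurable (D `&` @tv R p @^-1` B) by apply: measurableI => //; exact: mtv.
  have := integral_borel_eq0 mB; rewrite /P => <-.
  rewrite (negligible_integral mA' mDB _ null); last first.
    by apply: (integrableS mD mDB) => //; exact: subIsetl.
  rewrite setDD setIidr// => t At; split; [exact: AD|exact: AB].
by apply: filterS H => t H Dt; have := H Dt => /= -[].
Qed.

End cas_complete.

(** * Fourier projections and the spectral gap *)

Section integer_boxes.
Variable p : nat.

(** All [m] with coordinates of absolute value at most [N]: each [k a] runs from [0] to [2N] and is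
    shifted by [N]. [undup] gives uniqueness without an injectivity argument for this
    parametrization. *)
Definition zbox (N : nat) : seq 'rV[int]_p :=
  locked (undup [seq \row_a ((k a : nat)%:Z - N%:Z) | k : {ffun 'I_p -> 'I_(N.*2.+1)}]).

Lemma zbox_uniq N : uniq (zbox N).
Proof. by rewrite /zbox -lock undup_uniq. Qed.

Lemma mem_zbox N (m : 'rV[int]_p) :
  (m \in zbox N) = [forall a, (`|m 0%R a| <= N)%N].
Proof.
rewrite /zbox -lock mem_undup; apply/mapP/forallP => [[k _ ->] a|H].
  rewrite mxE; have := ltn_ord (k a); move: (nat_of_ord (k a)) => i; lia.
have H' a : (absz (m 0 a + N%:Z)%R < N.*2.+1)%N by have := H a; lia.
exists [ffun a => Ordinal (H' a)]; first by rewrite mem_enum.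
by apply/rowP => a; rewrite !mxE ffunE /=; have := H a; lia.
Qed.

Lemma zbox_le M N : (M <= N)%N -> {subset zbox M <= zbox N}.
Proof.
move=> MN m; rewrite !mem_zbox => /forallP H; apply/forallP => a.
exact: leq_trans (H a) MN.
Qed.

Lemma zbox_split (R : zmodType) M N (F : 'rV[int]_p -> R) : (M <= N)%N ->
  \sum_(m <- zbox N) F m =
  \sum_(m <- zbox M) F m + \sum_(m <- [seq m <- zbox N | m \notin zbox M]) F m.
Proof.
move=> MN.
rewrite [LHS](bigID (fun m => m \in zbox M)).
rewrite -[X in X + _ = _]big_filter.
rewrite -[X in _ + X = _]big_filter.
congr (_ + _).
apply: perm_big; apply: uniq_perm; rewrite ?filter_uniq ?zbox_uniq//.
by move=> m; rewrite mem_filter; case: (boolP (m \in zbox M)) => // /(zbox_le MN).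
Qed.

End integer_boxes.

#[local] Opaque cas.

(** * Bessel, Parseval and the spectral gap *)

Section parseval.
Context (R : realType) (p : nat) (T : 'rV[R]_p).
Hypothesis T0 : forall i, 0 < T 0 i.
Local Notation D := (box T : set (lebesgue_space R p)).
Local Notation mu := (@lebesgue R p).
Local Notation cas := (cas T).
Local Notation V := (\prod_a T 0 a).
Local Notation sqint := (sqint mu D).
Local Notation ip := (ip mu D).
Implicit Types (f g : lebesgue_space R p -> R) (m : 'rV[int]_p).

Let mD := measurable_box T.
Let V0 : 0 < V := volume_gt0 T0.
Let sc m : sqint (cas m) := sqint_cas T0 m.

Definition cas_sum (r : seq 'rV[int]_p) (d : 'rV[int]_p -> R) (t : lebesgue_space R p) : R :=
  \sum_(m <- r) d m * cas m t.

Lemma sqint_cas_sum r d : sqint (cas_sum r d).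
Proof. by apply: (sqint_sum mD) => m _; exact: (sqintZ mD _ (sc m)). Qed.

Lemma ip_cas_sum r d l : uniq r ->
  ip (cas_sum r d) (cas l) = if l \in r then V * d l else 0.
Proof.
move=> ur; have sm m (_ : true) := sqintZ mD (d m) (sc m).
rewrite /cas_sum (ip_suml mD r sm (sc l)).
rewrite [LHS](eq_bigr (fun m => d m * (if m == l then V else 0))); last first.
  by move=> m _; rewrite (ipZl mD (d m) (sc m) (sc l)) (ip_cas T0).
move: (\prod_a T 0 a) => v.
case: ifPn => lr.
  rewrite (bigD1_seq l)//= eqxx big1 ?addr0 1?mulrC// => m ml.
  by rewrite (negbTE ml) mulr0.
rewrite big_seq big1// => m mr; case: eqVneq => [ml|]; last by rewrite mulr0.
by rewrite -ml mr in lr.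
Qed.

Lemma ip_cas_sum_r r d f : sqint f ->
  ip f (cas_sum r d) = \sum_(m <- r) d m * ip f (cas m).
Proof.
move=> sf; have sm m (_ : true) := sqintZ mD (d m) (sc m).
rewrite ipC /cas_sum (ip_suml mD r sm sf).
by apply: eq_bigr => m _; rewrite (ipZl mD (d m) (sc m) sf) ipC.
Qed.

Lemma cas_sum_norm r d : uniq r ->
  ip (cas_sum r d) (cas_sum r d) = V * \sum_(m <- r) d m ^+ 2.
Proof.
move=> ur; rewrite ip_cas_sum_r; last exact: sqint_cas_sum.
rewrite mulr_sumr big_seq [RHS]big_seq; apply: eq_bigr => m mr.
by rewrite ip_cas_sum// mr; ring.
Qed.

(** [V] is the common squared norm of the [cas m], so this is the orthogonal projection on the span
    of those with [m] in [r] when [r] has no repetition. *)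
Definition fproj r f := cas_sum r (fun m => ip f (cas m) / V).

Lemma fproj_norm r f : uniq r ->
  ip (fproj r f) (fproj r f) = V^-1 * \sum_(m <- r) ip f (cas m) ^+ 2.
Proof.
move=> ur; rewrite cas_sum_norm// !mulr_sumr; apply: eq_bigr => m _.
by field; rewrite gt_eqF.
Qed.

Lemma fproj_residual r f : sqint f -> uniq r ->
  ip (fun t => f t - fproj r f t) (fun t => f t - fproj r f t) =
  ip f f - V^-1 * \sum_(m <- r) ip f (cas m) ^+ 2.
Proof.
move=> sf ur; rewrite (ip_subE mD sf (sqint_cas_sum _ _)).
rewrite (fproj_norm f ur) (ip_cas_sum_r _ _ sf).
have -> : \sum_(m <- r) ip f (cas m) / V * ip f (cas m) =
  V^-1 * \sum_(m <- r) ip f (cas m) ^+ 2.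
  by rewrite mulr_sumr; apply: eq_bigr => m _; rewrite expr2; ring.
by ring.
Qed.

Lemma bessel r f : sqint f -> uniq r ->
  V^-1 * \sum_(m <- r) ip f (cas m) ^+ 2 <= ip f f.
Proof. by move=> sf ur; rewrite -subr_ge0 -(fproj_residual sf ur); exact: ip_ge0. Qed.

Definition energy f N := V^-1 * \sum_(m <- zbox p N) ip f (cas m) ^+ 2.

Lemma energy_nd f : nondecreasing_seq (energy f).
Proof.
move=> M N MN; rewrite /energy (zbox_split _ MN) mulrDr lerDl.
by rewrite mulr_ge0 ?invr_ge0 ?(ltW V0)// sumr_ge0// => m _; rewrite sqr_ge0.
Qed.

Lemma fproj_diff f M N : (M <= N)%N ->
  ip (fun t => fproj (zbox p N) f t - fproj (zbox p M) f t)
     (fun t => fproj (zbox p N) f t - fproj (zbox p M) f t) =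
  energy f N - energy f M.
Proof.
move=> MN; set r := [seq m <- zbox p N | m \notin zbox p M].
transitivity (ip (fproj r f) (fproj r f)).
  by apply: eq_ip => t _; rewrite /fproj /cas_sum (zbox_split _ MN) addrAC subrr add0r.
rewrite fproj_norm ?filter_uniq ?zbox_uniq// /energy (zbox_split _ MN) mulrDr.
by rewrite addrAC subrr add0r.
Qed.

(** Bessel bounds the nondecreasing energies, so the projections are Cauchy. Their [L^2] limit has
    the Hartley coefficients of [f], and completeness identifies it with [f] almost everywhere. *)
Lemma cvg_fproj f : sqint f ->
  ip (fun t => f t - fproj (zbox p N) f t) (fun t => f t - fproj (zbox p N) f t)
    @[N --> \oo] --> (0 : R).
Proof.
move=> sf; have sS N : sqint (fproj (zbox p N) f) by exact: sqint_cas_sum.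
have cE : cvgn (energy f).
  apply: nondecreasing_is_cvgn; first exact: energy_nd.
  by exists (ip f f) => _ [N _ <-]; exact: (bessel sf (zbox_uniq _ _)).
have [g sg gS] : exists2 g, sqint g &
    ip (fun t => fproj (zbox p N) f t - g t) (fun t => fproj (zbox p N) f t - g t)
      @[N --> \oo] --> (0 : R).
  apply: (L2_complete mD sS) => e e0.
  have [N _ HN] : \forall N \near \oo, `|limn (energy f) - energy f N| <= e.
    by move/cvgrPdist_le : cE; exact.
  exists N => i j.
  wlog ij : i j / (j <= i)%N => [H Ni Nj|Ni Nj].
    have [ji|/ltnW ij] := leqP j i; first exact: H.
    apply: le_trans (H j i ij Nj Ni); rewrite le_eqVlt; apply/orP; left; apply/eqP.
    by apply: eq_Rintegral => t _; ring.
  rewrite fproj_diff//.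
  have := HN _ Nj; have := nondecreasing_cvgn_le (energy_nd f) cE i.
  by rewrite ler_norml => h1 /andP[h2 h3]; lra.
have sh := sqintB mD sf sg.
have orth m : ip (fun t => f t - g t) (cas m) = 0.
  rewrite (ipBl mD sf sg (sc m)); apply/eqP; rewrite subr_eq0 eq_sym; apply/eqP.
  pose N0 := (\max_a `|m 0%R a|)%N.
  have mN N : (N0 <= N)%N -> ip (fproj (zbox p N) f) (cas m) = ip f (cas m).
    move=> N0N; rewrite ip_cas_sum ?zbox_uniq// mem_zbox ifT.
      by field; rewrite gt_eqF.
    apply/forallP => a; apply: leq_trans N0N.
    exact: (@leq_bigmax _ (fun a => `|m 0%R a|%N) a).
  (* For [N >= N0] this is the squared coefficient of [fproj (zbox p N) f - g], which Cauchy-Schwarz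
     bounds by a quantity tending to zero. *)
  have H : (ip f (cas m) - ip g (cas m)) ^+ 2 <= 0.
    have : (fun N => ip (fun t => fproj (zbox p N) f t - g t)
       (fun t => fproj (zbox p N) f t - g t) * ip (cas m) (cas m)) @ \oo --> (0 : R).
      by rewrite -[X in _ --> X](mul0r (ip (cas m) (cas m))); exact: cvgMr_tmp.
    move=> L; rewrite -(cvg_lim _ L)//; apply: limr_ge; first exact: cvgP L.
    near=> N; rewrite -(mN N); last by near: N; exact: nbhs_infty_ge.
    by rewrite -(ipBl mD (sS N) sg (sc m)); exact: (ip_CS mD (sqintB mD (sS N) sg) (sc m)).
  have : (ip f (cas m) - ip g (cas m)) ^+ 2 == 0 by rewrite eq_le H sqr_ge0.
  by rewrite sqrf_eq0 subr_eq0 eq_sym => /eqP.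
have fg := cas_complete T0 sh orth.
rewrite [X in X @ _](_ : _ = fun N =>
  ip (fun t => fproj (zbox p N) f t - g t) (fun t => fproj (zbox p N) f t - g t))//.
apply/funext => N; congr fine.
have s1 := sqintB mD sf (sS N); have s2 := sqintB mD (sS N) sg.
apply: ae_eq_integral; [exact: mD|exact: measurable_int s1.2
  |exact: measurable_int s2.2|].
apply: filterS fg => t /[apply] /eqP; rewrite subr_eq0 => /eqP <-.
by congr EFin; ring.
Unshelve. all: by end_near. Qed.

Lemma cvg_energy f : sqint f -> energy f @ \oo --> ip f f.
Proof.
move=> sf; have := cvg_fproj sf.
rewrite (_ : (fun N => _) = fun N => ip f f - energy f N); last first.
  by apply/funext => N; rewrite (fproj_residual sf (zbox_uniq _ _)).
move=> H; rewrite -[X in _ --> X](subr0 (ip f f)).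
rewrite (_ : energy f = fun N => ip f f - (ip f f - energy f N)); last first.
  by apply/funext => N; rewrite subKr.
by apply: cvgB => //; exact: cvg_cst.
Qed.

Lemma parseval_eq0 f : sqint f -> (forall m, ip f (cas m) = 0) -> ip f f = 0.
Proof.
move=> sf f0; have := cvg_energy sf; rewrite (_ : energy f = fun=> 0).
  by move=> H; apply: (cvg_unique _ H (cvg_cst _)); exact: Rhausdorff.
by apply/funext => N; rewrite /energy [X in _ * X]big1 ?mulr0// => m _; rewrite f0 expr0n.
Qed.

Definition gap_constant := \sum_a T 0 a ^+ 2.

(** Some coordinate has [|m 0 a| >= N + 1], and [T 0 a * freq T m a] is [2 pi] times [m 0 a]; of the
    factor [2 pi] only its being at least [1] is kept. *)
Lemma freq_gap N m : m \notin zbox p N ->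
  N.+1%:R ^+ 2 <= gap_constant * \sum_a freq T m a ^+ 2.
Proof.
rewrite mem_zbox negb_forall => /existsP[a]; rewrite -ltnNge => Na.
apply: (@le_trans _ _ (T 0 a ^+ 2 * freq T m a ^+ 2)); last first.
  apply: ler_pM; rewrite ?sqr_ge0// /gap_constant (bigD1 a)//= lerDl sumr_ge0// => b _;
  exact: sqr_ge0.
rewrite -exprMn /freq /base_freq.
have -> : T 0 a * ((m 0 a)%:~R * (2 * pi / T 0 a)) = (m 0 a)%:~R * (2 * pi).
  by move: (pi : R) => c; field; rewrite gt_eqF.
rewrite -[leRHS]real_normK ?num_real// normrM.
rewrite lerXn2r ?nnegrE ?mulr_ge0//.
apply: (@le_trans _ _ (`|(m 0 a)%:~R| * 1)).
  rewrite mulr1 -intr_norm -(ler_nat R) in Na *.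
  by apply: le_trans Na _; rewrite -abszE.
rewrite ler_wpM2l// ger0_norm; have := pi_ge2 R; last by move: (pi : R) => c; lra.
by move: (pi : R) => c; lra.
Qed.

(** By Parseval the left side sums the squared coefficients of [f] outside [zbox p N]. There
    [freq_gap] bounds each of them by the coefficients of the [v a] at [- m], and Bessel sums the
    latter. *)
Lemma spectral_gap N f (v : 'I_p -> lebesgue_space R p -> R) :
  sqint f -> (forall a, sqint (v a)) ->
  (forall a m, ip (v a) (cas m) = - (freq T m a * ip f (cas (- m)))) ->
  ip (fun t => f t - fproj (zbox p N) f t) (fun t => f t - fproj (zbox p N) f t) <=
  gap_constant / N.+1%:R ^+ 2 * \sum_a ip (v a) (v a).
Proof.
move=> sf sv fv; rewrite (fproj_residual sf (zbox_uniq _ _)) -/(energy f N).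
have N0 : 0 < N.+1%:R ^+ 2 :> R by rewrite exprn_gt0.
have K0 : 0 <= gap_constant by apply: sumr_ge0 => a _; exact: sqr_ge0.
rewrite lerBlDr -(cvg_lim (@Rhausdorff R) (cvg_energy sf)).
apply: limr_le; first exact: cvgP (cvg_energy sf).
near=> K; have NK : (N <= K)%N by near: K; exact: nbhs_infty_ge.
rewrite -lerBlDr /energy (zbox_split _ NK) mulrDr addrAC subrr add0r.
set r := [seq m <- zbox p K | m \notin zbox p N].
have ur : uniq r by rewrite filter_uniq ?zbox_uniq.
(* Differentiation exchanges [m] and [- m], so Bessel for [v a] is used on the reflected
   frequencies. *)
apply: (@le_trans _ _ (gap_constant / N.+1%:R ^+ 2 *
    \sum_a V^-1 * \sum_(m <- [seq - m | m <- r]) ip (v a) (cas m) ^+ 2)); last first.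
  apply: ler_wpM2l; first by rewrite divr_ge0// ltW.
  by apply: ler_sum => a _; apply: (bessel (sv a)); rewrite map_inj_uniq//; exact: oppr_inj.
rewrite -mulr_sumr mulrCA ler_wpM2l ?invr_ge0 ?(ltW V0)//.
rewrite exchange_big /= big_map mulr_sumr big_seq [leRHS]big_seq.
apply: ler_sum => m; rewrite mem_filter => /andP[mN _].
under eq_bigr do rewrite fv opprK freqN mulNr opprK exprMn.
rewrite -mulr_suml mulrA ler_peMl ?sqr_ge0// mulrAC ler_pdivlMr// mul1r.
exact: freq_gap.
Unshelve. all: by end_near. Qed.

End parseval.

(** * Compactness along an ultrafilter *)

Lemma fmap_ultra (S X : Type) (U : set_system S) (x : S -> X) :
  UltraFilter U -> UltraFilter (x @ U).
Proof.
move=> UU; split; first exact: fmap_proper_filter.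
move=> G GG UG; apply/seteqP; split=> [B GB|]; last exact: UG.
have [//|nB] := in_ultra_setVsetC (x @^-1` B) UU.
have /UG GnB : (x @ U) (~` B) by [].
by have [? []] := filter_ex (filterI GB GnB).
Qed.

Lemma ultra_bounded_cvg (R : realType) (U : set_system nat) (x : nat -> R) (M : R) :
  UltraFilter U -> (forall j, `|x j| <= M) -> exists l : R, x @ U --> l.
Proof.
move=> UU xM; have xU := fmap_ultra x UU.
have := @segment_compact R (- M) M; rewrite compact_ultra => /(_ (x @ U) xU).
have xA : (x @ U) [set` `[- M, M]].
  by apply: (@filterE _ U) => j; rewrite /= in_itv/= -ler_norml xM.
by move=> /(_ xA)[l [_ xl]]; exists l.
Qed.

Section rellich.
Context (R : realType) (p : nat) (T : 'rV[R]_p).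
Hypothesis T0 : forall i, 0 < T 0 i.
Local Notation D := (box T : set (lebesgue_space R p)).
Local Notation mu := (@lebesgue R p).
Local Notation cas := (cas T).
Local Notation V := (\prod_a T 0 a).
Local Notation sqint := (sqint mu D).
Local Notation ip := (ip mu D).

Let mD := measurable_box T.

(** The weak derivative relation tested on Hartley functions only: it expresses the coefficients of
    [v] through those of [f] and passes to differences. *)
Definition weakly_derives (f : lebesgue_space R p -> R)
    (v : 'I_p -> lebesgue_space R p -> R) :=
  forall a m, ip (v a) (cas m) = - (freq T m a * ip f (cas (- m))).

Lemma ip_sub_le f g : sqint f -> sqint g ->
  ip (fun t => f t - g t) (fun t => f t - g t) <= 2 * ip f f + 2 * ip g g.
Proof.
move=> sf sg; have := ip_ge0 mu D (fun t => f t + 1 * g t).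
by rewrite (ip_addZ mD 1 sf sg) (ip_subE mD sf sg) => h; lra.
Qed.

(** The tails beyond [zbox p N] are small uniformly in [j], by the spectral gap, and the finitely
    many remaining coefficients converge along [U]. [A] consists of the indices whose coefficients
    are close to these limits. *)
Lemma rellich (U : set_system nat) (u : nat -> lebesgue_space R p -> R)
    (v : nat -> 'I_p -> lebesgue_space R p -> R) (M : R) : UltraFilter U ->
  (forall j, sqint (u j)) -> (forall j a, sqint (v j a)) ->
  (forall j, weakly_derives (u j) (v j)) ->
  (forall j, ip (u j) (u j) <= M) ->
  (forall j, \sum_a ip (v j a) (v j a) <= M) ->
  forall e, 0 < e -> exists2 A, U A & forall i j, A i -> A j ->
    ip (fun t => u i t - u j t) (fun t => u i t - u j t) <= e.
Proof.
move=> UU su sv uv uM vM e e0.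
have V0 := volume_gt0 T0.
have M0 : 0 <= M := le_trans (ip_ge0 mu D (u 0%N)) (uM 0%N).
pose c m j := ip (u j) (cas m).
have /choice[l cl] : forall m, exists l : R, c m @ U --> l.
  (* Cauchy-Schwarz gives [c ^+ 2 <= M * V], and [|c| <= c ^+ 2 + 1] avoids a square root. *)
  move=> m; apply: (ultra_bounded_cvg (M := M * V + 1)) => j.
  have := ip_CS mD (su j) (sqint_cas T0 m).
  rewrite (ip_cas T0) eqxx -/(c m j) -[_ ^+ 2]real_normK ?num_real// => h.
  have h2 : `|c m j| ^+ 2 <= M * V by apply: le_trans h _; rewrite ler_pM2r.
  by have := sqr_ge0 (`|c m j| - 1); have := normr_ge0 (c m j); nra.
(* [4 * M] bounds the squared gradient of a difference. An [N] beyond [K] is enough since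
   [(N + 1)^2 >= N + 1]. *)
have [N HN] : exists N, gap_constant T / N.+1%:R ^+ 2 * (4 * M) <= e / 2.
  pose K := gap_constant T * (4 * M) / (e / 2).
  exists (Num.bound K); set N := Num.bound K.
  have N0 : 0 < N.+1%:R :> R by [].
  have G0 : 0 <= gap_constant T by apply: sumr_ge0 => a _; exact: sqr_ge0.
  have K0 : 0 <= K by rewrite /K !mulr_ge0// invr_ge0 ltW// divr_gt0.
  have KN : K < N%:R by rewrite archi_boundP.
  rewrite mulrAC ler_pdivrMr ?exprn_gt0// [leRHS]mulrC -ler_pdivrMr ?divr_gt0// -/K.
  rewrite (le_trans (ltW KN))// (@le_trans _ _ N.+1%:R) ?ler_nat//.
  by rewrite expr2 ler_peMr ?ler1n// ltW.
pose r := zbox p N; pose rest j := V^-1 * \sum_(m <- r) (c m j - l m) ^+ 2.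
have rest0 : rest @ U --> (0 : R).
  have -> : (0 : R) = V^-1 * \sum_(m <- r) (l m - l m) * (l m - l m).
    by rewrite [X in _ * X]big1 ?mulr0// => m _; rewrite subrr mulr0.
  apply: cvgMl_tmp; apply: (@cvg_big _ _ _ _ _ (@add_continuous _) _ U) => m _.
  by apply: cvgM; apply: cvgB; [exact: cl|exact: cvg_cst|exact: cl|exact: cvg_cst].
(* The low frequencies of a difference cost at most [2 * rest i + 2 * rest j], hence [e / 2]; the
   tail takes the other half. *)
exists [set j | rest j <= e / 8].
  have e8 : 0 < e / 8 by rewrite divr_gt0.
  move/cvgrPdist_le : rest0 => /(_ _ e8); apply: filterS => j /=.
  by rewrite sub0r normrN => /(le_trans (ler_norm _)).
move=> i j /= Ai Aj.
pose w t := u i t - u j t; have sw : sqint w := sqintB mD (su i) (su j).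
have svw a := sqintB mD (sv i a) (sv j a).
have ww : weakly_derives w (fun a t => v i a t - v j a t).
  move=> a m; rewrite (ipBl mD (sv i a) (sv j a) (sqint_cas T0 m)).
  by rewrite (ipBl mD (su i) (su j) (sqint_cas T0 (- m))) !uv; ring.
have := spectral_gap T0 N sw svw ww.
rewrite (fproj_residual T0 sw (zbox_uniq p N)) lerBlDr => /le_trans; apply.
have h1 : gap_constant T / N.+1%:R ^+ 2 *
   (\sum_a ip (fun t => v i a t - v j a t) (fun t => v i a t - v j a t)) <= e / 2.
  apply: le_trans HN; apply: ler_wpM2l.
    by apply: divr_ge0; [apply: sumr_ge0 => a _; exact: sqr_ge0|exact: exprn_ge0].
  apply: (@le_trans _ _ (\sum_a (2 * ip (v i a) (v i a) + 2 * ip (v j a) (v j a)))).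
    by apply: ler_sum => a _; exact: ip_sub_le.
  by rewrite big_split/= -!mulr_sumr; have := vM i; have := vM j; lra.
have h2 : V^-1 * \sum_(m <- zbox p N) ip w (cas m) ^+ 2 <= 2 * rest i + 2 * rest j.
  rewrite /rest !mulrA ![2 * _]mulrC -!mulrA -mulrDr ler_wpM2l ?invr_ge0 ?(ltW V0)//.
  rewrite !mulr_sumr -big_split/=; apply: ler_sum => m _.
  rewrite (ipBl mD (su i) (su j) (sqint_cas T0 m)) -/(c m i) -/(c m j).
  by have := sqr_ge0 ((c m i - l m) + (c m j - l m)); nra.
apply: le_trans (lerD h1 h2) _.
by move: (rest i) (rest j) Ai Aj => *; lra.
Qed.

End rellich.

(** * Finite sums and square integrable matrix fields *)

Section integrable_sums.
Context d (X : measurableType d) (R : realType).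
Variables (mu : {measure set X -> \bar R}) (D : set X) (mD : measurable D).

Lemma int_sum I (s : seq I) (F : I -> X -> R) :
  (forall i, mu.-integrable D (EFin \o F i)) ->
  mu.-integrable D (EFin \o (fun t => \sum_(i <- s) F i t)).
Proof.
move=> IF; elim: s => [|i s IH].
  apply: (@eq_int _ _ _ _ _ mD (fun=> 0)); first by move=> t _; rewrite big_nil.
  exact: integrable0.
by apply: (eq_int mD _ (intD mD (IF i) IH)) => t _; rewrite big_cons.
Qed.

Lemma Rintegral_sum I (s : seq I) (F : I -> X -> R) :
  (forall i, mu.-integrable D (EFin \o F i)) ->
  \int[mu]_(t in D) (\sum_(i <- s) F i t) = \sum_(i <- s) \int[mu]_(t in D) F i t.
Proof.
move=> IF; elim: s => [|i s IH].
  rewrite big_nil (@eq_Rintegral _ _ _ mu D (fun=> 0)).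
    by rewrite /Rintegral integral0.
  by move=> t _; rewrite big_nil.
rewrite big_cons -IH -(RintegralD mD (IF i) (int_sum s IF)).
by apply: eq_Rintegral => t _; rewrite big_cons.
Qed.

End integrable_sums.

Section vector_L2.
Context (R : realType) (p : nat) (T : 'rV[R]_p).
Hypothesis T0 : forall i, 0 < T 0 i.
Local Notation X := (lebesgue_space R p).
Local Notation D := (box T : set X).
Local Notation mu := (@lebesgue R p).
Local Notation sqint := (sqint mu D).
Local Notation ip := (ip mu D).
Let mD := measurable_box T.

Section fixed_format.
Variables (m k : nat).
Implicit Types f g : 'rV[R]_p -> 'M[R]_(m, k).

Definition vip f g : R :=
  \sum_i \sum_j ip (fun t : X => f t i j) (fun t : X => g t i j).

Lemma L2P f : L2 T f <-> forall i j, sqint (fun t : X => f t i j).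
Proof.
split=> [[mf foo] i j|sf].
  have mij : measurable_fun D (fun t : X => f t i j) := mf i j.
  apply: (sqintP mij); apply: le_lt_trans foo.
  apply: ge0_le_integral; first exact: mD.
  - by move=> t _; rewrite lee_fin -expr2 sqr_ge0.
  - by apply/measurable_EFinP; exact: measurable_funM.
  - apply/measurable_EFinP; apply: measurable_sum => i'; apply: measurable_sum => j'.
    exact: measurable_funM.
  - move=> t _; rewrite lee_fin /mxdot (bigD1 i)//= (bigD1 j)//= -addrA lerDl.
    apply: addr_ge0; first by apply: sumr_ge0 => j' _; rewrite -expr2 sqr_ge0.
    by apply: sumr_ge0 => i' _; apply: sumr_ge0 => j' _; rewrite -expr2 sqr_ge0.
split=> [i j|]; first by case: (sf i j).
have I : mu.-integrable D (EFin \o (fun t => mxdot (f t) (f t))).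
  by apply: (int_sum mD) => i; apply: (int_sum mD) => j; case: (sf i j).
by have H := integrable_lty mD I; exact: H.
Qed.

#[local] Opaque L2.

Lemma integrable_mxdot f g : L2 T f -> L2 T g ->
  mu.-integrable D (EFin \o (fun t => mxdot (f t) (g t))).
Proof.
move=> /L2P sf /L2P sg.
apply: (int_sum mD) => i; apply: (int_sum mD) => j.
exact: (sqintM mD (sf i j) (sg i j)).
Qed.

Lemma Rintegral_mxdot f g : L2 T f -> L2 T g ->
  \int[mu]_(t in D) mxdot (f t) (g t) = vip f g.
Proof.
move=> /L2P sf /L2P sg; rewrite (Rintegral_sum mD) => [|i]; last first.
  by apply: (int_sum mD) => j; exact: (sqintM mD (sf i j) (sg i j)).
apply: eq_bigr => i _; rewrite (Rintegral_sum mD)// => j.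
exact: (sqintM mD (sf i j) (sg i j)).
Qed.

Lemma L2_addZ c f g : L2 T f -> L2 T g -> L2 T (fun t => f t + c *: g t).
Proof.
move=> /L2P sf /L2P sg; apply/L2P => i j.
apply: (eq_sqint mD _ (sqintD mD (sf i j) (sqintZ mD c (sg i j)))) => t _.
by rewrite !mxE.
Qed.

Lemma vip_ge0 f : (0 : R) <= vip f f.
Proof. by apply: sumr_ge0 => i _; apply: sumr_ge0 => j _; exact: ip_ge0. Qed.

Lemma vipC f g : vip f g = vip g f.
Proof. by apply: eq_bigr => i _; apply: eq_bigr => j _; rewrite ipC. Qed.

Lemma vip_addZl c f g h : L2 T f -> L2 T g -> L2 T h ->
  vip (fun t => f t + c *: g t) h = vip f h + c * vip g h.
Proof.
move=> /L2P sf /L2P sg /L2P sh; rewrite /vip mulr_sumr -big_split.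
apply: eq_bigr => i _; rewrite mulr_sumr -big_split; apply: eq_bigr => j _ /=.
rewrite -(ipZl mD c (sg i j) (sh i j)).
rewrite -(ipDl mD (sf i j) (sqintZ mD c (sg i j)) (sh i j)).
by apply: eq_ip => t _; rewrite ?mxE.
Qed.

Lemma vip_addZ c f g : L2 T f -> L2 T g ->
  vip (fun t => f t + c *: g t) (fun t => f t + c *: g t) =
  vip f f + 2 * c * vip f g + c ^+ 2 * vip g g.
Proof.
move=> sf sg; have sfg := L2_addZ c sf sg.
rewrite (vip_addZl c sf sg sfg) [vip f _]vipC [vip g _]vipC.
by rewrite (vip_addZl c sf sg sf) (vip_addZl c sf sg sg) (vipC g f); ring.
Qed.

Lemma vip_CS f g : L2 T f -> L2 T g -> vip f g ^+ 2 <= vip f f * vip g g.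
Proof.
move=> sf sg; apply: discriminant_le0; try exact: vip_ge0.
by move=> s; rewrite -(vip_addZ s sf sg); exact: vip_ge0.
Qed.

Lemma vip_subE f g : L2 T f -> L2 T g ->
  vip (fun t => f t - g t) (fun t => f t - g t) = vip f f - 2 * vip f g + vip g g.
Proof.
move=> sf sg; transitivity
  (vip (fun t => f t + (-1) *: g t) (fun t => f t + (-1) *: g t)).
  by congr vip; apply/funext => t; rewrite scaleN1r.
by rewrite (vip_addZ (-1) sf sg); ring.
Qed.

Lemma L2_sub f g : L2 T f -> L2 T g -> L2 T (fun t => f t - g t).
Proof.
move=> sf sg; have := L2_addZ (-1) sf sg.
by congr L2; apply/funext => t; rewrite scaleN1r.
Qed.

Lemma vip_subl f g h : L2 T f -> L2 T g -> L2 T h ->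
  vip (fun t => f t - g t) h = vip f h - vip g h.
Proof.
move=> sf sg sh; rewrite -mulN1r -(vip_addZl _ sf sg sh).
by congr (vip _ h); apply/funext => t; rewrite scaleN1r.
Qed.

(** Cauchy-Schwarz bounds the squared error by the squared distance times [vip g g]; the [1] added
    to the denominator covers [g] of norm zero. *)
Lemma cvg_vipl (f_ : nat -> 'rV[R]_p -> 'M[R]_(m, k)) f g :
  (forall j, L2 T (f_ j)) -> L2 T f -> L2 T g ->
  vip (fun t => f_ j t - f t) (fun t => f_ j t - f t) @[j --> \oo] --> (0 : R) ->
  vip (f_ j) g @[j --> \oo] --> vip f g.
Proof.
move=> sf_ sf sg f0; apply/cvgrPdist_le => e e0.
have G0 := vip_ge0 g; have G1 : 0 < vip g g + 1 by apply: ltr_wpDl.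
have d0 : 0 < e ^+ 2 / (vip g g + 1) by rewrite divr_gt0// exprn_gt0.
move/cvgrPdist_le : f0 => /(_ _ d0); apply: filterS => j.
rewrite sub0r normrN ger0_norm ?vip_ge0// => h.
rewrite distrC -(vip_subl (sf_ j) sf sg).
have H := vip_CS (L2_sub (sf_ j) sf) sg.
rewrite -(@ler_pXn2r _ 2) ?nnegrE ?(ltW e0)// real_normK ?num_real//.
apply: (le_trans H); move: h; rewrite ler_pdivlMr//.
by have := vip_ge0 (fun t => f_ j t - f t); nra.
Qed.

Lemma cvg_vip (f_ : nat -> 'rV[R]_p -> 'M[R]_(m, k)) f :
  (forall j, L2 T (f_ j)) -> L2 T f ->
  vip (fun t => f_ j t - f t) (fun t => f_ j t - f t) @[j --> \oo] --> (0 : R) ->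
  vip (f_ j) (f_ j) @[j --> \oo] --> vip f f.
Proof.
move=> sf_ sf f0; have H := cvg_vipl sf_ sf sf f0.
rewrite (_ : (fun j => _) = (fun j => vip (fun t => f_ j t - f t) (fun t => f_ j t - f t)
   + 2 * vip (f_ j) f - vip f f)); last first.
  by apply/funext => j; rewrite (vip_subE (sf_ j) sf); ring.
rewrite [X in _ --> X](_ : _ = 0 + 2 * vip f f - vip f f); last by ring.
exact: (cvgB (cvgD f0 (cvgMl_tmp H)) (cvg_cst _)).
Qed.

Lemma vector_L2_complete (f_ : nat -> 'rV[R]_p -> 'M[R]_(m, k)) :
  (forall j, L2 T (f_ j)) ->
  (forall e : R, 0 < e -> exists N, forall i j, (N <= i)%N -> (N <= j)%N ->
     vip (fun t => f_ i t - f_ j t) (fun t => f_ i t - f_ j t) <= e) ->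
  exists2 f, L2 T f &
    vip (fun t => f_ j t - f t) (fun t => f_ j t - f t) @[j --> \oo] --> (0 : R).
Proof.
move=> sf_ cf.
have H (ij : 'I_m * 'I_k) : exists g : X -> R, sqint g /\
    ip (fun t : X => f_ l t ij.1 ij.2 - g t) (fun t : X => f_ l t ij.1 ij.2 - g t)
      @[l --> \oo] --> (0 : R).
  have [||g sg gf] := @L2_complete _ _ _ mu D mD (fun l (t : X) => f_ l t ij.1 ij.2).
  - by move=> l; have /L2P := sf_ l; exact.
  - move=> e /cf[N HN]; exists N => i j Ni Nj; apply: le_trans (HN i j Ni Nj).
    rewrite /vip (bigD1 ij.1)//= (bigD1 ij.2)//= -addrA.
    rewrite [leLHS](_ : _ = ip (fun t : X => (f_ i t - f_ j t) ij.1 ij.2)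
      (fun t : X => (f_ i t - f_ j t) ij.1 ij.2)); last first.
      by apply: eq_ip => t _; rewrite !mxE.
    rewrite lerDl addr_ge0//; first by apply: sumr_ge0 => j' _; exact: ip_ge0.
    by apply: sumr_ge0 => i' _; apply: sumr_ge0 => j' _; exact: ip_ge0.
  - by exists g.
have [g Hg] := choice H.
pose f t : 'M[R]_(m, k) := \matrix_(i, j) g (i, j) t.
exists f.
  apply/L2P => i j; have [sg _] := Hg (i, j).
  by apply: (eq_sqint mD _ sg) => t _; rewrite mxE.
have -> : (0 : R) = \sum_(i < m) \sum_(j < k) 0.
  by rewrite big1// => i _; rewrite big1.
apply: (@cvg_big _ _ _ _ _ (@add_continuous _) _ \oo) => i _.
apply: (@cvg_big _ _ _ _ _ (@add_continuous _) _ \oo) => j _.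
have [_ gf] := Hg (i, j).
rewrite (_ : (fun l => _) = (fun l => ip (fun t : X => f_ l t i j - g (i, j) t)
   (fun t : X => f_ l t i j - g (i, j) t)))//.
by apply/funext => l; apply: eq_ip => t _; rewrite !mxE.
Qed.

End fixed_format.
End vector_L2.

(** * Weak gradients *)

Section weak_gradients.
Context (R : realType) (p n : nat) (T : 'rV[R]_p).
Hypothesis T0 : forall i, 0 < T 0 i.
Local Notation X := (lebesgue_space R p).
Local Notation D := (box T : set X).
Local Notation mu := (@lebesgue R p).
Local Notation sqint := (sqint mu D).
Local Notation ip := (ip mu D).
Local Notation cas := (cas T).
Implicit Types (u f : 'rV[R]_p -> 'rV[R]_n) (G : 'rV[R]_p -> 'M[R]_(n, p)).
Let mD := measurable_box T.

Lemma derivative_coord (f : 'rV[R]_p -> 'rV[R]_n) t e i : derivable f t e ->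
  derivable (fun s => f s 0 i : R^o) t e /\
  'D_e (fun s => f s 0 i : R^o) t = 'D_e f t 0 i.
Proof.
move=> df.
pose q (h : R) : 'rV[R]_n := h^-1 *: ((f \o shift t) (h *: e) - f t).
have C : (fun h => q h 0 i) @ 0^' --> ('D_e f t 0 i : R^o).
  apply: (@continuous_cvg _ _ _ _ _ q (fun M : 'rV[R]_n => M 0 i)); last exact: df.
  exact: coord_continuous.
have E : (fun h => q h 0 i) =
    (fun h : R => h^-1 *: (((fun s => f s 0 i : R^o) \o shift t) (h *: e) - f t 0 i)).
  by apply/funext => h /=; rewrite !mxE.
rewrite E in C.
by split; [apply/cvg_ex; eexists; exact: C|exact: (cvg_lim _ C)].
Qed.

Lemma continuous_coord (f : 'rV[R]_p -> 'rV[R]_n) i : continuous f ->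
  continuous (fun t => f t 0 i).
Proof.
move=> cf t; apply: (@continuous_comp _ _ _ f (fun M : 'rV[R]_n => M 0 i)).
  exact: cf.
exact: coord_continuous.
Qed.

Lemma sqint_continuous (h : 'rV[R]_p -> R) : continuous h -> sqint h.
Proof.
move=> ch; have [C C0 HC] := @box_bounded _ _ T h (continuous_subspaceT ch).
apply: (sqint_bounded mD (lebesgue_box_lty T0) _ HC).
exact/measurable_funTS/measurable_continuous.
Qed.

Section smooth_test.
Variable f : 'rV[R]_p -> 'rV[R]_n.
Hypothesis sf : smooth_periodic T f.

Lemma smooth_continuous : continuous f.
Proof. by have [H _] := sf; have [] := H 0%N. Qed.

Lemma smooth_derivable a t : derivable f t (basis_vec R a).
Proof. by have [H _] := sf; have [_ /(_ a)[H' _]] := H 1%N; exact: H'. Qed.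

Lemma smooth_continuous_partial a : continuous (partial a f).
Proof. by have [H _] := sf; have [_ /(_ a)[_ []]] := H 1%N. Qed.

Lemma smooth_coord_derivable a t i :
  derivable (fun s => f s 0 i : R^o) t (basis_vec R a).
Proof. by have [] := derivative_coord i (@smooth_derivable a t). Qed.

Lemma smooth_coord_partial a t i :
  partial a (fun s => f s 0 i : R^o) t = partial a f t 0 i.
Proof. by have [] := derivative_coord i (@smooth_derivable a t). Qed.

Lemma sqint_smooth i : sqint (fun t : X => f t 0 i).
Proof. exact/sqint_continuous/continuous_coord/smooth_continuous. Qed.

Lemma sqint_smooth_partial a i : sqint (fun t : X => partial a f t 0 i).
Proof. exact/sqint_continuous/continuous_coord/smooth_continuous_partial. Qed.

End smooth_test.

Lemma row_L2P u : L2 T u <-> forall i, sqint (fun t : X => u t 0 i).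
Proof.
split=> [/L2P H i|H]; first exact: H.
by apply/L2P => i j; rewrite ord1; exact: H.
Qed.

Lemma weak_gradientP u G : L2 T u -> is_weak_gradient T u G <->
  L2 T G /\ forall f a, smooth_periodic T f ->
    \sum_i ip (fun t : X => u t 0 i) (fun t : X => partial a f t 0 i) =
    - \sum_i ip (fun t : X => G t i a) (fun t : X => f t 0 i).
Proof.
move=> L2u; suff E : L2 T G -> forall f a, smooth_periodic T f ->
   (\int[mu]_(t in D) mxdot (u t) (partial a f t) =
      \sum_i ip (fun t : X => u t 0 i) (fun t : X => partial a f t 0 i)) /\
   (\int[mu]_(t in D) mxdot (col a (G t))^T (f t) =
      \sum_i ip (fun t : X => G t i a) (fun t : X => f t 0 i)).
  split=> -[L2G H]; split => // f a sf; have [E1 E2] := E L2G f a sf.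
    by rewrite -E1 -E2; exact: H.
  by rewrite E1 E2; exact: H.
move=> L2G f a sf.
have L2f : L2 T f by apply/row_L2P => i; exact: sqint_smooth.
have L2df : L2 T (partial a f) by apply/row_L2P => i; exact: sqint_smooth_partial.
have L2c : L2 T (fun t => (col a (G t))^T).
  apply/row_L2P => i; have /L2P sG := L2G.
  by apply: (eq_sqint mD _ (sG i a)) => t _; rewrite !mxE.
split; first by rewrite (Rintegral_mxdot L2u L2df) /vip big_ord1.
rewrite (Rintegral_mxdot L2c L2f) /vip big_ord1; apply: eq_bigr => i _.
by apply: eq_ip => t _; rewrite ?mxE.
Qed.

(** The gradient is carried as data: sums and strong limits of pairs are pairs, whereas the gradient
    selected by [weak_gradient] commutes with these operations only almost everywhere. *)
Definition sobolev_pair u G := L2 T u /\ is_weak_gradient T u G.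

Lemma sobolev_pair_L2 u G : sobolev_pair u G -> L2 T u /\ L2 T G.
Proof. by case=> ? []. Qed.

(** The test function [casv T m i 1] isolates component [i], all its other components being zero. *)
Lemma sobolev_pair_weakly_derives u G i : sobolev_pair u G ->
  weakly_derives T (fun t : X => u t 0 i) (fun a t => G t i a).
Proof.
move=> [L2u wG] a m; have [L2G H] := (weak_gradientP G L2u).1 wG.
have := H (casv T m i 1) a (smooth_casv T0 m i 1).
rewrite (bigD1 i)//= big1 ?addr0 => [|j ji]; last first.
  rewrite /ip (@eq_Rintegral _ _ _ mu D (fun=> 0)); last first.
    by move=> t _; rewrite partial_casv// casvE (negbTE ji) mulr0.
  by rewrite /Rintegral integral0.
rewrite [X in _ = - X](bigD1 i)//= [X in _ = - (_ + X)]big1 ?addr0 => [|j ji]; last first.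
  rewrite /ip (@eq_Rintegral _ _ _ mu D (fun=> 0)); last first.
    by move=> t _; rewrite casvE (negbTE ji) mulr0.
  by rewrite /Rintegral integral0.
have -> : ip (fun t : X => G t i a) (fun t : X => casv T m i 1 t 0 i) =
    ip (fun t : X => G t i a) (cas m).
  by apply: eq_ip => t _ //; rewrite casvE eqxx mul1r.
have su : sqint (fun t : X => u t 0 i) by move/row_L2P : L2u; exact.
have sc := sqint_cas T0 (- m).
have -> : ip (fun t : X => u t 0 i) (fun t : X => partial a (casv T m i 1) t 0 i) =
    freq T m a * ip (fun t : X => u t 0 i) (cas (- m)).
  rewrite [RHS]mulrC ipC [in RHS]ipC mulrC -(ipZl mD (freq T m a) sc su).
  by apply: eq_ip => t _ //; rewrite partial_casv// casvE eqxx mul1r.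
by move=> ->; rewrite opprK.
Qed.

(** The Hartley coefficients of a weak gradient are determined by those of [u], so Parseval makes
    the difference of two of them vanish in norm. *)
Lemma sobolev_pair_unique u G G' i a : sobolev_pair u G -> sobolev_pair u G' ->
  ip (fun t : X => G t i a - G' t i a) (fun t : X => G t i a - G' t i a) = 0.
Proof.
move=> uG uG'; have [_ /L2P sG] := sobolev_pair_L2 uG.
have [_ /L2P sG'] := sobolev_pair_L2 uG'.
apply: (parseval_eq0 T0 (sqintB mD (sG i a) (sG' i a))) => m.
rewrite (ipBl mD (sG i a) (sG' i a) (sqint_cas T0 m)).
have -> := sobolev_pair_weakly_derives i uG a m.
have -> := sobolev_pair_weakly_derives i uG' a m.
by rewrite subrr.
Qed.

Lemma sobolev_pair_vip u G G' H : sobolev_pair u G -> sobolev_pair u G' ->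
  L2 T H -> vip T G H = vip T G' H.
Proof.
move=> uG uG' L2H; have [_ sG] := sobolev_pair_L2 uG; have [_ sG'] := sobolev_pair_L2 uG'.
apply/eqP; rewrite -subr_eq0 -(vip_subl sG sG' L2H) -sqrf_eq0 eq_le sqr_ge0 andbT.
apply: (le_trans (vip_CS (L2_sub sG sG') L2H)).
rewrite (_ : vip T _ _ = 0) ?mul0r//.
rewrite /vip big1// => i _; rewrite big1// => a _.
rewrite -[RHS](sobolev_pair_unique i a uG uG').
by apply: eq_ip => t _; rewrite !mxE.
Qed.

Lemma sobolev_pair_addZ c u G v H : sobolev_pair u G -> sobolev_pair v H ->
  sobolev_pair (fun t => u t + c *: v t) (fun t => G t + c *: H t).
Proof.
move=> [L2u wG] [L2v wH]; have L2uv := L2_addZ c L2u L2v; split; first exact: L2uv.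
have [L2G gG] := (weak_gradientP G L2u).1 wG.
have [L2H gH] := (weak_gradientP H L2v).1 wH.
apply/(weak_gradientP _ L2uv); split; first exact: (L2_addZ c L2G L2H).
move=> f a sf.
have /row_L2P su := L2u; have /row_L2P sv := L2v.
have /L2P sG := L2G; have /L2P sH := L2H.
have E1 i : ip (fun t : X => (u t + c *: v t) 0 i) (fun t : X => partial a f t 0 i) =
   ip (fun t : X => u t 0 i) (fun t : X => partial a f t 0 i) +
   c * ip (fun t : X => v t 0 i) (fun t : X => partial a f t 0 i).
  have s := sqint_smooth_partial sf a i.
  rewrite -(ipZl mD c (sv i) s) -(ipDl mD (su i) (sqintZ mD c (sv i)) s).
  by apply: eq_ip => t _; rewrite ?mxE.
have E2 i : ip (fun t : X => (G t + c *: H t) i a) (fun t : X => f t 0 i) =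
   ip (fun t : X => G t i a) (fun t : X => f t 0 i) +
   c * ip (fun t : X => H t i a) (fun t : X => f t 0 i).
  have s := sqint_smooth sf i.
  rewrite -(ipZl mD c (sH i a) s) -(ipDl mD (sG i a) (sqintZ mD c (sH i a)) s).
  by apply: eq_ip => t _; rewrite ?mxE.
rewrite (eq_bigr _ (fun i _ => E1 i)) [in RHS](eq_bigr _ (fun i _ => E2 i)).
rewrite !big_split/= -!mulr_sumr gG// gH//.
by ring.
Qed.

(** The product rule and the vanishing integral of the partial derivative of the periodic product
    [v_i f_i]. It makes smooth periodic functions admissible variations. *)
Lemma smooth_sobolev_pair v : smooth_periodic T v ->
  sobolev_pair v (fun t => \matrix_(i, a) partial a v t 0 i).
Proof.
move=> sv; have L2v : L2 T v by apply/row_L2P => i; exact: sqint_smooth.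
split; first exact: L2v.
apply/(weak_gradientP _ L2v); split.
  apply/L2P => i a; apply: (eq_sqint mD _ (sqint_smooth_partial sv a i)) => t _.
  by rewrite mxE.
move=> f a sf; rewrite -sumrN; apply: eq_bigr => i _; apply/eqP.
rewrite -subr_eq0 opprK; apply/eqP.
have sdv := sqint_smooth_partial sv a i; have sdf := sqint_smooth_partial sf a i.
have svi := sqint_smooth sv i; have sfi := sqint_smooth sf i.
have -> : ip (fun t : X => (\matrix_(i, a) partial a v t 0 i) i a) (fun t : X => f t 0 i) =
   ip (fun t : X => partial a v t 0 i) (fun t : X => f t 0 i).
  by apply: eq_ip => t _; rewrite ?mxE.
rewrite /ip -(RintegralD mD (sqintM mD svi sdf) (sqintM mD sdv sfi)).
pose h t : R^o := v t 0 i * f t 0 i.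
have dh t : derivable h t (basis_vec R a) /\
   'D_(basis_vec R a) h t = v t 0 i * partial a f t 0 i + partial a v t 0 i * f t 0 i.
  have d1 := @smooth_coord_derivable _ sv a t i; have d2 := @smooth_coord_derivable _ sf a t i.
  split; first exact: (derivableM d1 d2).
  rewrite (deriveM d1 d2) -!smooth_coord_partial// /partial.
  by congr (_ + _); rewrite mulrC.
have -> : \int[mu]_(t in D) (v t 0 i * partial a f t 0 i + partial a v t 0 i * f t 0 i) =
   \int[mu]_(t in D) partial a h t.
  by apply: eq_Rintegral => t _; have [_ <-] := dh t.
have c1 : continuous (fun t => v t 0 i) by exact/continuous_coord/smooth_continuous.
have c2 : continuous (fun t => f t 0 i) by exact/continuous_coord/smooth_continuous.
have c3 : continuous (fun t => partial a v t 0 i).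
  exact/continuous_coord/smooth_continuous_partial.
have c4 : continuous (fun t => partial a f t 0 i).
  exact/continuous_coord/smooth_continuous_partial.
apply: (integral_partial_eq0 T0).
- by move=> t; exact: (cvgM (c1 t) (c2 t)).
- by move=> t; have [] := dh t.
- rewrite (_ : partial a h = fun t => v t 0 i * partial a f t 0 i + partial a v t 0 i * f t 0 i).
    by move=> t; exact: (cvgD (cvgM (c1 t) (c4 t)) (cvgM (c3 t) (c2 t))).
  by apply/funext => t; have [_ <-] := dh t.
- by move=> t; rewrite /h (sv.2 a t) (sf.2 a t).
Qed.

(** For a fixed test function both sides of the defining identity are continuous under strong [L^2]
    convergence. *)
Lemma sobolev_pair_closed (u_ : nat -> 'rV[R]_p -> 'rV[R]_n)
    (G_ : nat -> 'rV[R]_p -> 'M[R]_(n, p)) u G :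
  (forall k, sobolev_pair (u_ k) (G_ k)) -> L2 T u -> L2 T G ->
  vip T (fun t => u_ k t - u t) (fun t => u_ k t - u t) @[k --> \oo] --> (0 : R) ->
  vip T (fun t => G_ k t - G t) (fun t => G_ k t - G t) @[k --> \oo] --> (0 : R) ->
  sobolev_pair u G.
Proof.
move=> H L2u L2G u0 G0; split; first exact: L2u.
apply/(weak_gradientP _ L2u); split=> [|f a sf]; first exact: L2G.
have L2u_ k : L2 T (u_ k) by case: (H k).
have L2G_ k : L2 T (G_ k) by case: (sobolev_pair_L2 (H k)).
have L2df : L2 T (partial a f) by apply/row_L2P => i; exact: sqint_smooth_partial.
(* Placing [f] in column [a] turns the pairing with column [a] of the gradient into a product of
   full matrix fields. *)
pose f' t : 'M[R]_(n, p) := \matrix_(i, b) (if b == a then f t 0 i else 0).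
have L2f' : L2 T f'.
  apply/L2P => i b; have [->|ba] := eqVneq b a.
    by apply: (eq_sqint mD _ (sqint_smooth sf i)) => t _; rewrite mxE eqxx.
  by apply: (eq_sqint mD _ (sqint0 mu mD)) => t _; rewrite mxE (negbTE ba).
have E1 w : vip T w (partial a f) =
    \sum_i ip (fun t : X => w t 0 i) (fun t : X => partial a f t 0 i).
  by rewrite /vip big_ord1.
have E2 W : vip T W f' = \sum_i ip (fun t : X => W t i a) (fun t : X => f t 0 i).
  apply: eq_bigr => i _; rewrite (bigD1 a)//= big1 ?addr0 => [|b ba].
    by apply: eq_ip => t _ //; rewrite mxE eqxx.
  rewrite /ip (@eq_Rintegral _ _ _ mu D (fun=> 0)); last first.
    by move=> t _; rewrite mxE (negbTE ba) mulr0.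
  by rewrite /Rintegral integral0.
rewrite -E1 -E2.
have C1 := cvg_vipl L2u_ L2u L2df u0; have C2 := cvgN (cvg_vipl L2G_ L2G L2f' G0).
apply: (cvg_unique (@Rhausdorff R) C1).
rewrite (_ : (fun k => vip T (u_ k) (partial a f)) = (fun k => - vip T (G_ k) f')).
  exact: C2.
apply/funext => k; rewrite E1 E2; have [L2k wk] := H k.
by have [_ ->] := (weak_gradientP (G_ k) L2k).1 wk.
Qed.

End weak_gradients.

Lemma cvg_dnbhs0 (R : realType) (s : nat -> R) :
  s @ \oo --> (0 : R) -> (forall k, s k != 0) -> s @ \oo --> (0 : R)^'.
Proof.
move=> s0 sn A /s0 H.
have {}H : \forall k \near \oo, s k != 0 -> A (s k) := H.
suff : \forall k \near \oo, A (s k) by [].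
by apply: filterS H => k H; exact: (H (sn k)).
Qed.

(** * Increments through partial derivatives *)

Section increments.
Context (R : realType).

Lemma mean_value_line (V : normedModType R) (f : V -> R^o) (y e : V) (r : R) :
  (forall x, derivable f x e) ->
  exists2 th, `|th| <= `|r| & f (y + r *: e) - f y = r * 'D_e f (y + th *: e).
Proof.
move=> df; pose phi (s : R) : R^o := f (y + s *: e).
have dphi (s : R) : is_derive s 1 phi ('D_e f (y + s *: e)).
  by split; [exact: derivable_line|exact: derive_line].
have cphi a b : {within `[a, b], continuous phi}.
  by apply: derivable_within_continuous => s _; case: (dphi s).
have phi0 : phi 0 = f y by rewrite /phi scale0r addr0.
have [r0|r0] := leP 0 r.
  have [th] := @MVT_segment R phi _ 0 r r0 (fun s _ => dphi s) (cphi 0 r).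
  rewrite in_itv/= => /andP[th0 thr]; rewrite phi0 subr0 => E.
  by exists th; rewrite ?ger0_norm// mulrC -E.
have [th] := @MVT_segment R phi _ r 0 (ltW r0) (fun s _ => dphi s) (cphi r 0).
rewrite in_itv/= => /andP[thr th0]; rewrite phi0 sub0r => E.
exists th; first by rewrite (ler0_norm th0) (ltr0_norm r0) lerN2.
by rewrite -[LHS]opprB E mulrN opprK mulrC.
Qed.

(* Moving one coordinate at a time, each step is controlled by the mean value
   theorem, so only partial derivatives are needed. *)
Lemma increment_partials n (f : 'rV[R]_n -> R^o) (u w : 'rV[R]_n) :
  (forall i x, derivable f x (basis_vec R i)) ->
  exists xi : 'I_n -> 'rV[R]_n,
    (forall i j, `|xi i 0 j - u 0 j| <= `|w 0 j|) /\
    f (u + w) - f u = \sum_i w 0 i * partial i f (xi i).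
Proof.
move=> df; pose z (k : nat) : 'rV[R]_n := u + \row_i (if (i < k)%N then w 0 i else 0).
have zS (i : 'I_n) : z i.+1 = z i + w 0 i *: basis_vec R i.
  apply/rowP => j; rewrite !mxE /= ltnS -addrA; congr (_ + _).
  case: (ltngtP j i) => ji.
  - by rewrite -val_eqE/= ltn_eqF// mulr0 addr0.
  - by rewrite -val_eqE/= gtn_eqF// mulr0 addr0.
  - by rewrite (val_inj ji) eqxx mulr1 add0r.
have H i : exists th : R, `|th| <= `|w 0 i| /\
    f (z i.+1) - f (z i) = w 0 i * partial i f (z i + th *: basis_vec R i).
  by rewrite zS; have [th h1 h2] := mean_value_line (z i) (w 0 i) (df i); exists th.
have [th Hth] := choice H.
exists (fun i : 'I_n => z i + th i *: basis_vec R i); split=> [i j|].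
  have E (a b c : R) : a + b + c - a = b + c by ring.
  rewrite !mxE /= E; case: eqVneq => [->|ji].
    by rewrite ltnn add0r mulr1; case: (Hth i).
  by rewrite mulr0 addr0; case: ifP; rewrite ?normr0.
have <- : \sum_(i < n) (f (z i.+1) - f (z i)) = f (u + w) - f u.
  rewrite -(big_mkord xpredT (fun i => f (z i.+1) - f (z i))) telescope_sumr//.
  by congr (f _ - f _); apply/rowP => i; rewrite !mxE ?ltn_ord ?addr0.
by apply: eq_bigr => i _; case: (Hth i).
Qed.

Lemma ler_enorm n (x : 'rV[R]_n) i : `|x 0 i| <= enorm x.
Proof.
rewrite -sqrtr_sqr /enorm; apply: ler_wsqrtr.
rewrite /mxdot big_ord1 (bigD1 i)//= -expr2 lerDl.
by apply: sumr_ge0 => j _; rewrite -expr2 sqr_ge0.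
Qed.

End increments.

(** * The action functional *)

Section potential.
Context (R : realType) (p n : nat) (T : 'rV[R]_p).
Hypothesis T0 : forall i, 0 < T 0 i.
Local Notation X := (lebesgue_space R p).
Local Notation D := (box T : set X).
Local Notation mu := (@lebesgue R p).
Local Notation sqint := (sqint mu D).
Local Notation V := (\prod_a T 0 a).
Let mD := measurable_box T.
Implicit Types u v w : 'rV[R]_p -> 'rV[R]_n.

Variables (F : 'rV[R]_p -> 'rV[R]_n -> R) (B C : R).
Hypothesis F_meas : forall u : 'rV[R]_n, measurable_fun D (fun t : X => F t u).
Hypothesis F_C1 : forall t, box T t -> Cn 1 (F t : 'rV[R]_n -> R^o).
Hypothesis F_bound : forall t, box T t -> `|F t 0| <= B.
Hypothesis C_ge0 : 0 <= C.
Hypothesis dF_bound : forall t (u : 'rV[R]_n) i, box T t ->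
  `|partial i (F t : 'rV[R]_n -> R^o) u| <= C.

Lemma F_derivable t i x : box T t ->
  derivable (F t : 'rV[R]_n -> R^o) x (basis_vec R i).
Proof. by move=> Dt; have [_ /(_ i)[H _]] := F_C1 Dt; exact: H. Qed.

Lemma F_partial_continuous t i : box T t ->
  continuous (partial i (F t : 'rV[R]_n -> R^o)).
Proof. by move=> Dt; have [_ /(_ i)[_ [H _]]] := F_C1 Dt. Qed.

Lemma F_lipschitz t (u w : 'rV[R]_n) : box T t ->
  `|F t (u + w) - F t u| <= C * \sum_i `|w 0 i|.
Proof.
move=> Dt; have [xi [_ ->]] :=
  increment_partials u w (fun i x => @F_derivable t i x Dt).
rewrite (le_trans (ler_norm_sum _ _ _))// mulr_sumr; apply: ler_sum => i _.
by rewrite normrM mulrC ler_wpM2r// dF_bound.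
Qed.

Lemma measurable_F u : (forall i, measurable_fun D (fun t : X => u t 0 i)) ->
  measurable_fun D (fun t : X => F t (u t)).
Proof.
move=> mu'; have cF t : D t -> {for u t, continuous (F t)}.
  by move=> Dt; have [H _] := F_C1 Dt; exact: H.
exact: (measurable_superposition mD F_meas cF mu').
Qed.

(** A pointwise limit of difference quotients with step [1/(k+1)], each measurable by
    superposition. *)
Lemma measurable_partialF u i : (forall i, measurable_fun D (fun t : X => u t 0 i)) ->
  measurable_fun D (fun t : X => partial i (F t : 'rV[R]_n -> R^o) (u t)).
Proof.
move=> mu'; pose q k (t : X) := k.+1%:R *
  (F t (u t + k.+1%:R^-1 *: basis_vec R i) - F t (u t)).
apply: (@measurable_fun_cvg _ X R D q).
  move=> k; apply: measurable_funM; first exact: measurable_cst.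
  apply: measurable_funB; last exact: measurable_F.
  apply: measurable_F => j; rewrite (_ : (fun t => _) =
      fun t : X => u t 0 j + (k.+1%:R^-1 *: basis_vec R i) 0 j).
    exact: (measurable_funD (mu' j) (measurable_cst _)).
  by apply/funext => t; rewrite mxE.
move=> t Dt; 
have L : (fun h : R => h^-1 *: (((F t : 'rV[R]_n -> R^o) \o shift (u t))
     (h *: basis_vec R i) - (F t (u t) : R^o)))
   @ 0^' --> partial i (F t : 'rV[R]_n -> R^o) (u t) by exact: (@F_derivable t i (u t) Dt).
have S : (fun k : nat => k.+1%:R^-1 : R) @ \oo --> 0^'.
  by apply: (cvg_dnbhs0 (@cvg_harmonic R)) => k; rewrite invr_eq0 pnatr_eq0.
rewrite (_ : q ^~ t = (fun h : R => h^-1 *: (((F t : 'rV[R]_n -> R^o) \o shift (u t))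
     (h *: basis_vec R i) - (F t (u t) : R^o))) \o (fun k : nat => k.+1%:R^-1 : R)).
  exact: (cvg_comp _ _ S L).
by apply/funext => k; rewrite /q /= invrK [in RHS](addrC _ (u t)).
Qed.

Definition pot (u : 'rV[R]_p -> 'rV[R]_n) : R := \int[mu]_(t in D) F t (u t).

Lemma L2_measurable u i : L2 T u -> measurable_fun D (fun t : X => u t 0 i).
Proof. by move=> /row_L2P /(_ i)[]. Qed.

Lemma integrable_norm_coord u i : L2 T u ->
  mu.-integrable D (EFin \o (fun t : X => `|u t 0 i|)).
Proof.
move=> /row_L2P /(_ i) su.
exact: (integrable_abse (sqint_integrable mD (lebesgue_box_lty T0) su)).
Qed.

Lemma sqint_cst (c : R) : sqint (fun=> c).
Proof.
apply: (@sqint_bounded _ _ _ _ _ mD `|c| _ (lebesgue_box_lty T0)).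
  exact: measurable_cst.
by move=> t _; exact: lexx.
Qed.

Lemma integrable_cst (c : R) : mu.-integrable D (EFin \o (fun _ : X => c)).
Proof. exact: (sqint_integrable mD (lebesgue_box_lty T0) (sqint_cst c)). Qed.

Lemma integrable_F u : L2 T u -> mu.-integrable D (EFin \o (fun t : X => F t (u t))).
Proof.
move=> L2u; have mF := measurable_F (fun i => L2_measurable i L2u).
apply: (sqint_le_integrable mD mF (intD mD (integrable_cst B)
  (intZ mD C (int_sum mD (index_enum 'I_n) (fun i => integrable_norm_coord i L2u))))).
move=> t Dt; have := F_lipschitz 0 (u t) Dt; rewrite add0r => h.
have -> : F t (u t) = F t 0 + (F t (u t) - F t 0) by ring.
by rewrite (le_trans (ler_normD _ _))// lerD// F_bound.
Qed.

Lemma Rintegral_cst_box (c : R) : \int[mu]_(t in D) c = c * V.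
Proof. by rewrite (Rintegral_cst _ mD); congr (_ * _); apply/(congr1 fine (lebesgue_box T0)). Qed.

(** Integrating [|x| <= d + x ^+ 2 / d] bounds the [L^1] distance by the squared [L^2] distance
    without square roots. The parameter [d] stays free: small, it gives uniform continuity; large,
    it lets the kinetic term absorb the error. *)
Lemma pot_lipschitz u v d : 0 < d -> L2 T u -> L2 T v ->
  `|pot u - pot v| <=
  C * (n%:R * V * d + d^-1 * vip T (fun t => u t - v t) (fun t => u t - v t)).
Proof.
move=> d0 L2u L2v; have L2w := L2_sub L2u L2v.
have /row_L2P sw := L2w; set w := (fun t => u t - v t) in L2w sw *.
have IF := intB mD (integrable_F L2u) (integrable_F L2v).
rewrite /pot -(RintegralB mD (integrable_F L2u) (integrable_F L2v)).
apply: (le_trans (le_normr_Rintegral mD IF)).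
pose h i (t : X) := d + d^-1 * (w t 0 i * w t 0 i).
have Ih i : mu.-integrable D (EFin \o h i).
  exact: (intD mD (integrable_cst d) (intZ mD d^-1 (sqintM mD (sw i) (sw i)))).
have Ih' : mu.-integrable D (EFin \o (fun t => C * \sum_i h i t)).
  exact: (intZ mD C (int_sum mD (index_enum 'I_n) Ih)).
apply: (@le_trans _ _ (\int[mu]_(t in D) (C * \sum_i h i t))).
  apply: (le_Rintegral mD _ Ih'); first exact: (integrable_abse IF).
  move=> t Dt; have := F_lipschitz (v t) (w t) Dt.
  have -> : v t + w t = u t by rewrite /w addrC subrK.
  move=> /le_trans; apply; apply: ler_wpM2l => //.
  apply: ler_sum => i _; rewrite /h -expr2 -[_ ^+ 2]real_normK ?num_real//.
  move: `|w t 0 i| (normr_ge0 (w t 0 i)) => x x0.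
  rewrite -(ler_pM2l d0) mulrDr mulrA mulfV ?gt_eqF// mul1r.
  by have := sqr_ge0 (d - x); have := mulr_ge0 (ltW d0) x0; nra.
rewrite (RintegralZl _ mD (int_sum mD (index_enum 'I_n) Ih)).
rewrite (Rintegral_sum mD _ Ih) ler_wpM2l//.
rewrite le_eqVlt; apply/orP; left; apply/eqP.
transitivity (\sum_(i < n) (V * d + d^-1 * ip mu D (fun t : X => w t 0 i) (fun t : X => w t 0 i))).
  apply: eq_bigr => i _; rewrite (RintegralD mD (integrable_cst d)); last first.
    exact: (intZ mD d^-1 (sqintM mD (sw i) (sw i))).
  rewrite (RintegralZl _ mD (sqintM mD (sw i) (sw i))) Rintegral_cst_box.
  by rewrite [d * V]mulrC.
rewrite big_split/= sumr_const card_ord -mulr_sumr /vip big_ord1.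
by rewrite -[_ *+ n]mulr_natl mulrA.
Qed.

Lemma pot_unif_continuous e : 0 < e -> exists2 d, 0 < d &
  forall u v, L2 T u -> L2 T v ->
    vip T (fun t => u t - v t) (fun t => u t - v t) <= d -> `|pot u - pot v| <= e.
Proof.
move=> e0; have V0 := volume_gt0 T0.
(* With parameter [r] the first summand of [pot_lipschitz] is at most [e / 2], and so is the second
   for squared distances up to [d]. The added [1] keeps the denominators positive when [C] or [n] is
   zero. *)
pose K := C * (n%:R * V); have K0 : 0 <= K by rewrite !mulr_ge0// ltW.
pose r := e / (2 * (K + 1)); have r0 : 0 < r by rewrite divr_gt0// mulr_gt0// ltr_wpDl.
have C1 : 0 < C + 1 by rewrite ltr_wpDl.
pose d := e * r / (2 * (C + 1)); have d0 : 0 < d.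
  by apply: divr_gt0; apply: mulr_gt0.
exists d => // u v L2u L2v h; apply: (le_trans (pot_lipschitz r0 L2u L2v)).
rewrite mulrDr.
have h1 : C * (n%:R * V * r) <= e / 2.
  rewrite mulrA -/K /r; have K1 : 0 < K + 1 by rewrite ltr_wpDl.
  rewrite mulrA ler_pdivrMr ?mulr_gt0//.
  have -> : e / 2 * (2 * (K + 1)) = e * (K + 1) by field.
  by rewrite mulrC ler_wpM2l ?(ltW e0)// lerDl.
have h2 : C * (r^-1 * vip T (fun t => u t - v t) (fun t => u t - v t)) <= e / 2.
  apply: (@le_trans _ _ (C * (r^-1 * d))).
    by rewrite ler_wpM2l// ler_wpM2l// invr_ge0 ltW.
  have -> : C * (r^-1 * d) = e / 2 * (C / (C + 1)).
    by rewrite /d; field; rewrite !gt_eqF.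
  by rewrite ler_piMr ?divr_ge0 ?(ltW e0)// ler_pdivrMr// mul1r lerDl.
by apply: le_trans (lerD h1 h2) _; rewrite -splitr.
Qed.

Lemma cvg_pot (u_ : nat -> 'rV[R]_p -> 'rV[R]_n) u :
  (forall k, L2 T (u_ k)) -> L2 T u ->
  vip T (fun t => u_ k t - u t) (fun t => u_ k t - u t) @[k --> \oo] --> (0 : R) ->
  pot (u_ k) @[k --> \oo] --> pot u.
Proof.
move=> L2u_ L2u H; apply/cvgrPdist_le => e /pot_unif_continuous[d d0 Hd].
move/cvgrPdist_le : H => /(_ _ d0); apply: filterS => k.
rewrite sub0r normrN ger0_norm ?vip_ge0// distrC => h.
exact: (Hd _ _ (L2u_ k) L2u h).
Qed.

(** The intermediate points of [increment_partials] differ from [u] by at most [|s k * v 0 j|] in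
    coordinate [j], so continuity of the partial derivatives suffices. *)
Lemma cvg_F_quotient t (u v : 'rV[R]_n) (s : nat -> R) : box T t ->
  s @ \oo --> (0 : R) -> (forall k, s k != 0) ->
  (fun k => (s k)^-1 * (F t (u + s k *: v) - F t u)) @ \oo -->
    \sum_i v 0 i * partial i (F t : 'rV[R]_n -> R^o) u.
Proof.
move=> Dt s0 sn.
have /choice[xi Hxi] k := increment_partials u (s k *: v) (fun i x => @F_derivable t i x Dt).
have E k : (s k)^-1 * (F t (u + s k *: v) - F t u) =
    \sum_i v 0 i * partial i (F t : 'rV[R]_n -> R^o) (xi k i).
  have [_ ->] := Hxi k; rewrite mulr_sumr; apply: eq_bigr => i _.
  by rewrite mxE -[s k * _ * _]mulrA mulKf.
rewrite (funext E); apply: (@cvg_big _ _ _ _ _ (@add_continuous _) _ \oo) => i _.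
apply: cvgMl_tmp.
apply: (@continuous_cvg _ _ _ _ _ (fun k => xi k i)
  (partial i (F t : 'rV[R]_n -> R^o))); first exact: F_partial_continuous.
apply: row_cvgP => j; apply/cvgrPdist_le => e e0.
have sv0 : (fun k => s k * v 0 j) @ \oo --> (0 : R).
  by rewrite -[X in _ --> X](mul0r (v 0 j)); exact: cvgMr_tmp.
move/cvgrPdist_le : sv0 => /(_ _ e0); apply: filterS => k.
rewrite sub0r normrN distrC; apply: le_trans.
by have [/(_ i j)] := Hxi k; rewrite mxE.
Qed.

(** Dominated convergence: the Lipschitz bound on [F] dominates every quotient by [C] times the sum
    of the [|v t 0 i|], whatever the step. *)
Lemma cvg_pot_quotient u v (s : nat -> R) : L2 T u -> L2 T v ->
  s @ \oo --> (0 : R) -> (forall k, s k != 0) ->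
  (fun k => (s k)^-1 * (pot (fun t => u t + s k *: v t) - pot u)) @ \oo -->
  \int[mu]_(t in D) \sum_i v t 0 i * partial i (F t : 'rV[R]_n -> R^o) (u t).
Proof.
move=> L2u L2v s0 sn.
have L2uv k := L2_addZ (s k) L2u L2v.
have IF k := intB mD (integrable_F (L2uv k)) (integrable_F L2u).
have IFk k := intZ mD (s k)^-1 (IF k).
pose q k (t : X) := (s k)^-1 * (F t (u t + s k *: v t) - F t (u t)).
pose l (t : X) := \sum_i v t 0 i * partial i (F t : 'rV[R]_n -> R^o) (u t).
pose g (t : X) := C * \sum_i `|v t 0 i|.
have mq k : measurable_fun D (EFin \o q k) by exact: measurable_int (IFk k).
have ml : measurable_fun D (EFin \o l).
  apply/measurable_EFinP; apply: measurable_sum => i.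
  apply: measurable_funM; first exact: (L2_measurable i L2v).
  by apply: measurable_partialF => j; exact: L2_measurable.
have lim : {ae mu, forall t, D t -> (fun k => (EFin \o q k) t) @ \oo --> (EFin \o l) t}.
  apply: aeW => t Dt; apply: cvg_EFin; first exact: nearW.
  exact: cvg_F_quotient.
have Ig : mu.-integrable D (EFin \o g).
  exact: (intZ mD C (int_sum mD (index_enum 'I_n) (fun i => integrable_norm_coord i L2v))).
have dom : {ae mu, forall t k, D t -> (`|(EFin \o q k) t| <= (EFin \o g) t)%E}.
  apply: aeW => t k Dt; rewrite /= lee_fin /q normrM normfV.
  rewrite ler_pdivrMl ?normr_gt0// (le_trans (F_lipschitz _ _ Dt))//.
  rewrite /g mulrCA ler_wpM2l// mulr_sumr ler_sum// => i _.
  by rewrite mxE normrM.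
have [Il _ H] := dominated_convergence mD mq ml lim Ig dom.
have fin : (\int[mu]_(t in D) (EFin \o l) t)%E = (\int[mu]_(t in D) l t)%:E.
  by rewrite /Rintegral fineK// (integrable_fin_num mD Il).
rewrite fin in H.
rewrite (_ : (fun k => (s k)^-1 * _) =
  (fun k => fine (\int[mu]_(t in D) (EFin \o q k) t)%E)); first exact: (fine_cvg H).
apply/funext => k /=; rewrite /pot.
rewrite -(RintegralB mD (integrable_F (L2uv k)) (integrable_F L2u)).
by rewrite -(RintegralZl _ mD (IF k)).
Qed.

(** * The Euler-Lagrange equation *)

Definition dpot u (t : 'rV[R]_p) : 'rV[R]_n := gradient (F t) (u t).

Lemma L2_dpot u : L2 T u -> L2 T (dpot u).
Proof.
move=> L2u; apply/row_L2P => i.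
apply: (@sqint_bounded _ _ _ _ _ mD C _ (lebesgue_box_lty T0)).
  rewrite (_ : (fun t => _) = fun t : X => partial i (F t : 'rV[R]_n -> R^o) (u t)).
    by apply: measurable_partialF => j; exact: L2_measurable.
  by apply/funext => t; rewrite mxE.
by move=> t Dt; rewrite mxE dF_bound.
Qed.

Definition energy_pair u (G : 'rV[R]_p -> 'M[R]_(n, p)) : R := 2^-1 * vip T G G + pot u.

(** Variations in direction [v] with steps of a fixed sign [sg] give a one-sided inequality in the
    limit; the two signs together give equality. *)
Lemma euler_lagrange u G v H : sobolev_pair T u G -> sobolev_pair T v H ->
  (forall w K, sobolev_pair T w K -> energy_pair u G <= energy_pair w K) ->
  vip T G H = - vip T (dpot u) v.
Proof.
move=> uG vH min.
have [L2u L2G] := sobolev_pair_L2 uG; have [L2v L2H] := sobolev_pair_L2 vH.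
pose L := \int[mu]_(t in D) \sum_i v t 0 i * partial i (F t : 'rV[R]_n -> R^o) (u t).
have LE : L = vip T (dpot u) v.
  rewrite -(Rintegral_mxdot (L2_dpot L2u) L2v); apply: eq_Rintegral => t _.
  by rewrite /mxdot big_ord1; apply: eq_bigr => i _; rewrite mxE mulrC.
suff H0 (sg : R) : sg ^+ 2 = 1 -> 0 <= sg * (vip T G H + L).
  apply/eqP; rewrite -addr_eq0 -LE eq_le.
  have := H0 1; rewrite expr1n mul1r => -> //; rewrite andbT.
  by have := H0 (-1); rewrite sqrrN expr1n mulN1r oppr_ge0 => ->.
move=> sg2; have sg0 : sg != 0 by rewrite -sqrf_eq0 sg2 oner_eq0.
pose s k : R := sg * k.+1%:R^-1.
have sn k : s k != 0 by rewrite mulf_neq0// invr_eq0 pnatr_eq0.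
have s0 : s @ \oo --> (0 : R).
  by rewrite -[X in _ --> X](mulr0 sg); apply: cvgMl_tmp; exact: cvg_harmonic.
have Q := cvg_pot_quotient L2u L2v s0 sn.
pose r k := sg * (vip T G H + 2^-1 * s k * vip T H H +
  (s k)^-1 * (pot (fun t => u t + s k *: v t) - pot u)).
have rl : r @ \oo --> sg * (vip T G H + L).
  rewrite -[vip T G H](addr0 (vip T G H)) -[X in _ + X + L](mul0r (vip T H H)).
  rewrite -[X in _ + X * _ + L](mulr0 2^-1).
  apply: cvgMl_tmp; apply: cvgD; last exact: Q.
  apply: cvgD; first exact: cvg_cst.
  by apply: cvgMr_tmp; exact: cvgMl_tmp.
rewrite -(cvg_lim (@Rhausdorff R) rl); apply: limr_ge; first exact: cvgP rl.
apply: nearW => k.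
have := min _ _ (sobolev_pair_addZ T0 (s k) uG vH).
rewrite /energy_pair (vip_addZ (s k) L2G L2H) -subr_ge0.
(* As [sg / s k] is [k.+1], [r k] is [k.+1] times the excess of energy of the varied pair, hence
   nonnegative. *)
have -> : r k = k.+1%:R * (2^-1 * (vip T G G + 2 * s k * vip T G H + s k ^+ 2 * vip T H H) +
    pot (fun t => u t + s k *: v t) - (2^-1 * vip T G G + pot u)).
  have -> : k.+1%:R = sg * (s k)^-1 by rewrite /s invfM invrK mulrA mulfV// mul1r.
  rewrite /r -[RHS]mulrA; congr (_ * _).
  move: (pot (fun t => u t + s k *: v t)) (pot u) (s k) (sn k) => P1 P2 x x0.
  by field.
by move=> h; rewrite mulr_ge0.
Qed.

(** * Mean values, coercivity and bounds on sublevel sets *)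

Lemma L2_cst (w : 'rV[R]_n) : L2 T (fun=> w).
Proof. by apply/row_L2P => i; exact: sqint_cst. Qed.

Lemma vip_cst (w : 'rV[R]_n) : vip T (fun=> w) (fun=> w) = V * \sum_i w 0 i ^+ 2.
Proof.
rewrite /vip big_ord1 mulr_sumr; apply: eq_bigr => i _.
by rewrite /ip Rintegral_cst_box mulrC expr2.
Qed.

(** The coefficient on [cas 0 = 1], written so that the constant [mean u] is the projection on
    [zbox p 0]. *)
Definition mean u : 'rV[R]_n :=
  \row_i (ip mu D (fun t : X => u t 0 i) (cas T 0) / V).

Lemma poincare u G : sobolev_pair T u G ->
  vip T (fun t => u t - mean u) (fun t => u t - mean u) <= gap_constant T * vip T G G.
Proof.
move=> uG; have [L2u L2G] := sobolev_pair_L2 uG.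
have /row_L2P su := L2u; have /L2P sG := L2G.
rewrite /vip big_ord1 mulr_sumr; apply: ler_sum => i _.
have := spectral_gap T0 0 (su i) (sG i) (sobolev_pair_weakly_derives T0 i uG).
rewrite expr1n divr1; apply: le_trans; rewrite le_eqVlt; apply/orP; left; apply/eqP.
have E t : (u t - mean u) 0 i =
    u t 0 i - fproj T (zbox p 0) (fun t : X => u t 0 i) t.
  rewrite !mxE /fproj /cas_sum (perm_big [:: 0]).
    by rewrite big_seq1 cas0 mulr1.
  apply: uniq_perm => // [|m]; first exact: zbox_uniq.
  rewrite mem_zbox inE; apply/forallP/eqP => [H|-> a]; last by rewrite mxE.
  apply/rowP => a; rewrite mxE; have := H a; rewrite leqn0 absz_eq0.
  by move/eqP.
by apply: eq_ip => t _; exact: E.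
Qed.

Lemma vip_add_le (f g : 'rV[R]_p -> 'rV[R]_n) : L2 T f -> L2 T g ->
  vip T (fun t => f t + g t) (fun t => f t + g t) <= 2 * vip T f f + 2 * vip T g g.
Proof.
move=> L2f L2g.
rewrite (_ : (fun t => f t + g t) = (fun t => f t + 1 *: g t)); last first.
  by apply/funext => t; rewrite scale1r.
have := vip_ge0 T (fun t => f t - g t).
by rewrite (vip_addZ 1 L2f L2g) (vip_subE L2f L2g) => h; lra.
Qed.

Hypothesis F_coercive : forall M : R, exists r : R, forall w : 'rV[R]_n,
  r < enorm w -> M <= pot (fun=> w).

(** Beyond the radius given by coercivity the potential is nonnegative; within it the Lipschitz
    estimate starting from [0] applies. That radius may be negative, hence [|r|]. *)
Lemma pot_cst_bounded_below : exists P, forall w : 'rV[R]_n, - P <= pot (fun=> w).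
Proof.
have [r Hr] := F_coercive 0; have V0 := volume_gt0 T0.
have B0 : 0 <= B by apply: (le_trans (normr_ge0 (F 0 0))); apply: F_bound => a;
  rewrite mxE lexx ltW.
exists (V * (B + C * (n%:R * `|r|))) => w.
have [rw|wr] := ltP r (enorm w).
  apply: le_trans (Hr _ rw); rewrite oppr_le0.
  by rewrite mulr_ge0 ?(ltW V0)// addr_ge0// !mulr_ge0.
have wi i : `|w 0 i| <= `|r|.
  by rewrite (le_trans (ler_enorm w i))// (le_trans wr)// ler_norm.
have Ic := integrable_cst (- (B + C * (n%:R * `|r|))).
rewrite -mulrN [leLHS]mulrC -Rintegral_cst_box.
apply: (le_Rintegral mD Ic (integrable_F (L2_cst w))) => t Dt.
have := F_lipschitz 0 w Dt; rewrite add0r => h1; have h2 := F_bound Dt.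
have h3 : C * (\sum_i `|w 0 i|) <= C * (n%:R * `|r|).
  rewrite ler_wpM2l// mulr_natl -[X in _ *+ X]card_ord -sumr_const.
  by apply: ler_sum.
move: h1 h2; rewrite !ler_norml => /andP[h4 _] /andP[h5 _].
by rewrite opprD; lra.
Qed.

(** Replacing [u] by [mean u] in the potential costs a constant plus [C / d] times the squared
    oscillation, at most [C * k / d * vip T G G] by Poincaré-Wirtinger. The choice of [d] makes this
    factor at most [1/4], half of the kinetic coefficient. *)
Lemma energy_lower_bound : exists Q, forall u G, sobolev_pair T u G ->
  4^-1 * vip T G G - Q + pot (fun=> mean u) <= energy_pair u G.
Proof.
pose k := gap_constant T; have k0 : 0 <= k by apply: sumr_ge0 => a _; exact: sqr_ge0.
pose d := 4 * (C * k) + 1.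
have Ck : 0 <= C * k by exact: mulr_ge0.
have d0 : 0 < d by rewrite ltr_wpDl// mulr_ge0.
exists (C * (n%:R * V * d)) => u G uG; have [L2u L2G] := sobolev_pair_L2 uG.
have := pot_lipschitz d0 L2u (L2_cst (mean u)).
rewrite mulrDr => h; have P := poincare uG.
have h1 : C * (d^-1 * vip T (fun t => u t - mean u) (fun t => u t - mean u)) <=
    4^-1 * vip T G G.
  apply: (@le_trans _ _ (C * (d^-1 * (k * vip T G G)))).
    by rewrite ler_wpM2l// ler_wpM2l// invr_ge0 ltW.
  rewrite [X in C * X]mulrA mulrA ler_wpM2r ?vip_ge0//.
  rewrite mulrCA mulrC ler_pdivrMr// /d; lra.
have := ler_norm (- (pot u - pot (fun=> mean u))); rewrite normrN /energy_pair => h2.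
by move: (vip T G G) h1 => x h1; lra.
Qed.

Lemma energy_bounded_below : exists Q, forall u G, sobolev_pair T u G ->
  - Q <= energy_pair u G.
Proof.
have [P HP] := pot_cst_bounded_below; have [Q HQ] := energy_lower_bound.
exists (Q + P) => u G uG; have := HQ _ _ uG; have := HP (mean u).
by have := vip_ge0 T G; lra.
Qed.

(** The lower bound on the potential at constants leaves a bound on the gradient. Dropping the
    gradient instead bounds the potential at the mean by [c + Q], so coercivity bounds the mean, and
    Poincaré-Wirtinger the rest of [u]. *)
Lemma energy_sublevel_bounded (c : R) : exists M, forall u G, sobolev_pair T u G ->
  energy_pair u G <= c -> vip T u u <= M /\ vip T G G <= M.
Proof.
have [P HP] := pot_cst_bounded_below; have [Q HQ] := energy_lower_bound.
(* The [1] makes a mean of norm above [r] contradict the bound [c + Q] on its potential. *)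
have [r Hr] := F_coercive (c + Q + 1).
have k0 : 0 <= gap_constant T by apply: sumr_ge0 => a _; exact: sqr_ge0.
have V0 := volume_gt0 T0.
pose g := 4 * (c + Q + P); pose m := 2 * (gap_constant T * g) + 2 * (V * (n%:R * `|r| ^+ 2)).
exists (Num.max g m) => u G uG uc.
have [L2u L2G] := sobolev_pair_L2 uG.
have h1 := HQ _ _ uG; have h2 := HP (mean u); have h3 := vip_ge0 T G.
have Gg : vip T G G <= g by rewrite /g; lra.
rewrite !le_max Gg orTb; split => //; apply/orP; right.
have wr : enorm (mean u) <= r.
  by rewrite leNgt; apply/negP => /Hr h4; lra.
have L2m := L2_cst (mean u).
rewrite (_ : u = (fun t => (u t - mean u) + mean u)); last first.
  by apply/funext => t; rewrite subrK.
apply: (le_trans (vip_add_le (L2_sub L2u L2m) L2m)).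
apply: lerD; rewrite ler_wpM2l//.
  by apply: (le_trans (poincare uG)); rewrite ler_wpM2l.
rewrite vip_cst ler_wpM2l ?(ltW V0)// mulr_natl -[X in _ *+ X]card_ord -sumr_const.
apply: ler_sum => i _; rewrite -[leLHS]real_normK ?num_real// lerXn2r ?nnegrE//.
by rewrite (le_trans (ler_enorm (mean u) i))// (le_trans wr)// ler_norm.
Qed.

Lemma vip_scale m k c (f : 'rV[R]_p -> 'M[R]_(m, k)) : L2 T f ->
  vip T (fun t => c *: f t) (fun t => c *: f t) = c ^+ 2 * vip T f f.
Proof.
move=> /L2P sf; rewrite /vip mulr_sumr; apply: eq_bigr => i _.
rewrite mulr_sumr; apply: eq_bigr => j _; have sij := sf i j.
have scij := sqintZ mD c sij.
rewrite -[in RHS]mulrA -(ipZl mD c sij sij) ipC -(ipZl mD c sij scij).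
by apply: eq_ip => t _; rewrite ?mxE.
Qed.

Lemma rellich_vector (U : set_system nat) (u : nat -> 'rV[R]_p -> 'rV[R]_n)
    (G : nat -> 'rV[R]_p -> 'M[R]_(n, p)) (M : R) : UltraFilter U ->
  (forall k, sobolev_pair T (u k) (G k)) ->
  (forall k, vip T (u k) (u k) <= M) -> (forall k, vip T (G k) (G k) <= M) ->
  forall e, 0 < e -> exists2 A, U A & forall i j, A i -> A j ->
    vip T (fun t => u i t - u j t) (fun t => u i t - u j t) <= e.
Proof.
move=> UU uG uM GM e e0.
(* Each of the [n] coordinates gets one share of [e]; [n.+1] also covers [n = 0]. *)
have e'0 : 0 < e / n.+1%:R by rewrite divr_gt0.
have su k i : sqint (fun t : X => u k t 0 i).
  by have [/row_L2P] := sobolev_pair_L2 (uG k).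
have sG k i a : sqint (fun t : X => G k t i a).
  by have [_ /L2P] := sobolev_pair_L2 (uG k).
have /choice[A HA] : forall i : 'I_n, exists A, U A /\ forall k l, A k -> A l ->
    ip mu D (fun t : X => u k t 0 i - u l t 0 i) (fun t : X => u k t 0 i - u l t 0 i)
      <= e / n.+1%:R.
  move=> i.
  have h1 k : ip mu D (fun t : X => u k t 0 i) (fun t : X => u k t 0 i) <= M.
    apply: le_trans (uM k); rewrite /vip big_ord1 (bigD1 i)//= lerDl.
    by apply: sumr_ge0 => j _; exact: ip_ge0.
  have h2 k : \sum_a ip mu D (fun t : X => G k t i a) (fun t : X => G k t i a) <= M.
    apply: le_trans (GM k); rewrite /vip (bigD1 i)//= lerDl.
    by apply: sumr_ge0 => j _; apply: sumr_ge0 => a _; exact: ip_ge0.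
  have [A UA HA] := rellich T0 UU (fun k => su k i) (fun k a => sG k i a)
    (fun k => sobolev_pair_weakly_derives T0 i (uG k)) h1 h2 e'0.
  by exists A.
exists [set k | forall i, A i k]; first by apply: filter_forall => i; case: (HA i).
move=> k l /= Ak Al; rewrite /vip big_ord1.
apply: (@le_trans _ _ (\sum_(i < n) (e / n.+1%:R))).
  apply: ler_sum => i _; have [_ /(_ k l (Ak i) (Al i))] := HA i.
  apply: le_trans; rewrite le_eqVlt; apply/orP; left; apply/eqP.
  by apply: eq_ip => t _; rewrite !mxE.
rewrite sumr_const card_ord -[leLHS]mulr_natl mulrA ler_pdivrMr// mulrC ler_wpM2l ?(ltW e0)//.
by rewrite ler_nat.
Qed.

(** * Existence of a minimizing pair *)

Lemma sobolev_pair0 : sobolev_pair T (fun=> 0 : 'rV[R]_n) (fun=> 0).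
Proof.
split; first exact: L2_cst.
have L20 : L2 T (fun=> 0 : 'M[R]_(n, p)).
  by apply/L2P => i a; apply: (eq_sqint mD _ (sqint_cst 0)) => t _; rewrite mxE.
have ip0 f : ip mu D (fun=> 0) f = 0.
  rewrite /ip (@eq_Rintegral _ _ _ mu D (fun=> 0)); last by move=> t _; rewrite mul0r.
  by rewrite /Rintegral integral0.
apply/(weak_gradientP T0 _ (L2_cst 0)); split=> [|f a sf]; first exact: L20.
rewrite !big1 ?oppr0// => i _.
  rewrite -[RHS](ip0 (fun t : X => f t 0 i)).
  by apply: eq_ip => t _; rewrite ?mxE.
rewrite -[RHS](ip0 (fun t : X => partial a f t 0 i)).
by apply: eq_ip => t _; rewrite ?mxE.
Qed.

(* Parallelogram identity for the gradients, tested at the midpoint. *)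
Lemma gradient_gap u G v H (iota eps d e : R) :
  sobolev_pair T u G -> sobolev_pair T v H ->
  (forall w K, sobolev_pair T w K -> iota <= energy_pair w K) ->
  energy_pair u G <= iota + eps -> energy_pair v H <= iota + eps ->
  (forall f g, L2 T f -> L2 T g ->
     vip T (fun t => f t - g t) (fun t => f t - g t) <= d -> `|pot f - pot g| <= e) ->
  vip T (fun t => v t - u t) (fun t => v t - u t) <= d ->
  vip T (fun t => H t - G t) (fun t => H t - G t) <= 8 * eps + 8 * e.
Proof.
move=> uG vH low Eu Ev unif uvd.
have [L2u L2G] := sobolev_pair_L2 uG; have [L2v L2H] := sobolev_pair_L2 vH.
have L2vu := L2_sub L2v L2u; have L2HG := L2_sub L2H L2G.
pose w t := u t + 2^-1 *: (v t - u t); pose K t := G t + 2^-1 *: (H t - G t).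
have wK : sobolev_pair T w K.
  rewrite (_ : w = fun t => u t + 2^-1 *: (v t + (-1) *: u t)); last first.
    by apply/funext => t; rewrite /w scaleN1r.
  rewrite (_ : K = fun t => G t + 2^-1 *: (H t + (-1) *: G t)); last first.
    by apply/funext => t; rewrite /K scaleN1r.
  exact: (sobolev_pair_addZ T0 2^-1 uG (sobolev_pair_addZ T0 (-1) vH uG)).
have [L2w L2K] := sobolev_pair_L2 wK.
have d0 := vip_ge0 T (fun t => v t - u t).
have quarter : 4^-1 * vip T (fun t => v t - u t) (fun t => v t - u t) <= d by lra.
have wu : `|pot w - pot u| <= e.
  apply: unif => //; rewrite (_ : (fun t => w t - u t) = (fun t => 2^-1 *: (v t - u t))).
    by rewrite (vip_scale _ L2vu); apply: le_trans quarter; lra.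
  by apply/funext => t; rewrite /w addrAC subrr add0r.
have wv : `|pot w - pot v| <= e.
  apply: unif => //; rewrite (_ : (fun t => w t - v t) = (fun t => (- 2^-1) *: (v t - u t))).
    by rewrite (vip_scale _ L2vu) sqrrN; apply: le_trans quarter; lra.
  by apply/funext => t; rewrite /w; apply/rowP => i; rewrite !mxE; field.
(* [vip T K K] is the average of [vip T G G] and [vip T H H] minus a quarter of the squared distance
   of the gradients, and the potential of [w] exceeds the average of the other two by at most [e].
   Comparison with [iota] leaves an eighth of that squared distance below [eps + e]. *)
have := low _ _ wK; rewrite /energy_pair (vip_addZ 2^-1 L2G L2HG).
have -> : vip T G (fun t => H t - G t) = vip T H G - vip T G G.
  by rewrite vipC (vip_subl L2H L2G L2G).
rewrite (vip_subE L2H L2G); move: Eu Ev; rewrite /energy_pair => Eu Ev.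
move: wu wv; rewrite !ler_norml => /andP[_ wu] /andP[_ wv] h.
lra.
Qed.

(** Once functions and gradients converge strongly, the energy passes to the limit, and the limit,
    still a pair, attains the infimum. *)
Lemma energy_minimizer : exists u G, sobolev_pair T u G /\
  forall v H, sobolev_pair T v H -> energy_pair u G <= energy_pair v H.
Proof.
pose S : set R := [set x | exists u G, sobolev_pair T u G /\ x = energy_pair u G].
have [Q HQ] := energy_bounded_below.
have infS : has_inf S.
  split.
    exists (energy_pair (fun=> 0) (fun=> 0)); exists (fun=> 0), (fun=> 0).
    by split => //; exact: sobolev_pair0.
  by exists (- Q) => _ [u [G [uG ->]]]; exact: HQ.
pose iota := inf S.
have low w K : sobolev_pair T w K -> iota <= energy_pair w K.
  by move=> wK; apply: ge_inf; [case: infS|exists w, K].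
have /choice[z Hz] : forall k : nat, exists z : ('rV[R]_p -> 'rV[R]_n) * ('rV[R]_p -> 'M[R]_(n, p)),
    sobolev_pair T z.1 z.2 /\ energy_pair z.1 z.2 <= iota + k.+1%:R^-1.
  move=> k; have k0 : 0 < k.+1%:R^-1 :> R by rewrite invr_gt0.
  have [_ [u [G [uG ->]]] H] := inf_adherent k0 infS.
  by exists (u, G); split => //; exact: ltW.
have zG k : sobolev_pair T (z k).1 (z k).2 by case: (Hz k).
have [M HM] := energy_sublevel_bounded (iota + 1).
have HMz k := HM _ _ (zG k).
have zM k : vip T (z k).1 (z k).1 <= M /\ vip T (z k).2 (z k).2 <= M.
  apply: HMz; have [_ /le_trans] := Hz k; apply.
  by rewrite lerD2l invf_le1// ler1n.
have [U [UU oU]] := ultraFilterLemma (@eventually_filter).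
have /choice[A HA] : forall l : nat, exists A, U A /\ forall i j, A i -> A j ->
    vip T (fun t => (z i).1 t - (z j).1 t) (fun t => (z i).1 t - (z j).1 t) <= l.+1%:R^-1.
  move=> l; have l0 : 0 < l.+1%:R^-1 :> R by rewrite invr_gt0.
  have [A UA HA] := rellich_vector UU zG (fun k => (zM k).1) (fun k => (zM k).2) l0.
  by exists A.
(* The ultrafilter contains the tails, so [A 0], ..., [A k] and the indices from [k] on have a
   common element: the chosen [s] gives a genuine sequence, Cauchy in [L^2] and still minimizing. *)
have /choice[s Hs] : forall k : nat, exists j, (k <= j)%N /\ forall l : 'I_k.+1, A l j.
  move=> k; have U1 : U [set j | (k <= j)%N] by apply: oU; exact: nbhs_infty_ge.
  have U2 : U [set j | forall l : 'I_k.+1, A l j].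
    by apply: filter_forall => l; case: (HA l).
  by have [j [? ?]] := filter_ex (filterI U1 U2); exists j.
pose u_ k := (z (s k)).1; pose G_ k := (z (s k)).2.
have uG_ k : sobolev_pair T (u_ k) (G_ k) by exact: zG.
have L2u_ k : L2 T (u_ k) by case: (sobolev_pair_L2 (uG_ k)).
have L2G_ k : L2 T (G_ k) by case: (sobolev_pair_L2 (uG_ k)).
have E_ k N : (N <= k)%N -> energy_pair (u_ k) (G_ k) <= iota + N.+1%:R^-1.
  move=> Nk; have [_ /le_trans] := Hz (s k); apply.
  rewrite lerD2l lef_pV2 ?posrE// ler_nat ltnS.
  by apply: leq_trans Nk _; case: (Hs k).
have cu N i j : (N <= i)%N -> (N <= j)%N ->
    vip T (fun t => u_ i t - u_ j t) (fun t => u_ i t - u_ j t) <= N.+1%:R^-1.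
  move=> Ni Nj; have [_ HAN] := HA N.
  have [_ /(_ (Ordinal (Ni : N < i.+1)%N)) Ai] := Hs i.
  have [_ /(_ (Ordinal (Nj : N < j.+1)%N)) Aj] := Hs j.
  exact: HAN.
have small (e : R) : 0 < e -> exists N : nat, N.+1%:R^-1 <= e.
  move=> e0; have [N _ HN] : \forall N \near \oo, N.+1%:R^-1 < e.
    exact: near_infty_natSinv_lt (PosNum e0).
  by exists N; rewrite ltW//; exact: (HN N (leqnn N)).
have [u L2u u_u] : exists2 u, L2 T u &
    vip T (fun t => u_ k t - u t) (fun t => u_ k t - u t) @[k --> \oo] --> (0 : R).
  apply: (vector_L2_complete L2u_) => e /small[N HN]; exists N => i j Ni Nj.
  exact: le_trans (cu N i j Ni Nj) HN.
have [G L2G G_G] : exists2 G, L2 T G &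
    vip T (fun t => G_ k t - G t) (fun t => G_ k t - G t) @[k --> \oo] --> (0 : R).
  apply: (vector_L2_complete L2G_) => e e0.
  (* [gradient_gap] will bound the squared distance by [8 * (e / 16) + 8 * (e / 16) = e]. *)
  have e16 : 0 < e / 16 by rewrite divr_gt0.
  have [d d0 unif] := pot_unif_continuous e16.
  have [N1 HN1] := small _ d0; have [N2 HN2] := small _ e16.
  exists (maxn N1 N2) => i j; rewrite !geq_max => /andP[i1 i2] /andP[j1 j2].
  have := gradient_gap (uG_ j) (uG_ i) low (E_ j N2 j2) (E_ i N2 i2) unif
    (le_trans (cu N1 i j i1 j1) HN1).
  by move/le_trans; apply; move: HN2; move: (N2.+1%:R^-1 : R) => x; lra.
have uG := sobolev_pair_closed T0 uG_ L2u L2G u_u G_G.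
exists u, G; split=> [|v H vH]; first exact: uG.
have Ecvg : (fun k => energy_pair (u_ k) (G_ k)) @ \oo --> energy_pair u G.
  apply: cvgD; last exact: cvg_pot.
  by apply: cvgMl_tmp; exact: cvg_vip.
apply: le_trans (low _ _ vH); apply/ler_addgt0Pr => e e0.
have [N HN] := small _ e0.
rewrite -(cvg_lim (@Rhausdorff R) Ecvg); apply: limr_le; first exact: cvgP Ecvg.
near=> k; have Nk : (N <= k)%N by near: k; exact: nbhs_infty_ge.
by apply: (le_trans (E_ k N Nk)); rewrite lerD2l.
Unshelve. all: by end_near. Qed.

End potential.

(** * From the minimizing pair to the boundary value problem *)

Theorem theorem4 (R : realType) (p n : nat) (T : 'rV[R]_p)
    (hT : forall i, 0 < T 0 i)
    (F : 'rV[R]_p -> 'rV[R]_n -> R)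
    (hFmeas : forall u, measurable_fun (box T : set (lebesgue_space R p))
                          (fun t => F t u))
    (hFC1 : forall t, box T t -> Cn 1 (F t : 'rV[R]_n -> R^o))
    (a a' : R -> R)
    (ha_cont : {within [set r : R | 0 <= r], continuous a})
    (ha_deriv : continuous_derivative_within
                  [set r : R^o | 0 <= r] (1 : R^o) a a')
    (ha_ge0 : forall r, 0 <= r -> 0 <= a r)
    (ha'_bounded : exists M, forall r, 0 <= r -> a' r <= M)
    (b : 'rV[R]_p -> R)
    (hb_cont : {within box T, continuous b})
    (hb_ge0 : forall t, box T t -> 0 <= b t)
    (hF_ab : forall t u, box T t -> `|F t u| <= a (enorm u) * b t)
    (hgradF_ab : forall t u, box T t ->
       enorm (gradient (F t) u) <= a (enorm u) * b t)
    (g : 'rV[R]_p -> R)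
    (hg : C1_box T g)
    (hgradF_g : forall t u, box T t -> enorm (gradient (F t) u) <= g t)
    (hlsc : H1_weakly_lsc T (potential_action T F))
    (hcoercive : forall M : R, exists r : R, forall u : 'rV[R]_n, r < enorm u ->
       (M%:E <= \int[@lebesgue R p]_(t in box T) (F t u)%:E)%E) :
  exists u : 'rV[R]_p -> 'rV[R]_n,
    periodic_solution T F u /\
    forall v, H1 T v -> (action T F u <= action T F v)%E.
Proof.
(* Continuity on the compact box turns [b] into a bound on [F] at [u = 0] and [g] into a uniform
   bound on the partial derivatives of [F]. *)
have [Bb Bb0 Hb] := box_bounded hb_cont; have [C C0 HC] := box_bounded hg.1.
pose B := a (enorm (0 : 'rV[R]_n)) * Bb.
have F_bound t : box T t -> `|F t 0| <= B.
  move=> Dt; apply: (le_trans (hF_ab t 0 Dt)); apply: ler_wpM2l.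
    exact/ha_ge0/sqrtr_ge0.
  exact: le_trans (ler_norm _) (Hb t Dt).
have dF_bound t (u : 'rV[R]_n) i : box T t ->
    `|partial i (F t : 'rV[R]_n -> R^o) u| <= C.
  move=> Dt; have := ler_enorm (gradient (F t) u) i; rewrite mxE => /le_trans; apply.
  apply: (le_trans (hgradF_g t u Dt)); exact: le_trans (ler_norm _) (HC t Dt).
have IF u : L2 T u -> (@lebesgue R p).-integrable (box T) (EFin \o (fun t => F t (u t))).
  by move=> L2u; exact: (integrable_F hT hFmeas hFC1 F_bound dF_bound L2u).
have F_coercive (M : R) : exists r : R, forall w : 'rV[R]_n,
    r < enorm w -> M <= pot T F (fun=> w).
  have [r Hr] := hcoercive M; exists r => w /Hr.
  have Iw := IF _ (L2_cst hT w).
  by rewrite -lee_fin /pot /Rintegral fineK// (integrable_fin_num (measurable_box T) Iw).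
have wgP (v : 'rV[R]_p -> 'rV[R]_n) : H1 T v -> sobolev_pair T v (weak_gradient T v).
  by move=> [L2v ex]; split; [exact: L2v|exact: (xgetPex _ ex)].
have actionE v : H1 T v -> action T F v = (energy_pair T F v (weak_gradient T v))%:E.
  move=> /wgP vG; have [L2v L2G] := sobolev_pair_L2 vG.
  have mD := measurable_box T.
  have I1 := intZ mD 2^-1 (integrable_mxdot L2G L2G).
  have I2 := IF v L2v.
  rewrite /energy_pair -(Rintegral_mxdot L2G L2G) -(RintegralZl _ mD (integrable_mxdot L2G L2G)).
  rewrite /pot -(RintegralD mD I1 I2) /Rintegral fineK//.
  exact: (integrable_fin_num mD (intD mD I1 I2)).
have [u [G [uG min]]] := energy_minimizer hT hFmeas hFC1 F_bound C0 dF_bound F_coercive.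
have H1u : H1 T u by case: uG => L2u wG; split; [exact: L2u|exists G; exact: wG].
have uW : sobolev_pair T u (weak_gradient T u) by exact: wgP.
have [L2u L2G] := sobolev_pair_L2 uG; have [_ L2W] := sobolev_pair_L2 uW.
(* [G] and the selected gradient have the same products with square integrable fields; they are
   exchanged in one argument of [vip] at a time. *)
have EW : energy_pair T F u (weak_gradient T u) = energy_pair T F u G.
  rewrite /energy_pair (sobolev_pair_vip hT uW uG L2W) vipC.
  by rewrite (sobolev_pair_vip hT uW uG L2G).
exists u; split; last first.
  by move=> v H1v; rewrite !actionE// lee_fin EW; apply: min; exact: wgP.
have L2d := L2_dpot hT hFmeas hFC1 dF_bound L2u.
split; first exact: H1u.
(* The weak Laplacian is taken to be the gradient of [F] along [u] itself: the equation then holds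
   at every point, and the content is the weak identity. *)
exists (dpot F u); split; last by apply: aeW => t _.
split; first exact: L2d.
(* A smooth periodic [v] with its classical derivatives is a pair, so the Euler-Lagrange identity in
   direction [v] is the weak identity. *)
move=> v sv; have vH := smooth_sobolev_pair hT sv.
have [L2v L2H] := sobolev_pair_L2 vH.
rewrite (Rintegral_mxdot L2W L2H) (Rintegral_mxdot L2d L2v).
apply: (euler_lagrange hT hFmeas hFC1 F_bound C0 dF_bound uW vH).
by move=> w K wK; rewrite EW; exact: min.
Qed.
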